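(* Let $B$, $C$, $R$ be finite-dimensional quantum systems and let $\rho_{BCR}$ be any state (density operator) on $B\otimes C\otimes R$. Then \begin{align*} I(C:R|B)_{\rho} &\geq \lim_{n \rightarrow \infty} \min_{\Lambda_n : B^n \rightarrow B^nC^n} \frac{1}{n} S\big(\rho_{BCR}^{\otimes n}\,\big\|\, (\Lambda_n\otimes \mathrm{id}_{R^n})(\rho_{BR}^{\otimes n})\big) \\ &\geq \min_{\Lambda : B \rightarrow BC} \mathbb{M}S\big( \rho_{BCR} \,\big\|\, (\Lambda \otimes \mathrm{id}_R)(\rho_{BR}) \big) \\ &\geq \min_{\Lambda : B \rightarrow BC} S_{1/2}\big(\rho_{BCR} \,\big\|\, (\Lambda \otimes \mathrm{id}_R)(\rho_{BR})\big), \end{align*} where the minima are over quantum channels (completely positive trace-preserving maps) $\Lambda_n$ from $B^{\otimes n}$ to $B^{\otimes n}\otimes C^{\otimes n}$, respectively $\Lambda$ from $B$ to $B\otimes C$.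
   Context: $\rho_{BR}$ and other reduced states are obtained by partial trace. $S(X)_\rho=-\mathrm{tr}(\rho_X\log\rho_X)$ is the von Neumann entropy and the conditional mutual information is $I(C:R|B)_\rho = S(BC)_\rho+S(BR)_\rho-S(BCR)_\rho-S(B)_\rho$. The quantum relative entropy is $S(\rho\|\sigma)=\mathrm{tr}[\rho(\log\rho-\log\sigma)]$ (equal to $+\infty$ if the support of $\rho$ is not contained in that of $\sigma$). The measured relative entropy is $\mathbb{M}S(\rho\|\sigma)=\max_{M\in\mathcal{M}} S(M(\rho)\|M(\sigma))$, where $\mathcal{M}$ is the set of all quantum-classical channels $M(\rho)=\sum_k \mathrm{tr}(M_k\rho)|k\rangle\langle k|$ with $\{M_k\}$ a POVM and $\{|k\rangle\}$ an orthonormal basis. The order-$1/2$ Rényi relative entropy is $S_{1/2}(\rho\|\sigma)=-2\log F(\rho,\sigma)$ with fidelity $F(\rho,\sigma)=\mathrm{tr}[(\sigma^{1/2}\rho\sigma^{1/2})^{1/2}]$. $X^n$ denotes $X^{\otimes n}$, and $\mathrm{id}_R$ the identity channel on $R$. *)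

(* Defs.v *)
From HB Require Import structures.
From mathcomp Require Import all_boot all_order all_algebra.
From mathcomp Require Import sesquilinear spectral.
From mathcomp Require Import all_classical all_reals all_analysis.
From mathcomp Require Import complex.

Set Implicit Arguments.
Unset Strict Implicit.
Unset Printing Implicit Defensive.

Import Order.TTheory GRing.Theory Num.Theory.
Local Open Scope ring_scope.

Section Quantum.
Variable RR : realType.
Local Notation CC := (RR[i]).

(* Operators on the Hilbert space C^X of a finite quantum system with
   (orthonormal basis indexed by the) finite type X. *)
Definition op (X : finType) := 'M[CC]_#|X|.

Definition mkop (X : finType) (f : X -> X -> CC) : op X :=
  \matrix_(i, j) f (enum_val i) (enum_val j).
Definition ent (X : finType) (A : op X) (x y : X) : CC :=
  A (enum_rank x) (enum_rank y).

Definition adjmx (m n : nat) (A : 'M[CC]_(m, n)) : 'M[CC]_(n, m) :=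
  map_mx Num.conj A^T.

Definition hermitian (X : finType) (A : op X) : Prop := adjmx A = A.

Definition psd (X : finType) (A : op X) : Prop :=
  hermitian A /\ forall v : 'rV[CC]_#|X|, 0 <= (v *m A *m adjmx v) 0 0.

Definition density (X : finType) (rho : op X) : Prop :=
  psd rho /\ \tr rho = 1.

(* Functional calculus for normal (in particular Hermitian) matrices through
   the spectral decomposition A = P^-1 diag(d) P (P unitary) of mathcomp's
   spectral.v: f(A) = P^-1 diag(f(d)) P.  For Hermitian A the eigenvalues d
   are real, so f : RR -> RR is applied to their real parts. *)
Definition mxfun (f : RR -> RR) (n : nat) (A : 'M[CC]_n) : 'M[CC]_n :=
  invmx (spectralmx A)
  *m diag_mx (map_mx (fun z : CC => complex.Complex (f (complex.Re z)) 0) (spectral_diag A))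
  *m spectralmx A.

(* matrix logarithm (natural log; ln 0 = 0, so this is the log on the
   support, the standard convention) and matrix square root *)
Definition logmx (n : nat) (A : 'M[CC]_n) := mxfun (@ln RR) A.
Definition sqrtmx (n : nat) (A : 'M[CC]_n) := mxfun (@Num.sqrt RR) A.

Definition vN_entropy (X : finType) (rho : op X) : RR :=
  - complex.Re (\tr (rho *m logmx rho)).

(* quantum relative entropy, +oo unless supp rho <= supp sigma
   (the support of a Hermitian matrix is its row space) *)
Definition qrel_ent (X : finType) (rho sigma : op X) : \bar RR :=
  if (rho <= sigma)%MS
  then (complex.Re (\tr (rho *m (logmx rho - logmx sigma))))%:E
  else +oo%E.

Definition fidelity (X : finType) (rho sigma : op X) : RR :=
  complex.Re (\tr (sqrtmx (sqrtmx sigma *m rho *m sqrtmx sigma))).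

Definition renyi_half (X : finType) (rho sigma : op X) : \bar RR :=
  if fidelity rho sigma == 0 then +oo%E
  else (- 2 * ln (fidelity rho sigma))%:E.

Definition povm (X : finType) (k : nat) (M : 'I_k -> op X) : Prop :=
  (forall j, psd (M j)) /\ \sum_(j < k) M j = 1%:M.

Definition qc_channel (X : finType) (k : nat) (M : 'I_k -> op X) (rho : op X)
  : op 'I_k :=
  mkop (fun i j => (i == j)%:R * \tr (M i *m rho)).

Definition measured_rel_ent (X : finType) (rho sigma : op X) : \bar RR :=
  ereal_sup [set x | exists (k : nat) (M : 'I_k -> op X),
     povm M /\ x = qrel_ent (qc_channel M rho) (qc_channel M sigma)].

Definition app_id (X Y K : finType) (L : op X -> op Y) (A : op (X * K)%type)
  : op (Y * K)%type :=
  mkop (fun p q => ent (L (mkop (fun x x' => ent A (x, p.2) (x', q.2)))) p.1 q.1).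

Definition is_channel (X Y : finType) (L : op X -> op Y) : Prop :=
  [/\ forall (a : CC) (A A' : op X), L (a *: A + A') = a *: L A + L A',
      forall A : op X, \tr (L A) = \tr A
    & forall (k : nat) (A : op (X * 'I_k)%type), psd A -> psd (app_id L A)].

Section Marginals.
Variables (B C R : finType).
Definition marg_BR (rho : op ((B * C) * R)%type) : op (B * R)%type :=
  mkop (fun x y => \sum_(c : C) ent rho ((x.1, c), x.2) ((y.1, c), y.2)).
Definition marg_BC (rho : op ((B * C) * R)%type) : op (B * C)%type :=
  mkop (fun x y => \sum_(r : R) ent rho (x, r) (y, r)).
Definition marg_B (rho : op ((B * C) * R)%type) : op B :=
  mkop (fun b b' => \sum_(c : C) \sum_(r : R) ent rho ((b, c), r) ((b', c), r)).

Definition cmi (rho : op ((B * C) * R)%type) : RR :=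
  vN_entropy (marg_BC rho) + vN_entropy (marg_BR rho)
  - vN_entropy rho - vN_entropy (marg_B rho).

(* n-fold tensor powers, with the factors regrouped as B^n C^n R^n
   (resp. B^n R^n); X^n is modelled by the finite type {ffun 'I_n -> X} *)
Definition tpow_BCR (n : nat) (rho : op ((B * C) * R)%type)
  : op (({ffun 'I_n -> B} * {ffun 'I_n -> C}) * {ffun 'I_n -> R})%type :=
  mkop (fun p q : (({ffun 'I_n -> B} * {ffun 'I_n -> C}) * {ffun 'I_n -> R})%type =>
        \prod_(i < n) ent rho ((p.1.1 i, p.1.2 i), p.2 i) ((q.1.1 i, q.1.2 i), q.2 i)).
Definition tpow_BR (n : nat) (rho : op (B * R)%type)
  : op ({ffun 'I_n -> B} * {ffun 'I_n -> R})%type :=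
  mkop (fun p q : ({ffun 'I_n -> B} * {ffun 'I_n -> R})%type =>
    \prod_(i < n) ent rho (p.1 i, p.2 i) (q.1 i, q.2 i)).

Definition regularized_term (rho : op ((B * C) * R)%type) (n : nat) : \bar RR :=
  ((n%:R)^-1)%:E *
  ereal_inf [set x | exists L : op {ffun 'I_n -> B} ->
                                  op ({ffun 'I_n -> B} * {ffun 'I_n -> C})%type,
     is_channel L /\ x = qrel_ent (tpow_BCR n rho) (app_id L (tpow_BR n (marg_BR rho)))].

Definition min_measured (rho : op ((B * C) * R)%type) : \bar RR :=
  ereal_inf [set x | exists L : op B -> op (B * C)%type,
     is_channel L /\ x = measured_rel_ent rho (app_id L (marg_BR rho))].

Definition min_renyi_half (rho : op ((B * C) * R)%type) : \bar RR :=
  ereal_inf [set x | exists L : op B -> op (B * C)%type,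
     is_channel L /\ x = renyi_half rho (app_id L (marg_BR rho))].
End Marginals.

End Quantum.

(* Main.v *)
(* Upper bound on the limit: recover with a pinched Petz map built from
   (rho_BC)^{(x)n}.  Tensor powers have polynomially many distinct eigenvalues, so each
   pinching costs only O(log n), and after pinching all operators involved commute, so
   that the relative entropy splits into the four entropies of I(C:R|B).

   Lower bound on the limit: by minimax over the convex set of states
   (Lambda (x) id)(rho_BR), a single operator w > 0 satisfies
   tr rho log w + 1 - tr (sigma w) >= m for all of them, m being the measured minimum;
   the step from a POVM to w is the operator Jensen inequality for log.  The pinching
   argument with w^{(x)n} then bounds S(rho^{(x)n} || sigma_n) below by
   n tr rho log w - log tr (sigma_n w^{(x)n}) - O(log n), and tr (sigma_n w^{(x)n}) is at most
   (tr Z)^n, where Z is a dual solution of the semidefinite program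
   max tr ((Lambda (x) id)(rho_BR) w) on one copy.

   The limit exists by subadditivity, and the last inequality is the Fuchs-Caves
   measurement of the eigenspaces of the operator w with w sigma w = rho. *)
Require Import Defs.
From HB Require Import structures.
From mathcomp Require Import all_boot all_order all_algebra.
From mathcomp Require Import sesquilinear spectral.
From mathcomp Require Import all_classical all_reals all_analysis.
From mathcomp Require Import complex ring lra.
Set Implicit Arguments.
Unset Strict Implicit.
Unset Printing Implicit Defensive.
Import Order.TTheory GRing.Theory Num.Theory.
Local Open Scope ring_scope.

(** The obstacle in the lower bound is that a channel on [n] copies may act jointly on all of them,
    so no measurement of a single copy is adapted to it. A witness [w] that meets the channel output
    [s] only through [tr (s w)] avoids this: maximizing a linear functional over channels is a
    semidefinite program, and a dual solution stays feasible under tensor powers. Hence one [w] must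
    serve all channels. For the minimax step [- log tr (s w)] is linearized to [1 - tr (s w)], so
    that the objective is affine in [s] and concave in [w]; the bound [ln y <= y - 1] undoes this at
    the end.

    No compactness enters. Optimal channels, witnesses and dual solutions are replaced by
    near-optimal ones, with errors that vanish per copy. Because [ln 0 = 0], an expression
    [tr (r log A)] has its usual meaning only when the support of [r] lies in that of [A]; this
    condition is followed through every construction, and operators are made invertible by small
    multiples of the identity where needed. *)

(* An interface to [RR[i]]: with the field abstract, unification does not unfold
   complex arithmetic. *)
Structure complexLike (RR : realType) := ComplexLike {
  cx_sort :> numClosedFieldType;
  ofR : {rmorphism RR -> cx_sort};
  re : cx_sort -> RR;
  reD : forall x y, re (x + y) = re x + re y;
  reK : forall a, re (ofR a) = a;
  reZ : forall a z, re (ofR a * z) = a * re z;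
  re_conj : forall z, re (Num.conj z) = re z;
  conj_ofR : forall a, Num.conj (ofR a) = ofR a;
  ofR_re : forall z, z \is Num.real -> ofR (re z) = z;
  ofR_ge0 : forall a, (0 <= ofR a) = (0 <= a) }.

Arguments ofR {RR c}.
Arguments re {RR c}.
Notation "x %:C" := (ofR x) (at level 1, format "x %:C") : ring_scope.

(** * Positive matrices, spectral resolutions and the functional calculus *)

Section GenericDefs.
Variables (RR : realType) (CC : complexLike RR).

Definition adjm (m n : nat) (A : 'M[CC]_(m, n)) : 'M[CC]_(n, m) :=
  map_mx Num.conj A^T.
Definition psdmx n (A : 'M[CC]_n) : Prop :=
  adjm A = A /\ forall v : 'rV[CC]_n, 0 <= (v *m A *m adjm v) 0 0.
(** Repeats [mxfun] literally over the abstract field, so that the two agree by conversion once the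
    field is instantiated. *)
Definition fcalc (f : RR -> RR) (n : nat) (A : 'M[CC]_n) : 'M[CC]_n :=
  invmx (spectralmx A)
  *m diag_mx (map_mx (fun z : CC => (f (re z))%:C) (spectral_diag A))
  *m spectralmx A.
Definition glog (n : nat) (A : 'M[CC]_n) := fcalc (@ln RR) A.
Definition gsqrt (n : nat) (A : 'M[CC]_n) := fcalc (@Num.sqrt RR) A.
Definition rtr n (A : 'M[CC]_n) : RR := re (\tr A).

End GenericDefs.

Section MatrixBasics.
Variables (RR : realType) (CC : complexLike RR).

Lemma adjmE m n (A : 'M[CC]_(m, n)) : adjm A = map_mx Num.conj A^T.
Proof. by []. Qed.

Lemma adjm_ij m n (A : 'M[CC]_(m, n)) i j : adjm A i j = Num.conj (A j i).
Proof. by rewrite !mxE. Qed.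

Lemma adjmK m n (A : 'M[CC]_(m, n)) : adjm (adjm A) = A.
Proof. by apply/matrixP=> i j; rewrite !mxE conjCK. Qed.

Lemma adjmM m n p (A : 'M[CC]_(m, n)) (B : 'M[CC]_(n, p)) :
  adjm (A *m B) = adjm B *m adjm A.
Proof. by rewrite /adjm trmx_mul map_mxM. Qed.

Lemma adjmD m n (A B : 'M[CC]_(m, n)) : adjm (A + B) = adjm A + adjm B.
Proof. by rewrite /adjm linearD /= map_mxD. Qed.

Lemma adjm0 m n : adjm (0 : 'M[CC]_(m, n)) = 0.
Proof. by apply/matrixP=> i j; rewrite !mxE conjC0. Qed.

Lemma adjm1 n : adjm (1%:M : 'M[CC]_n) = 1%:M.
Proof. by rewrite /adjm trmx1 map_mx1. Qed.

Lemma adjmZ m n (a : CC) (A : 'M[CC]_(m, n)) :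
  adjm (a *: A) = Num.conj a *: adjm A.
Proof. by apply/matrixP=> i j; rewrite !mxE rmorphM. Qed.

Lemma adjmZr m n (a : RR) (A : 'M[CC]_(m, n)) :
  adjm (a%:C *: A) = a%:C *: adjm A.
Proof. by rewrite adjmZ conj_ofR. Qed.

Lemma adjmN m n (A : 'M[CC]_(m, n)) : adjm (- A) = - adjm A.
Proof. by apply/matrixP=> i j; rewrite !mxE rmorphN. Qed.

Lemma adjmB m n (A B : 'M[CC]_(m, n)) : adjm (A - B) = adjm A - adjm B.
Proof. by rewrite adjmD adjmN. Qed.

Lemma adjm_sum m n (I : Type) (r : seq I) (P : pred I) (F : I -> 'M[CC]_(m, n)) :
  adjm (\sum_(i <- r | P i) F i) = \sum_(i <- r | P i) adjm (F i).
Proof. exact: (big_morph _ (@adjmD m n) (adjm0 m n)). Qed.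

Lemma re0 : re (0 : CC) = 0.
Proof. by rewrite -(rmorph0 (@ofR _ CC)) reK. Qed.

Lemma reN (x : CC) : re (- x) = - re x.
Proof. by apply/eqP; rewrite -subr_eq0 opprK -reD addNr re0. Qed.

Lemma re_sum (I : Type) (r : seq I) (P : pred I) (F : I -> CC) :
  re (\sum_(i <- r | P i) F i) = \sum_(i <- r | P i) re (F i).
Proof. exact: (big_morph _ (@reD _ CC) re0). Qed.

Lemma re_ge0K (x : CC) : 0 <= x -> (re x)%:C = x.
Proof. by move=> x0; rewrite ofR_re // ger0_real. Qed.

Lemma re_ge0 (x : CC) : 0 <= x -> 0 <= re x.
Proof. by move=> x0; rewrite -(ofR_ge0 CC) re_ge0K. Qed.

Lemma mx11E (A : 'M[CC]_1) : A 0 0 = \tr A.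
Proof. by rewrite /mxtrace big_ord_recl big_ord0 addr0. Qed.

Lemma psdmx_conj m n (M : 'M[CC]_(m, n)) (A : 'M[CC]_n) :
  psdmx A -> psdmx (M *m A *m adjm M).
Proof.
case=> hA pA; split; first by rewrite !adjmM adjmK hA mulmxA.
by move=> v; have := pA (v *m M); rewrite adjmM !mulmxA.
Qed.

Lemma psdmx1 n : psdmx (1%:M : 'M[CC]_n).
Proof.
split=> [|v]; first exact: adjm1.
rewrite mulmx1 mxE sumr_ge0 // => i _.
by rewrite !mxE mul_conjC_ge0.
Qed.

Lemma psdmx_gram m n (M : 'M[CC]_(m, n)) : psdmx (M *m adjm M).
Proof. by have := psdmx_conj M (psdmx1 n); rewrite mulmx1. Qed.

Lemma psdmx0 n : psdmx (0 : 'M[CC]_n).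
Proof. by split=> [|v]; rewrite ?adjm0 // mulmx0 mul0mx mxE. Qed.

Lemma psdmxD n (A B : 'M[CC]_n) : psdmx A -> psdmx B -> psdmx (A + B).
Proof.
case=> hA pA [hB pB]; split=> [|v]; first by rewrite adjmD hA hB.
by rewrite mulmxDr mulmxDl mxE addr_ge0.
Qed.

Lemma psdmx_sum n (I : Type) (r : seq I) (P : pred I) (F : I -> 'M[CC]_n) :
  (forall i, P i -> psdmx (F i)) -> psdmx (\sum_(i <- r | P i) F i).
Proof.
move=> h; elim/big_rec: _ => [|i A Pi pA]; first exact: psdmx0.
by apply: psdmxD => //; exact: h.
Qed.

Lemma psdmxZ n (a : RR) (A : 'M[CC]_n) : 0 <= a -> psdmx A -> psdmx (a%:C *: A).
Proof.
move=> a0 [hA pA]; split=> [|v]; first by rewrite adjmZr hA.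
by rewrite -scalemxAr -scalemxAl mxE mulr_ge0 // ofR_ge0.
Qed.

Lemma psdmx_herm n (A : 'M[CC]_n) : psdmx A -> adjm A = A.
Proof. by case. Qed.

Lemma rtrE n (A : 'M[CC]_n) : rtr A = re (\tr A).
Proof. by []. Qed.

Lemma rtrD n (A B : 'M[CC]_n) : rtr (A + B) = rtr A + rtr B.
Proof. by rewrite /rtr mxtraceD reD. Qed.
Lemma rtrN n (A : 'M[CC]_n) : rtr (- A) = - rtr A.
Proof. by rewrite /rtr raddfN reN. Qed.
Lemma rtrB n (A B : 'M[CC]_n) : rtr (A - B) = rtr A - rtr B.
Proof. by rewrite rtrD rtrN. Qed.
Lemma rtrZ n a (A : 'M[CC]_n) : rtr (a%:C *: A) = a * rtr A.
Proof. by rewrite /rtr mxtraceZ reZ. Qed.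
Lemma rtr0 n : rtr (0 : 'M[CC]_n) = 0.
Proof. by rewrite /rtr mxtrace0 re0. Qed.
Lemma rtr_sum n (I : Type) (r : seq I) (P : pred I) (F : I -> 'M[CC]_n) :
  rtr (\sum_(i <- r | P i) F i) = \sum_(i <- r | P i) rtr (F i).
Proof. exact: (big_morph _ (@rtrD n) (rtr0 n)). Qed.
Lemma rtrC m n (A : 'M[CC]_(m, n)) (B : 'M[CC]_(n, m)) : rtr (A *m B) = rtr (B *m A).
Proof. by rewrite /rtr mxtrace_mulC. Qed.
Lemma rtr_adj n (A : 'M[CC]_n) : rtr (adjm A) = rtr A.
Proof.
rewrite /rtr /mxtrace !re_sum; apply: eq_bigr => i _.
by rewrite !mxE re_conj.
Qed.
Lemma rtr1 n : rtr (1%:M : 'M[CC]_n) = n%:R.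
Proof.
by rewrite /rtr mxtrace1 -(rmorph_nat (@ofR _ CC)) reK.
Qed.

Definition unitary n (P : 'M[CC]_n) := P *m adjm P = 1%:M /\ adjm P *m P = 1%:M.

Lemma spectral_unitary n (A : 'M[CC]_n) : unitary (spectralmx A).
Proof.
have /unitarymxP h : spectralmx A \is unitarymx by exact: spectral_unitarymx.
have h' : spectralmx A *m adjm (spectralmx A) = 1%:M by [].
by split=> //; apply: mulmx1C.
Qed.

Lemma invmx_spectral n (A : 'M[CC]_n) : invmx (spectralmx A) = adjm (spectralmx A).
Proof. by rewrite invmx_unitary ?spectral_unitarymx. Qed.

Lemma herm_spectral n (A : 'M[CC]_n) : adjm A = A ->
  A = adjm (spectralmx A) *m diag_mx (spectral_diag A) *m spectralmx A.
Proof.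
move=> hA; rewrite -invmx_spectral; apply/orthomx_spectralP/normalmxP.
by move: hA; rewrite /adjm -/(map_mx _ _) => hA; rewrite hA.
Qed.

(** Members may vanish and distinct indices may carry equal eigenvalues, so spectral decompositions
    can be tensored, embedded and coarse-grained without being made canonical again. *)
Definition resol (I : finType) n (E : I -> 'M[CC]_n) : Prop :=
  [/\ forall i, adjm (E i) = E i,
      forall i j, E i *m E j = if i == j then E i else 0
    & \sum_i E i = 1%:M].

Definition rsum (I : finType) n (d : I -> RR) (E : I -> 'M[CC]_n) : 'M[CC]_n :=
  \sum_i (d i)%:C *: E i.

Lemma rsum_mul (I : finType) n (d e : I -> RR) (E : I -> 'M[CC]_n) : resol E ->
  rsum d E *m rsum e E = rsum (fun i => d i * e i) E.
Proof.
case=> _ hE _; rewrite /rsum mulmx_suml; apply: eq_bigr => i _.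
rewrite mulmx_sumr (bigD1 i) //= big1 => [|j ji].
  by rewrite addr0 -scalemxAl -scalemxAr hE eqxx scalerA rmorphM.
by rewrite -scalemxAl -scalemxAr hE eq_sym (negbTE ji) !scaler0.
Qed.

Lemma rsum_adj (I : finType) n (d : I -> RR) (E : I -> 'M[CC]_n) : resol E ->
  adjm (rsum d E) = rsum d E.
Proof.
case=> hE _ _; rewrite /rsum adjm_sum; apply: eq_bigr => i _.
by rewrite adjmZr hE.
Qed.

Lemma rsum1 (I : finType) n (E : I -> 'M[CC]_n) : resol E -> rsum (fun=> 1) E = 1%:M.
Proof. by case=> _ _ <-; apply: eq_bigr => i _; rewrite rmorph1 scale1r. Qed.

Lemma rsumE (I : finType) n (d : I -> RR) (E : I -> 'M[CC]_n) i : resol E ->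
  rsum d E *m E i = (d i)%:C *: E i.
Proof.
case=> _ hE _; rewrite /rsum mulmx_suml (bigD1 i) //= big1 => [|j ji].
  by rewrite addr0 -scalemxAl hE eqxx.
by rewrite -scalemxAl hE (negbTE ji) scaler0.
Qed.

Lemma rsumEl (I : finType) n (d : I -> RR) (E : I -> 'M[CC]_n) i : resol E ->
  E i *m rsum d E = (d i)%:C *: E i.
Proof.
move=> rE; have [hE _ _] := rE.
have := congr1 (@adjm _ _ _ _) (rsumE d i rE).
by rewrite adjmM rsum_adj // hE adjmZr hE.
Qed.

Lemma rtr_rsum (I : finType) n (d : I -> RR) (E : I -> 'M[CC]_n) (A : 'M[CC]_n) :
  rtr (A *m rsum d E) = \sum_i d i * rtr (A *m E i).
Proof.
rewrite /rsum mulmx_sumr rtr_sum; apply: eq_bigr => i _.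
by rewrite -scalemxAr rtrZ.
Qed.

Lemma resol_psd (I : finType) n (E : I -> 'M[CC]_n) i : resol E -> psdmx (E i).
Proof.
by case=> hE hEE _; have := psdmx_gram (E i); rewrite hE hEE eqxx.
Qed.

Lemma rsum_psd (I : finType) n (d : I -> RR) (E : I -> 'M[CC]_n) :
  resol E -> (forall i, 0 <= d i) -> psdmx (rsum d E).
Proof.
by move=> rE d0; apply: psdmx_sum => i _; apply: psdmxZ => //; apply: resol_psd.
Qed.

(** The functional calculus does not depend on the decomposition: [E i *m adjm P] intertwines the
    diagonal matrix of eigenvalues with the scalar [d i], so its entry in column [k] vanishes unless
    the [k]-th eigenvalue is [d i]. *)
Lemma fcalc_resol (f : RR -> RR) (I : finType) n (d : I -> RR) (E : I -> 'M[CC]_n) :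
  resol E -> fcalc f (rsum d E) = rsum (fun i => f (d i)) E.
Proof.
move=> rE; set A := rsum d E.
have hA : adjm A = A by exact: rsum_adj.
have [_ _ sE] := rE.
have [PP' P'P] := spectral_unitary A.
have eA := herm_spectral hA.
rewrite /fcalc invmx_spectral; set P := spectralmx A in PP' P'P eA *.
set s := spectral_diag A in eA *.
rewrite -[LHS]mul1mx -sE mulmx_suml; apply: eq_bigr => i _.
have h : (E i *m adjm P) *m diag_mx s = (d i)%:C *: (E i *m adjm P).
  have := congr1 (fun M => M *m adjm P) (rsumEl d i rE).
  by rewrite -/A {1}eA !mulmxA -[_ *m P *m _]mulmxA PP' mulmx1 scalemxAl.
suff h2 : (E i *m adjm P) *m
    diag_mx (map_mx (fun z : CC => (f (re z))%:C) s)
    = (f (d i))%:C *: (E i *m adjm P).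
  by rewrite !mulmxA h2 -scalemxAl -mulmxA P'P mulmx1.
move: (E i *m adjm P) h => M /matrixP h.
apply/matrixP => x k; have := h x k; rewrite !mul_mx_diag !mxE => e.
have /eqP : M x k * (s 0 k - (d i)%:C) = 0 by rewrite mulrBr e mulrC subrr.
rewrite mulf_eq0 => /orP[/eqP ->|]; first by rewrite mul0r mulr0.
by rewrite subr_eq0 => /eqP ->; rewrite reK mulrC.
Qed.

Lemma resol_unitary n (P : 'M[CC]_n) : unitary P ->
  resol (fun i => adjm P *m delta_mx i i *m P).
Proof.
move=> [PP' P'P]; split=> [i|i j|].
- rewrite !adjmM adjmK mulmxA; congr (_ *m _ *m _).
  by apply/matrixP => a b; rewrite !mxE rmorph_nat andbC.
- rewrite !mulmxA -[_ *m P *m adjm P]mulmxA PP' mulmx1.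
  rewrite -[_ *m delta_mx i i *m _]mulmxA mul_delta_mx_cond.
  by case: eqP => [->|_]; rewrite ?mulr1n // mulr0n mulmx0 mul0mx.
- rewrite -mulmx_suml -mulmx_sumr.
  suff -> : \sum_i delta_mx i i = 1%:M :> 'M[CC]_n by rewrite mulmx1.
  by rewrite -diag_const_mx [RHS]diag_mx_sum_delta; apply: eq_bigr => i _; rewrite mxE scale1r.
Qed.

(** Rank-one projections are never zero, so a lower bound on [A], tested on the eigenvectors, bounds
    every [d i] without exception. *)
Lemma herm_resol_rank1 n (A : 'M[CC]_n) : adjm A = A ->
  exists (d : 'I_n -> RR) (E : 'I_n -> 'M[CC]_n),
    [/\ resol E, A = rsum d E, forall i, rtr (E i) = 1
      & forall c : RR, psdmx (A - c%:C%:M) -> forall i, c <= d i].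
Proof.
move=> hA; have [PP' P'P] := spectral_unitary A.
have eA := herm_spectral hA.
set P := spectralmx A in PP' P'P eA *; set s := spectral_diag A in eA *.
have sr i : (re (s 0 i))%:C = s 0 i.
  apply: ofR_re; apply/CrealP.
  have := congr1 (fun M => P *m M *m adjm P) hA.
  rewrite {1 2}eA !adjmM adjmK !mulmxA PP' mul1mx -[_ *m P *m _]mulmxA PP' mulmx1.
  rewrite mul1mx -[_ *m P *m _]mulmxA PP' mulmx1.
  by move=> /matrixP/(_ i i); rewrite !mxE !eqxx !mulr1n.
exists (fun i => re (s 0 i)), (fun i => adjm P *m delta_mx i i *m P).
have rE := resol_unitary (conj PP' P'P).
split=> //.
  rewrite {1}eA diag_mx_sum_delta mulmx_sumr mulmx_suml; apply: eq_bigr => i _.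
  by rewrite sr -scalemxAr -scalemxAl.
  move=> i; rewrite -mulmxA rtrC -mulmxA PP' mulmx1 rtrE /mxtrace (bigD1 i) //=.
  rewrite big1 => [|j ji]; rewrite mxE ?eqxx ?(negbTE ji) //.
  by rewrite addr0 -(rmorph1 (@ofR _ CC)) reK.
move=> c [_ pA] i; rewrite -subr_ge0.
have -> : re (s 0 i) - c = re (s 0 i - c%:C).
  by rewrite reD reN reK.
apply: re_ge0; have := pA (delta_mx 0 i *m P).
have -> : A - c%:C%:M = adjm P *m (diag_mx s - c%:C%:M) *m P.
  by rewrite mulmxBr mulmxBl -eA mul_mx_scalar -scalemxAl P'P scalemx1.
rewrite adjmM !mulmxA -[_ *m P *m adjm P]mulmxA PP' mulmx1.
rewrite -[_ *m P *m adjm P]mulmxA PP' mulmx1.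
rewrite -rowE mxE (bigD1 i) //= big1 => [|j ji]; last first.
  by rewrite !mxE !eqxx (negbTE ji) conjC0 mulr0.
by rewrite !mxE !eqxx addr0 conjC1 !mulr1n mulr1.
Qed.

Lemma herm_resol n (A : 'M[CC]_n) : adjm A = A ->
  exists (d : 'I_n -> RR) (E : 'I_n -> 'M[CC]_n),
    [/\ resol E, A = rsum d E
      & forall c : RR, psdmx (A - c%:C%:M) -> forall i, c <= d i].
Proof. by move=> /herm_resol_rank1[d [E [rE eA _ dE]]]; exists d, E. Qed.

(** Keeps the definition accessible after [psdmx] is made opaque. *)
Lemma psdmxP n (A : 'M[CC]_n) : psdmx A <->
  (adjm A = A /\ forall v : 'rV[CC]_n, 0 <= (v *m A *m adjm v) 0 0).
Proof. by []. Qed.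

End MatrixBasics.

Global Opaque psdmx rtr fcalc adjm.

(** * Operator monotonicity of roots and of the logarithm *)

Section RootsAndLogarithm.
Variables (RR : realType) (CC : complexLike RR).

Lemma scalarC n (c : RR) : (c%:C%:M : 'M[CC]_n) = c%:C *: 1%:M.
Proof. by rewrite scalemx1. Qed.

Lemma psd_resol n (A : 'M[CC]_n) : psdmx A ->
  exists (d : 'I_n -> RR) (E : 'I_n -> 'M[CC]_n),
    [/\ resol E, A = rsum d E & forall i, 0 <= d i].
Proof.
move=> pA; have [d [E [rE eA dE]]] := herm_resol (psdmx_herm pA).
exists d, E; split=> // i; apply: dE.
by rewrite rmorph0 raddf0 subr0.
Qed.

Lemma rsum_sqrt (I : finType) n (d : I -> RR) (E : I -> 'M[CC]_n) : resol E ->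
  (forall i, 0 <= d i) ->
  rsum (fun i => Num.sqrt (d i)) E *m rsum (fun i => Num.sqrt (d i)) E = rsum d E.
Proof.
move=> rE d0; rewrite rsum_mul //; apply: eq_bigr => i _.
by rewrite -expr2 sqr_sqrtr.
Qed.

Lemma gsqrt_rsum (I : finType) n (d : I -> RR) (E : I -> 'M[CC]_n) : resol E ->
  gsqrt (rsum d E) = rsum (fun i => Num.sqrt (d i)) E.
Proof. exact: fcalc_resol. Qed.

Lemma gsqrt_psd n (A : 'M[CC]_n) : psdmx A -> psdmx (gsqrt A).
Proof.
move=> /psd_resol[d [E [rE -> d0]]]; rewrite /gsqrt fcalc_resol //.
by apply: rsum_psd => // i; rewrite sqrtr_ge0.
Qed.

Lemma gsqrt_sqr n (A : 'M[CC]_n) : psdmx A -> gsqrt A *m gsqrt A = A.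
Proof.
move=> /psd_resol[d [E [rE -> d0]]]; rewrite /gsqrt fcalc_resol //.
exact: rsum_sqrt.
Qed.

Lemma psd_tr_ge0 n (A : 'M[CC]_n) : psdmx A -> 0 <= \tr A.
Proof.
move=> pA; rewrite -[A]gsqrt_sqr // -{2}(psdmx_herm (gsqrt_psd pA)).
rewrite /mxtrace sumr_ge0 // => i _; rewrite mxE sumr_ge0 // => j _.
by rewrite !mxE mul_conjC_ge0.
Qed.

Lemma psd_rtr_ge0 n (A : 'M[CC]_n) : psdmx A -> 0 <= rtr A.
Proof. by move=> /psd_tr_ge0/re_ge0. Qed.

Lemma psd_rtrM_ge0 n (A B : 'M[CC]_n) : psdmx A -> psdmx B -> 0 <= rtr (A *m B).
Proof.
move=> pA pB; rewrite -[A]gsqrt_sqr // -mulmxA rtrC.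
rewrite -{2}(psdmx_herm (gsqrt_psd pA)).
exact/psd_rtr_ge0/psdmx_conj.
Qed.

Lemma gram_tr0 m n (M : 'M[CC]_(m, n)) : rtr (M *m adjm M) <= 0 -> M = 0.
Proof.
move=> t0; have pM := psdmx_gram M.
have : \tr (M *m adjm M) = 0.
  rewrite -[LHS]re_ge0K ?psd_tr_ge0 //.
  suff -> : re (\tr (M *m adjm M)) = 0 by rewrite rmorph0.
  by apply/eqP; rewrite eq_le t0 psd_rtr_ge0.
rewrite /mxtrace => /eqP; rewrite psumr_eq0 => [|i _]; last first.
  by rewrite mxE sumr_ge0 // => j _; rewrite !mxE mul_conjC_ge0.
move=> /allP h; apply/matrixP => i j; rewrite [RHS]mxE.
have := h i; rewrite mem_index_enum => /(_ isT); rewrite mxE psumr_eq0.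
  move=> /allP/(_ j); rewrite mem_index_enum => /(_ isT).
  by rewrite !mxE mul_conjC_eq0 => /eqP.
by move=> k _; rewrite !mxE mul_conjC_ge0.
Qed.

Lemma psd_tr0 n (A : 'M[CC]_n) : psdmx A -> rtr A <= 0 -> A = 0.
Proof.
move=> pA; rewrite -{1 2}[A]gsqrt_sqr // -{2}(psdmx_herm (gsqrt_psd pA)).
by move=> /gram_tr0 ->; rewrite mul0mx.
Qed.

(** The trace is the squared Hilbert-Schmidt norm of [M] times the square root of [A]. *)
Lemma psd_ker m n (M : 'M[CC]_(m, n)) (A : 'M[CC]_n) : psdmx A ->
  rtr (M *m A *m adjm M) <= 0 -> M *m A = 0.
Proof.
move=> pA; have hS := psdmx_herm (gsqrt_psd pA).
rewrite -{1 2}[A]gsqrt_sqr // -{2}hS => h.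
suff -> : M *m (gsqrt A *m gsqrt A) = 0 by [].
rewrite mulmxA; suff -> : M *m gsqrt A = 0 by rewrite mul0mx.
by apply: gram_tr0; rewrite adjmM !mulmxA; rewrite !mulmxA in h.
Qed.

Local Notation lem A B := (psdmx (B - A)).

Lemma lem_trans n (B A C : 'M[CC]_n) : lem A B -> lem B C -> lem A C.
Proof.
move=> h1 h2;  have -> : C - A = (C - B) + (B - A) by rewrite addrA subrK.
exact: psdmxD.
Qed.

Lemma lem_conj m n (M : 'M[CC]_(m, n)) (A B : 'M[CC]_n) : lem A B ->
  lem (M *m A *m adjm M) (M *m B *m adjm M).
Proof. by move=> /(psdmx_conj M); rewrite mulmxBr mulmxBl. Qed.

Lemma lem_sum n (I : Type) (r : seq I) (P : pred I) (F G : I -> 'M[CC]_n) :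
  (forall i, P i -> lem (F i) (G i)) ->
  lem (\sum_(i <- r | P i) F i) (\sum_(i <- r | P i) G i).
Proof. by move=> h; rewrite -sumrB; apply: psdmx_sum. Qed.

Lemma lem_rtr n (R A B : 'M[CC]_n) : psdmx R -> lem A B -> rtr (R *m A) <= rtr (R *m B).
Proof. by move=> pR h; rewrite -subr_ge0 -rtrB -mulmxBr psd_rtrM_ge0. Qed.

(* Compress [2 (B^2 - A^2) = (B - A)(A + B) + (A + B)(B - A)] to an eigenspace of
   [B - A] with a negative eigenvalue. *)
Lemma lem_sqr n (A B : 'M[CC]_n) : psdmx A -> psdmx B ->
  lem (A *m A) (B *m B) -> lem A B.
Proof.
move=> pA pB h.
have hA := psdmx_herm pA; have hB := psdmx_herm pB.
have hD : adjm (B - A) = B - A by rewrite adjmB hA hB.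
have [d [E [rE eD _]]] := herm_resol hD.
rewrite eD; apply: psdmx_sum => i _.
have [d0|d0] := leP 0 (d i).
  by apply: psdmxZ => //; apply: resol_psd.
suff -> : E i = 0 by rewrite scaler0; apply: psdmx0.
have hE : adjm (E i) = E i by case: rE.
have h1 : psdmx (E i *m (B *m B - A *m A) *m E i).
  by have := psdmx_conj (E i) h; rewrite hE.
have pEA : psdmx (E i *m A *m E i) by have := psdmx_conj (E i) pA; rewrite hE.
have pEB : psdmx (E i *m B *m E i) by have := psdmx_conj (E i) pB; rewrite hE.
have e1 : 2 * rtr (E i *m (B *m B - A *m A) *m E i)
          = 2 * (d i * (rtr (E i *m A *m E i) + rtr (E i *m B *m E i))).
  rewrite -rtrD -mulmxDl -mulmxDr -[d i * _]rtrZ.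
  rewrite -![2 * _]rtrZ; congr rtr.
  have -> : (2 : RR)%:C = 1 + 1 :> CC by rewrite rmorphD rmorph1.
  have -> : (1 + 1) *: (E i *m (B *m B - A *m A) *m E i) =
     E i *m (B *m B - A *m A + (B *m B - A *m A)) *m E i.
    by rewrite scalerDl scale1r [in RHS]mulmxDr mulmxDl.
  rewrite scalerDl scale1r.
  have -> : B *m B - A *m A + (B *m B - A *m A) = (B - A) *m (A + B) + (A + B) *m (B - A).
    rewrite !mulmxDl !mulmxDr !mulNmx !mulmxN.
    move: (B *m A) (A *m B) (A *m A) (B *m B) => x y a b.
    apply/matrixP => p q; rewrite !mxE; ring.
  rewrite mulmxDr mulmxDl; congr (_ + _).
    by rewrite mulmxA eD rsumEl // -!scalemxAl.
  by rewrite -!mulmxA eD rsumE // -!scalemxAr.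
have h2 : rtr (E i *m A *m E i) + rtr (E i *m B *m E i) <= 0.
  have := psd_rtr_ge0 h1; rewrite -(pmulr_rge0 _ (ltr0n RR 2)) e1.
  by rewrite pmulr_rge0 // nmulr_rge0.
have a0 := psd_rtr_ge0 pEA; have b0 := psd_rtr_ge0 pEB.
(* Two nonnegative traces with sum at most zero both vanish, so [E i] annihilates [A] and [B], hence
   also [d i] times itself. *)
have EA : E i *m A = 0 by apply: psd_ker => //; rewrite hE; lra.
have EB : E i *m B = 0 by apply: psd_ker => //; rewrite hE; lra.
have := rsumEl d i rE; rewrite -eD mulmxBr EA EB subr0 => /esym/eqP.
by rewrite scaler_eq0 fmorph_eq0 (lt_eqF d0) => /eqP.
Qed.

(** This is [x ^ (1 / 2 ^ k)]; iterated square roots inherit operator monotonicity from the square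
    root. *)
Definition rootk (k : nat) (x : RR) := iter k Num.sqrt x.

Definition rootmx k n (A : 'M[CC]_n) := iter k (@gsqrt RR CC n) A.

Lemma rootmxS k n (A : 'M[CC]_n) : rootmx k.+1 A = gsqrt (rootmx k A).
Proof. by []. Qed.

Lemma rootmx_psd k n (A : 'M[CC]_n) : psdmx A -> psdmx (rootmx k A).
Proof. by move=> pA; elim: k => [//|k IH]; rewrite rootmxS; apply: gsqrt_psd. Qed.

Lemma rootmx_rsum k (I : finType) n (d : I -> RR) (E : I -> 'M[CC]_n) : resol E ->
  rootmx k (rsum d E) = rsum (fun i => rootk k (d i)) E.
Proof.
by move=> rE; elim: k => [//|k IH]; rewrite rootmxS IH /gsqrt fcalc_resol.
Qed.

Lemma lem_root k n (A B : 'M[CC]_n) : psdmx A -> psdmx B -> lem A B ->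
  lem (rootmx k A) (rootmx k B).
Proof.
move=> pA pB AB; elim: k => [//|k IH].
have pAk := rootmx_psd k pA; have pBk := rootmx_psd k pB.
rewrite !rootmxS; apply: lem_sqr; try exact: gsqrt_psd.
by rewrite !gsqrt_sqr.
Qed.

(** The gap is an operator variance: the Gram matrices of [X i K i - K i A] sum to it, the cross
    terms collapsing because the [adjm (K i) *m K i] sum to the identity. *)
Lemma kadison (I : finType) m n (K : I -> 'M[CC]_(m, n)) (X : I -> 'M[CC]_m) :
  \sum_i adjm (K i) *m K i = 1%:M -> (forall i, adjm (X i) = X i) ->
  let A := \sum_i adjm (K i) *m X i *m K i in
  lem (A *m A) (\sum_i adjm (K i) *m (X i *m X i) *m K i).
Proof.
move=> sK hX A.
have hA : adjm A = A.
  by rewrite adjm_sum; apply: eq_bigr => i _; rewrite !adjmM adjmK hX mulmxA.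
suff -> : \sum_i adjm (K i) *m (X i *m X i) *m K i - A *m A =
  \sum_i adjm (X i *m K i - K i *m A) *m adjm (adjm (X i *m K i - K i *m A)).
  by apply: psdmx_sum => i _; apply: psdmx_gram.
under [RHS]eq_bigr => i _.
  rewrite adjmK adjmB !adjmM hA hX mulmxBr !mulmxBl.
  over.
rewrite !sumrB /=.
have -> : \sum_i adjm (K i) *m X i *m (K i *m A) = A *m A.
  by under eq_bigr => i _ do rewrite mulmxA; rewrite -mulmx_suml.
have -> : \sum_i A *m adjm (K i) *m (X i *m K i) = A *m A.
  by rewrite [in RHS]mulmx_sumr; apply: eq_bigr => i _; rewrite !mulmxA.
have -> : \sum_i A *m adjm (K i) *m (K i *m A) = A *m A.
  rewrite -[X in _ = X *m _]mulmx1 -sK mulmx_sumr mulmx_suml.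
  by apply: eq_bigr => i _; rewrite !mulmxA.
rewrite subrr subr0; congr (_ - _).
by apply: eq_bigr => i _; rewrite !mulmxA.
Qed.

Lemma jensen_psd (I : finType) m n (K : I -> 'M[CC]_(m, n)) (X : I -> 'M[CC]_m) :
  (forall i, psdmx (X i)) -> psdmx (\sum_i adjm (K i) *m X i *m K i).
Proof.
move=> pX; apply: psdmx_sum => i _; have := psdmx_conj (adjm (K i)) (pX i).
by rewrite adjmK.
Qed.

(** Induction on [k]: Kadison's inequality for the next root, followed by the induction hypothesis,
    compares the squares; [lem_sqr] then takes operator square roots. *)
Lemma jensen_root k (I : finType) m n (K : I -> 'M[CC]_(m, n)) (X : I -> 'M[CC]_m) :
  \sum_i adjm (K i) *m K i = 1%:M -> (forall i, psdmx (X i)) ->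
  lem (\sum_i adjm (K i) *m rootmx k (X i) *m K i)
      (rootmx k (\sum_i adjm (K i) *m X i *m K i)).
Proof.
move=> sK pX; have pS := jensen_psd K pX.
elim: k => [|k IH]; first by rewrite subrr; apply: psdmx0.
have pr i : psdmx (gsqrt (rootmx k (X i))) by apply/gsqrt_psd/rootmx_psd.
have p1 : psdmx (\sum_i adjm (K i) *m rootmx k.+1 (X i) *m K i).
  exact: jensen_psd.
apply: lem_sqr => //; first exact/gsqrt_psd/rootmx_psd.
rewrite gsqrt_sqr; last exact: rootmx_psd.
apply: lem_trans IH; have := kadison sK (fun i => psdmx_herm (pr i)).
rewrite /=; congr (psdmx (_ - _)); apply: eq_bigr => i _.
by rewrite gsqrt_sqr //; apply: rootmx_psd.
Qed.

End RootsAndLogarithm.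

Global Opaque gsqrt rootmx.

(** * Traces against logarithms, the pinching inequality and Gibbs' inequality *)

Section LogTrace.
Variables (RR : realType) (CC : complexLike RR).
Local Notation lem A B := (psdmx (B - A)).

Lemma ln_le_subr1 (y : RR) : 0 < y -> ln y <= y - 1.
Proof.
move=> y0; rewrite lerBrDl -[leRHS]lnK ?posrE //.
exact: expR_ge1Dx.
Qed.

Lemma ln_ge_1subV (y : RR) : 0 < y -> 1 - y^-1 <= ln y.
Proof.
move=> y0; have := @ln_le_subr1 y^-1; rewrite invr_gt0 => /(_ y0).
rewrite lnV ?posrE //; lra.
Qed.

Lemma rootk_gt0 k (a : RR) : 0 < a -> 0 < rootk k a.
Proof. by elim: k => //= k IH /IH h; rewrite sqrtr_gt0. Qed.

Lemma ln_rootk k (a : RR) : 0 < a -> ln (rootk k a) = ln a / 2 ^+ k.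
Proof.
move=> a0; elim: k => [|k IH]; first by rewrite expr0 divr1.
have y0 := rootk_gt0 k a0.
have -> : ln a / 2 ^+ k.+1 = (ln a / 2 ^+ k) / 2.
  by rewrite exprSr invfM mulrA.
rewrite -IH /= -{2}(sqr_sqrtr (ltW y0)) lnXn ?sqrtr_gt0 //.
by field.
Qed.

Lemma rootk_lower k (a : RR) : 0 < a -> ln a <= 2 ^+ k * (rootk k a - 1).
Proof.
move=> a0; have N0 : 0 < (2 : RR) ^+ k by rewrite exprn_gt0.
have := ln_le_subr1 (rootk_gt0 k a0); rewrite ln_rootk //.
by rewrite ler_pdivrMr // mulrC.
Qed.

(** With [y = a ^ (1 / 2 ^ k)], the bound [1 - 1 / y <= ln y] gives at most [y * ln a] on the left,
    and [(y - 1) * ln a] is of order [(ln a) ^+ 2 / 2 ^ k]. The factor [1 + a] bounds [y] when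
    [a >= 1] and is slack when [a < 1]. *)
Lemma rootk_upper k (a : RR) : 0 < a ->
  2 ^+ k * (rootk k a - 1) <= ln a + ((1 + a) * (ln a) ^+ 2) / 2 ^+ k.
Proof.
move=> a0; have N0 : 0 < (2 : RR) ^+ k by rewrite exprn_gt0.
have N1 : 1 <= (2 : RR) ^+ k by rewrite exprn_ege1 // ler1n.
have y0 := rootk_gt0 k a0.
have hl := ln_rootk k a0.
have h1 := ln_ge_1subV y0.
have h2 := ln_le_subr1 y0.
have h3 : rootk k a - 1 <= rootk k a * ln (rootk k a).
  have := ler_wpM2l (ltW y0) h1; rewrite mulrBr mulr1 mulfV ?gt_eqF //.
move: h2 h3; rewrite hl; set y := rootk k a; set N := 2 ^+ k; set L := ln a => h2 h3.
have {}h3 : N * (y - 1) <= y * L.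
  by rewrite mulrC -ler_pdivlMr // -mulrA.
apply: le_trans h3 _; rewrite -lerBlDl -[X in _ - X]mul1r -mulrBl.
have [L0|L0] := leP 0 L.
  have ya : y <= 1 + a.
    have : y <= a.
      rewrite -ler_ln ?posrE // hl ler_pdivrMr // -/L.
      by rewrite -[leLHS]mulr1 ler_wpM2l.
    by move=> h; apply: le_trans h _; rewrite lerDr.
  apply: (@le_trans _ _ (y * (L / N) * L)).
    rewrite ler_wpM2r //.
    have := h1; rewrite hl -/y -/L -/N => h1'.
    have := ler_wpM2l (ltW y0) h1'; rewrite mulrBr mulr1 mulfV ?gt_eqF //.
  have -> : y * (L / N) * L = y * (L ^+ 2 / N) by ring.
  have -> : (1 + a) * L ^+ 2 / N = (1 + a) * (L ^+ 2 / N) by ring.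
  by rewrite ler_wpM2r // divr_ge0 ?sqr_ge0 // ltW.
apply: (@le_trans _ _ ((L / N) * L)).
  by rewrite ler_wnM2r // ltW.
have -> : L / N * L = L ^+ 2 / N by ring.
have -> : (1 + a) * L ^+ 2 / N = L ^+ 2 / N + a * (L ^+ 2 / N) by ring.
by rewrite lerDl mulr_ge0 ?divr_ge0 ?sqr_ge0 // ltW.
Qed.

Lemma le_vanish (x y c : RR) : (forall k : nat, x <= y + c / 2 ^+ k) -> x <= y.
Proof.
move=> h; apply/ler_addgt0Pr => e e0.
have [c0|c0] := leP c 0.
  apply: le_trans (h 0%N) _; rewrite lerD2l expr0 divr1; exact: le_trans c0 (ltW e0).
have /archi_boundP := divr_ge0 (ltW c0) (ltW e0).
set k := Num.bound _ => hk.
apply: le_trans (h k) _; rewrite lerD2l ler_pdivrMr ?exprn_gt0 //.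
rewrite mulrC -ler_pdivrMr //; apply: le_trans (ltW hk) _.
by rewrite -natrX ler_nat ltnW // ltn_expl.
Qed.

(** Entropic quantities become differences of such terms: [- tlog r r] is the entropy, and
    [tlog r r - tlog r s] the relative entropy under the support condition. *)
Definition tlog n (r A : 'M[CC]_n) : RR := rtr (r *m glog A).

Lemma tlog_rsum (I : finType) n (r : 'M[CC]_n) (d : I -> RR) E : resol E ->
  tlog r (rsum d E) = \sum_i ln (d i) * rtr (r *m E i).
Proof. by move=> rE; rewrite /tlog /glog fcalc_resol // rtr_rsum. Qed.

(* The support of [r] is contained in that of [A]. *)
Definition dominated n (r A : 'M[CC]_n) : Prop :=
  forall v : 'rV[CC]_n, v *m A = 0 -> v *m r = 0.

Lemma dominated_mx m n (M : 'M[CC]_(m, n)) (r A : 'M[CC]_n) :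
  dominated r A -> M *m A = 0 -> M *m r = 0.
Proof.
move=> h MA; apply/row_matrixP => i; rewrite row_mul row0; apply: h.
by rewrite -row_mul MA row0.
Qed.

Lemma dominated_trans n (B A D : 'M[CC]_n) :
  dominated A B -> dominated B D -> dominated A D.
Proof. by move=> h1 h2 v /h2/h1. Qed.

Lemma dominated_resol (I : finType) n (r : 'M[CC]_n) (d : I -> RR) E i : resol E ->
  dominated r (rsum d E) -> d i = 0 -> E i *m r = 0.
Proof.
move=> rE h d0; apply: dominated_mx h _.
by rewrite rsumEl // d0 rmorph0 scale0r.
Qed.

Lemma dominated_rtr (I : finType) n (r : 'M[CC]_n) (d : I -> RR) E i : resol E ->
  dominated r (rsum d E) -> d i = 0 -> rtr (r *m E i) = 0.
Proof.
by move=> rE h d0; rewrite rtrC (dominated_resol rE h d0) rtr0.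
Qed.

(** A vector annihilating [A] makes the form of [r] at most zero. Support conditions thus follow
    from operator inequalities with arbitrary constants, such as those that pinching yields. *)
Lemma lem_dominated n (c : RR) (r A : 'M[CC]_n) : psdmx r ->
  lem r (c%:C *: A) -> dominated r A.
Proof.
move=> pr h v vA; apply: psd_ker => //.
have := psd_rtr_ge0 (psdmx_conj v h).
by rewrite mulmxBr mulmxBl rtrB -scalemxAr vA scaler0 mul0mx rtr0 sub0r oppr_ge0.
Qed.

(** Invertibility as a lower bound [c], the form in which adding multiples of the identity and
    comparing operators use it. *)
Definition pdmx n (A : 'M[CC]_n) : Prop :=
  psdmx A /\ exists2 c : RR, 0 < c & psdmx (A - c%:C%:M).

Lemma resol_ge (I : finType) n (c : RR) (d : I -> RR) (E : I -> 'M[CC]_n) i :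
  resol E -> psdmx (rsum d E - c%:C%:M) -> E i = 0 \/ c <= d i.
Proof.
move=> rE h; have [hE hEE _] := rE.
have [dc|dc] := leP c (d i); [by right | left].
have : psdmx (E i *m (rsum d E - c%:C%:M) *m E i).
  by have := psdmx_conj (E i) h; rewrite hE.
rewrite mulmxBr rsumEl // mul_mx_scalar -scalerBl -scalemxAl hEE eqxx -rmorphB.
move=> /psd_rtr_ge0; rewrite rtrZ nmulr_rge0 ?subr_lt0 // => t0.
by apply: psd_tr0 => //; apply: resol_psd.
Qed.

Lemma pdmx_resol (I : finType) n (d : I -> RR) (E : I -> 'M[CC]_n) i :
  resol E -> pdmx (rsum d E) -> E i = 0 \/ 0 < d i.
Proof.
move=> rE [_ [c c0 h]]; have [->|dc] := resol_ge i rE h; [by left | right].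
exact: lt_le_trans dc.
Qed.

Lemma psdmx_resol (I : finType) n (d : I -> RR) (E : I -> 'M[CC]_n) i :
  resol E -> psdmx (rsum d E) -> E i = 0 \/ 0 <= d i.
Proof.
by move=> rE h; apply: resol_ge => //; rewrite rmorph0 raddf0 subr0.
Qed.

Lemma pdmx_dominated n (r A : 'M[CC]_n) : pdmx A -> dominated r A.
Proof.
move=> [pA [c c0 h]] v vA; suff -> : v = 0 by rewrite mul0mx.
have := psd_rtr_ge0 (psdmx_conj v h).
rewrite mulmxBr mulmxBl vA mul0mx sub0r rtrN mul_mx_scalar -scalemxAl rtrZ.
by rewrite oppr_ge0 pmulr_rle0 // => /gram_tr0.
Qed.

(* The logarithm is the limit of [2 ^ k * (x ^ (1 / 2 ^ k) - 1)], so that its operator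
   monotonicity and operator Jensen inequality follow from those of the square root. *)
Lemma tlog_lower k n (r A : 'M[CC]_n) : psdmx r -> psdmx A -> dominated r A ->
  tlog r A <= 2 ^+ k * (rtr (r *m rootmx k A) - rtr r).
Proof.
move=> pr /psd_resol[d [E [rE -> d0]]] h.
rewrite tlog_rsum // rootmx_rsum // -[X in _ - rtr X]mulmx1 -(rsum1 rE) !rtr_rsum.
rewrite -sumrB mulr_sumr; apply: ler_sum => i _; rewrite -mulrBl mulrA.
have p0 : 0 <= rtr (r *m E i) by apply: psd_rtrM_ge0 => //; apply: resol_psd.
have [di|di] := eqVneq (d i) 0; first by rewrite (dominated_rtr rE h di) !mulr0.
by rewrite ler_wpM2r // rootk_lower // lt_neqAle eq_sym di d0.
Qed.

Lemma tlog_upper n (r A : 'M[CC]_n) : psdmx r -> psdmx A -> dominated r A ->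
  exists c : RR, forall k,
  2 ^+ k * (rtr (r *m rootmx k A) - rtr r) <= tlog r A + c / 2 ^+ k.
Proof.
move=> pr /psd_resol[d [E [rE -> d0]]] h.
(* The scalar errors of [rootk_upper], weighted by the traces of [r] against the eigenprojections;
   the sum does not depend on [k]. *)
exists (\sum_i ((1 + d i) * (ln (d i)) ^+ 2) * rtr (r *m E i)) => k.
rewrite tlog_rsum // rootmx_rsum // -[X in _ - rtr X]mulmx1 -(rsum1 rE) !rtr_rsum.
rewrite -sumrB mulr_sumr mulr_suml -big_split /=; apply: ler_sum => i _.
rewrite -mulrBl mulrA [_ * rtr _ / _]mulrAC -mulrDl.
have p0 : 0 <= rtr (r *m E i) by apply: psd_rtrM_ge0 => //; apply: resol_psd.
have [di|di] := eqVneq (d i) 0; first by rewrite (dominated_rtr rE h di) !mulr0.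
by rewrite ler_wpM2r // rootk_upper // lt_neqAle eq_sym di d0.
Qed.

Lemma tlog_le n (r A B : 'M[CC]_n) : psdmx r -> psdmx A -> psdmx B ->
  dominated r A -> lem A B -> tlog r A <= tlog r B.
Proof.
move=> pr pA pB rA AB.
have rB : dominated r B.
  apply: dominated_trans rA _; apply: (@lem_dominated _ 1) => //.
  by rewrite rmorph1 scale1r.
have [c hc] := tlog_upper pr pB rB.
apply: (@le_vanish _ _ c) => k; apply: le_trans (hc k).
apply: le_trans (tlog_lower k pr pA rA) _.
rewrite ler_pM2l ?exprn_gt0 // lerD2r.
by apply: lem_rtr => //; apply: lem_root.
Qed.

Lemma tlog_jensen (I : finType) m n (r : 'M[CC]_n) (K : I -> 'M[CC]_(m, n))
    (X : I -> 'M[CC]_m) : psdmx r ->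
  \sum_i adjm (K i) *m K i = 1%:M -> (forall i, psdmx (X i)) ->
  (forall i, dominated (K i *m r *m adjm (K i)) (X i)) ->
  dominated r (\sum_i adjm (K i) *m X i *m K i) ->
  \sum_i tlog (K i *m r *m adjm (K i)) (X i)
  <= tlog r (\sum_i adjm (K i) *m X i *m K i).
Proof.
move=> pr sK pX dX dS.
have pS := jensen_psd K pX.
have [c hc] := tlog_upper pr pS dS.
apply: (@le_vanish _ _ c) => k; apply: le_trans (hc k).
have e1 : rtr r = \sum_i rtr (K i *m r *m adjm (K i)).
  rewrite -[in LHS](mulmx1 r) -sK mulmx_sumr rtr_sum; apply: eq_bigr => i _.
  by rewrite mulmxA rtrC mulmxA.
apply: (@le_trans _ _ (2 ^+ k * (\sum_i rtr (K i *m r *m adjm (K i) *m rootmx k (X i)) - rtr r))).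
  rewrite e1 -sumrB mulr_sumr; apply: ler_sum => i _.
  by apply: tlog_lower => //; apply: psdmx_conj.
rewrite ler_pM2l ?exprn_gt0 // lerD2r.
have -> : \sum_i rtr (K i *m r *m adjm (K i) *m rootmx k (X i))
   = rtr (r *m (\sum_i adjm (K i) *m rootmx k (X i) *m K i)).
  rewrite mulmx_sumr rtr_sum; apply: eq_bigr => i _.
  by rewrite -!mulmxA rtrC !mulmxA.
by apply: lem_rtr => //; apply: jensen_root.
Qed.

(** With [ln 0 = 0] the product rule fails at a zero eigenvalue; [dominated] gives its eigenspace
    weight zero. *)
Lemma tlogZ n (c : RR) (r A : 'M[CC]_n) : 0 < c -> psdmx A -> dominated r A ->
  tlog r (c%:C *: A) = ln c * rtr r + tlog r A.
Proof.
move=> c0 /psd_resol[d [E [rE -> d0]]] h.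
have -> : c%:C *: rsum d E = rsum (fun i => c * d i) E.
  by rewrite /rsum scaler_sumr; apply: eq_bigr => i _; rewrite scalerA rmorphM.
rewrite !tlog_rsum // -[X in _ * rtr X](mulmx1 r) -(rsum1 rE) rtr_rsum mulr_sumr.
rewrite -big_split /=; apply: eq_bigr => i _; rewrite mul1r -mulrDl.
have [di|di] := eqVneq (d i) 0; first by rewrite (dominated_rtr rE h di) !mulr0.
by rewrite lnM // posrE // lt_neqAle eq_sym di d0.
Qed.

Definition pinch (I : finType) n (E : I -> 'M[CC]_n) (X : 'M[CC]_n) : 'M[CC]_n :=
  \sum_i E i *m X *m E i.

Lemma pinch_psd (I : finType) n (E : I -> 'M[CC]_n) X : resol E -> psdmx X ->
  psdmx (pinch E X).
Proof.
move=> [hE _ _] pX; apply: psdmx_sum => i _.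
by have := psdmx_conj (E i) pX; rewrite hE.
Qed.

(** The positive matrices [(E i - E j) X (E i - E j)], summed over all pairs, give twice the gap;
    this takes the place of averaging over phase unitaries. *)
Lemma pinch_lem (I : finType) n (E : I -> 'M[CC]_n) X : resol E -> psdmx X ->
  lem X ((#|I|%:R)%:C *: pinch E X).
Proof.
move=> [hE _ sE] pX.
have e : \sum_i \sum_j (E i - E j) *m X *m (E i - E j) =
    2%:C *: ((#|I|%:R)%:C *: pinch E X - X).
  under eq_bigr => i _.
    under eq_bigr => j _ do rewrite mulmxBr !mulmxBl.
    rewrite !sumrB sumr_const -[X in _ - X - _]mulmx_suml -mulmx_suml sE mul1mx.
    rewrite -mulmx_sumr sE mulmx1 -/(pinch E X).
    over.
  rewrite /= !sumrB sumr_const -mulmx_sumr sE mulmx1 -mulmx_suml sE mul1mx.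
  rewrite sumrMnl -/(pinch E X) -/#|I|.
  have -> : (2 : RR)%:C = 1 + 1 :> CC by rewrite rmorphD rmorph1.
  rewrite scalerDl scale1r rmorph_nat scaler_nat.
  by rewrite opprB.
have : psdmx (2^-1%:C *: \sum_i \sum_j (E i - E j) *m X *m (E i - E j)).
  apply: psdmxZ; first by rewrite invr_ge0.
  apply: psdmx_sum => i _; apply: psdmx_sum => j _.
  by have := psdmx_conj (E i - E j) pX; rewrite adjmB !hE.
by rewrite e scalerA -rmorphM mulVf // rmorph1 scale1r.
Qed.

Lemma pinch_comm (I : finType) n (d : I -> RR) (E : I -> 'M[CC]_n) X : resol E ->
  rsum d E *m pinch E X = pinch E X *m rsum d E.
Proof.
move=> rE; rewrite /pinch mulmx_sumr mulmx_suml; apply: eq_bigr => i _.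
by rewrite !mulmxA rsumE // -!mulmxA rsumEl // -!scalemxAl -!scalemxAr.
Qed.

(** With [c i j = tr (E i F j)] for eigenprojections [E] of [r] and [F] of [t], the numbers
    [p i * c i j] and [s j * c i j / T] are two probability distributions on pairs, and the claim is
    the classical Gibbs inequality for them. *)
Lemma gibbs n (r t : 'M[CC]_n) : psdmx r -> rtr r = 1 -> psdmx t -> dominated r t ->
  0 < rtr t /\ - ln (rtr t) <= tlog r r - tlog r t.
Proof.
move=> pr tr1 pt dt.
have T0 : 0 < rtr t.
  rewrite lt_neqAle psd_rtr_ge0 // andbT eq_sym; apply/negP => /eqP t0.
  have t00 : t = 0 by apply: psd_tr0 => //; rewrite t0.
  have : (1%:M : 'M[CC]_n) *m r = 0 by apply: dominated_mx dt _; rewrite t00 mulmx0.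
  by rewrite mul1mx => r0; move: tr1; rewrite r0 rtr0 => /esym/eqP; rewrite oner_eq0.
split=> //; set T := rtr t in T0 *.
have [p [E [rE er p0]]] := psd_resol pr.
have [s [F [rF et s0]]] := psd_resol pt.
pose c i j := rtr (E i *m F j).
have c0 i j : 0 <= c i j by apply: psd_rtrM_ge0; apply: resol_psd.
have [_ _ sE] := rE; have [_ _ sF] := rF.
have rFj j : rtr (r *m F j) = \sum_i p i * c i j.
  rewrite er /rsum mulmx_suml rtr_sum; apply: eq_bigr => i _.
  by rewrite -scalemxAl rtrZ.
have e1 : tlog r r = \sum_j \sum_i ln (p i) * (p i * c i j).
  rewrite {2}er tlog_rsum // exchange_big /=; apply: eq_bigr => i _.
  rewrite -mulr_sumr; congr (_ * _).
  rewrite er rsumE // rtrZ -mulr_sumr; congr (_ * _).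
  by rewrite -[in LHS](mulmx1 (E i)) -sF mulmx_sumr rtr_sum.
have e2 : tlog r t = \sum_j \sum_i ln (s j) * (p i * c i j).
  by rewrite et tlog_rsum //; apply: eq_bigr => j _; rewrite rFj mulr_sumr.
have e3 : 1 = \sum_j \sum_i p i * c i j.
  rewrite -tr1 -[in LHS](mulmx1 r) -sF mulmx_sumr rtr_sum.
  by apply: eq_bigr => j _; rewrite rFj.
have e4 : 1 = \sum_j \sum_i s j * c i j / T.
  rewrite -[LHS](@mulfV _ T) ?gt_eqF // {1}/T -[in LHS](mul1mx t) -sE et.
  rewrite mulmx_suml rtr_sum mulr_suml exchange_big /=; apply: eq_bigr => i _.
  by rewrite rtr_rsum mulr_suml.
have zero i j : s j = 0 -> p i * c i j = 0.
  move=> sj; have := rFj j; rewrite (dominated_rtr rF _ sj) -?et //.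
  move=> /esym/eqP; rewrite psumr_eq0 => [|k _]; last by rewrite mulr_ge0.
  by move=> /allP/(_ i); rewrite mem_index_enum => /(_ isT)/eqP.
rewrite -subr_ge0 opprK -[ln T]mul1r {1}e3 mulr_suml e1 e2 -sumrB -big_split /=.
(* Zero is written as the difference of the two total masses, so that the inequality can be checked
   term by term. *)
rewrite [leLHS](_ : 0 = \sum_j \sum_i (p i * c i j - s j * c i j / T)); last first.
  have h := subrr (1 : RR); rewrite {1}e3 e4 -sumrB in h.
  by rewrite -[LHS]h; apply: eq_bigr => j _; rewrite sumrB.
apply: ler_sum => j _; rewrite mulr_suml -sumrB -big_split /=.
apply: ler_sum => i _.
have [pc|pc] := eqVneq (p i * c i j) 0.
  by rewrite pc !mulr0 mul0r subrr addr0 sub0r oppr_le0 !mulr_ge0 ?invr_ge0 // ltW.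
have pi0 : 0 < p i.
  rewrite lt_neqAle p0 andbT eq_sym; apply: contraNneq pc => ->.
  by rewrite mul0r.
have sj0 : 0 < s j.
  by rewrite lt_neqAle s0 andbT eq_sym; apply: contraNneq pc => /zero ->.
rewrite -mulrBl [p i * _ * ln T]mulrC -mulrDl.
have -> : ln (p i) - ln (s j) + ln T = ln (p i * T / s j).
  by rewrite ln_div ?posrE ?mulr_gt0 // lnM ?posrE // addrAC.
have h : 0 < p i * T / s j by rewrite divr_gt0 ?mulr_gt0.
apply: le_trans (ler_wpM2r _ (ln_ge_1subV h)); last by rewrite mulr_ge0.
rewrite le_eqVlt; apply/orP; left; apply/eqP.
field; rewrite ?gt_eqF //.
Qed.

(** [S + 'i *: Q] is normal, so one diagonalization serves both; real and imaginary parts of its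
    eigenvalues are those of [S] and [Q]. *)
Lemma joint_resol n (S Q : 'M[CC]_n) : adjm S = S -> adjm Q = Q -> S *m Q = Q *m S ->
  exists (s q : 'I_n -> RR) (E : 'I_n -> 'M[CC]_n),
    [/\ resol E, S = rsum s E & Q = rsum q E].
Proof.
move=> hS hQ SQ; pose N := S + 'i *: Q.
have aN : adjm N = S - 'i *: Q by rewrite adjmD adjmZ hS hQ conjCi scaleNr.
have nN : N \is normalmx.
  apply/normalmxP; rewrite -adjmE aN /N.
  have SQ' : S *m ('i *: Q) = ('i *: Q) *m S by rewrite -scalemxAr -scalemxAl SQ.
  move: ('i *: Q) SQ' => Q' SQ'; rewrite mulmxBr mulmxBl !mulmxDl !mulmxDr SQ'.
  by apply/matrixP => i j; rewrite !mxE; ring.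
have [PP' P'P] := spectral_unitary N.
have /orthomx_spectralP := nN; rewrite invmx_spectral.
set P := spectralmx N in PP' P'P *; set z := spectral_diag N => eN.
have aN' : adjm N = adjm P *m diag_mx (map_mx Num.conj z) *m P.
  rewrite {1}eN !adjmM adjmK mulmxA; congr (_ *m _ *m _).
  by apply/matrixP => i j; rewrite !mxE rmorphMn eq_sym; case: eqP => [->|].
pose s i := re ((z 0 i + Num.conj (z 0 i)) / 2).
pose q i := re ((z 0 i - Num.conj (z 0 i)) / (2 * 'i)).
have si i : (s i)%:C = (z 0 i + Num.conj (z 0 i)) / 2.
  apply: ofR_re; apply/CrealP.
  by rewrite rmorphM rmorphD /= conjCK fmorphV rmorph_nat addrC.
have qi i : (q i)%:C = (z 0 i - Num.conj (z 0 i)) / (2 * 'i).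
  apply: ofR_re; apply/CrealP.
  rewrite rmorphM rmorphB /= conjCK fmorphV rmorphM /= conjCi rmorph_nat.
  by rewrite mulrN invrN mulrN -mulNr opprB.
have two0 : (2 : CC) != 0 by rewrite pnatr_eq0.
have eS : S = 2^-1 *: (N + adjm N).
  by rewrite aN addrACA subrr addr0 -mulr2n -scaler_nat scalerA mulVf // scale1r.
have eQ : Q = (2 * 'i)^-1 *: (N - adjm N).
  have -> : N - adjm N = (2 * 'i) *: Q.
    by rewrite aN /N; apply/matrixP => i j; rewrite !mxE; ring.
  by rewrite scalerA mulVf ?scale1r // mulf_neq0 // neq0Ci.
exists s, q, (fun i => adjm P *m delta_mx i i *m P).
have rE : resol (fun i => adjm P *m delta_mx i i *m P) by exact: resol_unitary.
have diagE (w : 'rV[CC]_n) :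
    adjm P *m diag_mx w *m P = \sum_i w 0 i *: (adjm P *m delta_mx i i *m P).
  rewrite diag_mx_sum_delta mulmx_sumr mulmx_suml; apply: eq_bigr => i _.
  by rewrite -scalemxAr -scalemxAl.
split=> //.
  rewrite {1}eS aN' {1}eN !diagE -big_split /= scaler_sumr; apply: eq_bigr => i _.
  by rewrite mxE -scalerDl scalerA si mulrC.
rewrite {1}eQ aN' {1}eN !diagE -sumrB /= scaler_sumr; apply: eq_bigr => i _.
by rewrite mxE -scalerBl scalerA qi mulrC.
Qed.

(** In a joint eigenbasis this is [ln (s * q * s) = ln q + 2 * ln s]. Pinching exists to supply the
    commutation. *)
Lemma tlog_mul n (r S Q : 'M[CC]_n) : psdmx r -> pdmx S -> psdmx Q ->
  S *m Q = Q *m S -> dominated r Q ->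
  tlog r (S *m Q *m S) = tlog r Q + 2 * tlog r S.
Proof.
move=> pr pS pQ SQ rQ; have [pS' _] := pS.
have [s [q [E [rE eS eQ]]]] := joint_resol (psdmx_herm pS') (psdmx_herm pQ) SQ.
rewrite eS eQ !rsum_mul // !tlog_rsum // mulr_sumr -big_split /=.
apply: eq_bigr => i _; rewrite mulrA -mulrDl.
have [qi|qi] := eqVneq (q i) 0.
  by rewrite (dominated_rtr rE _ qi) ?mulr0 // -eQ.
have [->|si] := @pdmx_resol _ _ s _ i rE (eq_ind _ _ pS _ eS).
  by rewrite mulmx0 rtr0 !mulr0.
have [->|qi0] := @psdmx_resol _ _ q _ i rE (eq_ind _ _ pQ _ eQ).
  by rewrite mulmx0 rtr0 !mulr0.
have q0 : 0 < q i by rewrite lt_neqAle eq_sym qi qi0.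
by congr (_ * _); rewrite !lnM ?posrE ?mulr_gt0 //; ring.
Qed.

Lemma tlog_sqr n (r S : 'M[CC]_n) : psdmx r -> pdmx S ->
  tlog r (S *m S) = 2 * tlog r S.
Proof.
move=> pr pS; have [pS' _] := pS.
have [s [E [rE eS s0]]] := psd_resol pS'.
rewrite eS rsum_mul // !tlog_rsum // mulr_sumr; apply: eq_bigr => i _.
rewrite mulrA; have [->|si] := @pdmx_resol _ _ s _ i rE (eq_ind _ _ pS _ eS).
  by rewrite mulmx0 rtr0 !mulr0.
by rewrite lnM ?posrE //; congr (_ * _); ring.
Qed.

End LogTrace.

(** * Operators on systems, channels and Kraus operators *)

Section IndexedOperators.
Variables (RR : realType) (CC : complexLike RR).
Implicit Types X Y Z K : finType.

(** Rectangular so that Kraus operators fit; the square case is [op] over the abstract field. *)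
Definition rop X Y := 'M[CC]_(#|X|, #|Y|).
Definition rmk X Y (f : X -> Y -> CC) : rop X Y :=
  \matrix_(i, j) f (enum_val i) (enum_val j).
Definition rent X Y (A : rop X Y) (x : X) (y : Y) : CC :=
  A (enum_rank x) (enum_rank y).

Lemma rentE X Y (f : X -> Y -> CC) x y : rent (rmk f) x y = f x y.
Proof. by rewrite /rent mxE !enum_rankK. Qed.

Lemma ropP X Y (A B : rop X Y) : (forall x y, rent A x y = rent B x y) -> A = B.
Proof.
move=> h; apply/matrixP => i j.
by have := h (enum_val i) (enum_val j); rewrite /rent !enum_valK.
Qed.

Lemma sum_enum_rank X (F : 'I_#|X| -> CC) : \sum_i F i = \sum_(x : X) F (enum_rank x).
Proof.
rewrite (reindex (@enum_rank X)) //=.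
by exists enum_val => x _; rewrite ?enum_rankK ?enum_valK.
Qed.

Lemma rent_mul X Y Z (A : rop X Y) (B : rop Y Z) x z :
  rent (A *m B) x z = \sum_y rent A x y * rent B y z.
Proof. by rewrite /rent mxE sum_enum_rank. Qed.

Lemma rent_adj X Y (A : rop X Y) x y : rent (adjm A) y x = Num.conj (rent A x y).
Proof. by rewrite /rent adjm_ij. Qed.

Lemma rentD X Y (A B : rop X Y) x y : rent (A + B) x y = rent A x y + rent B x y.
Proof. by rewrite /rent mxE. Qed.

Lemma rentZ X Y (a : CC) (A : rop X Y) x y : rent (a *: A) x y = a * rent A x y.
Proof. by rewrite /rent mxE. Qed.

Lemma rent0 X Y x y : rent (0 : rop X Y) x y = 0.
Proof. by rewrite /rent mxE. Qed.

Lemma rent_sum X Y (I : Type) (r : seq I) (P : pred I) (F : I -> rop X Y) x y :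
  rent (\sum_(i <- r | P i) F i) x y = \sum_(i <- r | P i) rent (F i) x y.
Proof. by rewrite /rent summxE. Qed.

Lemma rent1 X x y : rent (1%:M : rop X X) x y = (x == y)%:R.
Proof. by rewrite /rent mxE (inj_eq enum_rank_inj). Qed.

Lemma tr_rent X (A : rop X X) : \tr A = \sum_x rent A x x.
Proof. by rewrite /mxtrace sum_enum_rank. Qed.

Lemma sum_delta X (F : X -> CC) x : \sum_y F y * (x == y)%:R = F x.
Proof.
rewrite (bigD1 x) //= big1 => [|y yx]; first by rewrite eqxx mulr1 addr0.
by rewrite eq_sym (negbTE yx) mulr0.
Qed.

Lemma sum_deltal X (F : X -> CC) x : \sum_y (x == y)%:R * F y = F x.
Proof. by rewrite -[RHS]sum_delta; apply: eq_bigr => y _; rewrite mulrC. Qed.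

Lemma sum_deltar X (F : X -> CC) x : \sum_y F y * (y == x)%:R = F x.
Proof. by rewrite -[RHS]sum_delta; apply: eq_bigr => y _; rewrite eq_sym. Qed.

Lemma sum_deltarl X (F : X -> CC) x : \sum_y (y == x)%:R * F y = F x.
Proof. by rewrite -[RHS]sum_delta; apply: eq_bigr => y _; rewrite mulrC eq_sym. Qed.

Lemma sum_pair X Y (F : X * Y -> CC) : \sum_p F p = \sum_x \sum_y F (x, y).
Proof. by rewrite pair_bigA /=; apply: eq_bigr => -[]. Qed.

Definition tensid K X Y (M : rop X Y) : rop (X * K)%type (Y * K)%type :=
  rmk (fun p q : _ * K => rent M p.1 q.1 * (p.2 == q.2)%:R).
Arguments tensid K {X Y} M.

Lemma tensidM K X Y Z (M : rop X Y) (N : rop Y Z) :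
  tensid K (M *m N) = tensid K M *m tensid K N.
Proof.
apply: ropP => -[x k] [z l]; rewrite rentE /= rent_mul rent_mul sum_pair mulr_suml.
apply: eq_bigr => y _.
under eq_bigr => j _ do rewrite !rentE /= mulrACA.
by rewrite -mulr_sumr sum_deltal.
Qed.

Lemma tensid_adj K X Y (M : rop X Y) : adjm (tensid K M) = tensid K (adjm M).
Proof.
apply: ropP => -[x k] [z l]; rewrite rent_adj !rentE /= rent_adj rmorphM rmorph_nat.
by rewrite eq_sym.
Qed.

Lemma tensid1 K X : tensid K (1%:M : rop X X) = 1%:M.
Proof.
apply: ropP => -[x k] [z l]; rewrite rentE !rent1 /= xpair_eqE.
by case: (x == z); rewrite ?mul1r ?mul0r.
Qed.

Lemma tensidD K X Y (M N : rop X Y) : tensid K (M + N) = tensid K M + tensid K N.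
Proof. by apply: ropP => p q; rewrite rentD !rentE rentD mulrDl. Qed.

Lemma tensid0 K X Y : tensid K (0 : rop X Y) = 0.
Proof. by apply: ropP => p q; rewrite rentE !rent0 mul0r. Qed.

Lemma tensidZ K X Y (a : CC) (M : rop X Y) : tensid K (a *: M) = a *: tensid K M.
Proof. by apply: ropP => p q; rewrite rentZ !rentE rentZ mulrA. Qed.

Lemma tensid_sum K X Y (I : Type) (r : seq I) (P : pred I) (F : I -> rop X Y) :
  tensid K (\sum_(i <- r | P i) F i) = \sum_(i <- r | P i) tensid K (F i).
Proof. exact: (big_morph _ (@tensidD K X Y) (tensid0 K X Y)). Qed.

Lemma tensid_resol K X (I : finType) (E : I -> rop X X) :
  resol E -> resol (fun i => tensid K (E i)).
Proof.
move=> [hE hEE sE]; split=> [i|i j|].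
- by rewrite tensid_adj hE.
- by rewrite -tensidM hEE; case: eqP; rewrite ?tensid0.
- by rewrite -tensid_sum sE tensid1.
Qed.

Lemma tensid_rsum K X (I : finType) (d : I -> RR) (E : I -> rop X X) :
  tensid K (rsum d E) = rsum d (fun i => tensid K (E i)).
Proof.
by rewrite /rsum tensid_sum; apply: eq_bigr => i _; rewrite tensidZ.
Qed.

Definition appid X Y K (L : rop X X -> rop Y Y) (A : rop (X * K)%type (X * K)%type)
  : rop (Y * K)%type (Y * K)%type :=
  rmk (fun p q : Y * K =>
    rent (L (rmk (fun x x' => rent A (x, p.2) (x', q.2)))) p.1 q.1).

Definition kraus X Y (I : finType) (M : I -> rop Y X) (A : rop X X) : rop Y Y :=
  \sum_i M i *m A *m adjm (M i).

Lemma rent_tensid_mul K X Y Z (M : rop X Y) (A : rop (Y * K)%type Z) x k z :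
  rent (tensid K M *m A) (x, k) z = \sum_y rent M x y * rent A (y, k) z.
Proof.
rewrite rent_mul sum_pair; apply: eq_bigr => y _.
under eq_bigr => l _ do rewrite rentE /= -mulrA.
by rewrite -mulr_sumr sum_deltal.
Qed.

Lemma rent_mul_tensid K X Y Z (M : rop X Y) (A : rop Z (X * K)%type) z y k :
  rent (A *m tensid K M) z (y, k) = \sum_x rent A z (x, k) * rent M x y.
Proof.
rewrite rent_mul sum_pair; apply: eq_bigr => x _.
under eq_bigr => l _ do rewrite rentE /= mulrA mulrAC.
by rewrite -mulr_suml sum_deltar.
Qed.

Lemma appid_kraus X Y K (I : finType) (M : I -> rop Y X) (A : rop (X * K)%type (X * K)%type) :
  appid (kraus M) A = \sum_i tensid K (M i) *m A *m adjm (tensid K (M i)).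
Proof.
apply: ropP => -[y k] [y' k']; rewrite rentE /= !rent_sum; apply: eq_bigr => i _.
rewrite tensid_adj rent_mul_tensid rent_mul; apply: eq_bigr => x' _.
rewrite rent_tensid_mul rent_mul; congr (_ * _); apply: eq_bigr => x _.
by rewrite rentE.
Qed.

Definition is_chan X Y (L : rop X X -> rop Y Y) : Prop :=
  [/\ forall (a : CC) (A A' : rop X X), L (a *: A + A') = a *: L A + L A',
      forall A : rop X X, \tr (L A) = \tr A
    & forall (k : nat) (A : rop (X * 'I_k)%type (X * 'I_k)%type),
        psdmx A -> psdmx (appid L A)].

Lemma appid_kraus_psd X Y K (I : finType) (M : I -> rop Y X)
    (A : rop (X * K)%type (X * K)%type) : psdmx A -> psdmx (appid (kraus M) A).
Proof. by move=> pA; rewrite appid_kraus; apply: psdmx_sum => i _; apply: psdmx_conj. Qed.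

Lemma tr_kraus X Y (I : finType) (M : I -> rop Y X) A :
  \tr (kraus M A) = \tr (A *m \sum_i adjm (M i) *m M i).
Proof.
rewrite /kraus mulmx_sumr !raddf_sum /=; apply: eq_bigr => i _.
by rewrite -mulmxA mxtrace_mulC -mulmxA.
Qed.

Lemma kraus_linear X Y (I : finType) (M : I -> rop Y X) a A A' :
  kraus M (a *: A + A') = a *: kraus M A + kraus M A'.
Proof.
rewrite /kraus scaler_sumr -big_split /=; apply: eq_bigr => i _.
by rewrite mulmxDr mulmxDl -scalemxAr -scalemxAl.
Qed.

Lemma kraus_chan X Y (I : finType) (M : I -> rop Y X) :
  \sum_i adjm (M i) *m M i = 1%:M -> is_chan (kraus M).
Proof.
move=> sM; split=> [a A A'|A|k A pA]; last exact: appid_kraus_psd.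
  exact: kraus_linear.
by rewrite tr_kraus sM mulmx1.
Qed.

Definition unitop X (x x' : X) : rop X X := rmk (fun y y' => (y == x)%:R * (y' == x')%:R).

Lemma rop_unit X (A : rop X X) : A = \sum_x \sum_x' rent A x x' *: unitop x x'.
Proof.
apply: ropP => y y'; rewrite rent_sum.
under eq_bigr => x _.
  rewrite rent_sum.
  under eq_bigr => x' _ do rewrite rentZ rentE mulrCA.
  rewrite -mulr_sumr sum_delta.
  over.
by rewrite sum_deltal.
Qed.

Lemma linear_ext X Y (L M : rop X X -> rop Y Y) :
  (forall a A A', L (a *: A + A') = a *: L A + L A') ->
  (forall a A A', M (a *: A + A') = a *: M A + M A') ->
  (forall x x', L (unitop x x') = M (unitop x x')) -> forall A, L A = M A.
Proof.
move=> hL hM h A.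
have F0 (F : rop X X -> rop Y Y) :
  (forall a A A', F (a *: A + A') = a *: F A + F A') -> F 0 = 0.
  move=> hF; have := hF 1 0 0; rewrite scaler0 addr0 scale1r.
  by move=> /esym/eqP; rewrite -subr_eq0 addrK => /eqP.
have Fs (F : rop X X -> rop Y Y) :
  (forall a A A', F (a *: A + A') = a *: F A + F A') ->
  F A = \sum_x \sum_x' rent A x x' *: F (unitop x x').
  move=> hF; have FD A1 A2 : F (A1 + A2) = F A1 + F A2.
    by have := hF 1 A1 A2; rewrite !scale1r.
  rewrite {1}(rop_unit A) (big_morph F FD (F0 F hF)); apply: eq_bigr => x _.
  rewrite (big_morph F FD (F0 F hF)); apply: eq_bigr => x' _.
  by rewrite -[X in F X]addr0 hF F0 // addr0.
by rewrite (Fs L) // (Fs M) //; do 2 (apply: eq_bigr => ? _); rewrite h.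
Qed.

(* The Kraus operators are the columns of the square root of the Choi matrix. *)
Lemma chan_kraus X Y (L : rop X X -> rop Y Y) : is_chan L ->
  exists (I : finType) (M : I -> rop Y X),
    L = kraus M /\ \sum_i adjm (M i) *m M i = 1%:M.
Proof.
move=> [linL trL cpL].
(* The unnormalized maximally entangled vector of [X] with a copy ['I_#|X|] of itself; [J] below is
   the Choi matrix. *)
pose v : rop (X * 'I_#|X|)%type unit := rmk (fun p _ => (enum_rank p.1 == p.2)%:R).
have pJ := cpL _ _ (psdmx_gram v).
set J := appid L _ in pJ.
pose S : rop _ _ := gsqrt J.
have hS : adjm S = S := psdmx_herm (gsqrt_psd pJ).
pose M (a : (Y * 'I_#|X|)%type) : rop Y X :=
  rmk (fun y x => rent S (y, enum_rank x) a).
have eL : L = kraus M.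
  apply: funext; apply: linear_ext; [exact: linL|exact: kraus_linear|] => x x'.
  apply: ropP => y y'.
  have -> : rent (L (unitop x x')) y y'
     = rent J (y, enum_rank x) (y', enum_rank x').
    rewrite rentE /=; congr (rent (L _) _ _); congr rmk.
    apply: funext => z; apply: funext => z'.
    rewrite rent_mul (big_pred1 tt); last by case.
    by rewrite rent_adj !rentE /= rmorph_nat !(inj_eq enum_rank_inj).
  rewrite -[J]gsqrt_sqr // -/S -{2}hS rent_mul rent_sum; apply: eq_bigr => a _.
  rewrite rent_adj rent_mul.
  under eq_bigr => w _.
    rewrite rent_mul.
    under eq_bigr => w' _ do rewrite [rent (unitop _ _) _ _]rentE mulrA.
    rewrite -mulr_suml sum_deltar mulrAC rent_adj.
    over.
  by rewrite sum_deltar !rentE.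
exists _, M; split=> //.
(* Trace preservation on the matrix units [unitop x x'] gives the entries of the sum. *)
apply: ropP => x' x; rewrite rent1.
have := trL (unitop x x'); rewrite eL tr_kraus !tr_rent.
under eq_bigr => y _.
  rewrite rent_mul.
  under eq_bigr => y' _ do rewrite rentE -mulrA.
  rewrite -mulr_sumr sum_deltarl.
  over.
rewrite sum_deltarl => ->.
by under eq_bigr => y _ do rewrite rentE; rewrite sum_deltarl eq_sym.
Qed.

Lemma chan_appid_tr X Y K (L : rop X X -> rop Y Y) (A : rop (X * K)%type (X * K)%type) :
  is_chan L -> \tr (appid L A) = \tr A.
Proof.
move=> /chan_kraus[I [M [-> sM]]]; rewrite appid_kraus.
have -> : \sum_i tensid K (M i) *m A *m adjm (tensid K (M i))
  = kraus (fun i => tensid K (M i)) A by [].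
rewrite tr_kraus; under eq_bigr => i _ do rewrite tensid_adj -tensidM.
by rewrite -tensid_sum sM tensid1 mulmx1.
Qed.

(** Isometries whose orthogonal ranges fill the space. For the embeddings [x -> (x, k)], [amplify]
    is [A (x) id] and [compress] the partial trace; the abstraction treats tensor factors in any
    position alike. *)
Definition isofam (I : finType) m n (T : I -> 'M[CC]_(m, n)) : Prop :=
  (forall i j, adjm (T i) *m T j = if i == j then 1%:M else 0) /\
  \sum_i T i *m adjm (T i) = 1%:M.

Definition amplify (I : finType) m n (T : I -> 'M[CC]_(m, n)) (A : 'M[CC]_n) : 'M[CC]_m :=
  \sum_i T i *m A *m adjm (T i).
Definition compress (I : finType) m n (T : I -> 'M[CC]_(m, n)) (A : 'M[CC]_m) : 'M[CC]_n :=
  \sum_i adjm (T i) *m A *m T i.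

Lemma amplify_psd (I : finType) m n (T : I -> 'M[CC]_(m, n)) A :
  psdmx A -> psdmx (amplify T A).
Proof. by move=> pA; apply: psdmx_sum => i _; apply: psdmx_conj. Qed.

Lemma compress_psd (I : finType) m n (T : I -> 'M[CC]_(m, n)) A :
  psdmx A -> psdmx (compress T A).
Proof.
by move=> pA; apply: psdmx_sum => i _; have := psdmx_conj (adjm (T i)) pA; rewrite adjmK.
Qed.

Lemma amplifyM (I : finType) m n (T : I -> 'M[CC]_(m, n)) A B : isofam T ->
  amplify T A *m amplify T B = amplify T (A *m B).
Proof.
move=> [hT _]; rewrite /amplify mulmx_suml; apply: eq_bigr => i _.
rewrite mulmx_sumr (bigD1 i) //= big1 => [|j ji].
  by rewrite addr0 !mulmxA -[_ *m adjm (T i) *m T i]mulmxA hT eqxx mulmx1.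
rewrite !mulmxA -[_ *m adjm (T i) *m T j]mulmxA hT eq_sym (negbTE ji).
by rewrite mulmx0 !mul0mx.
Qed.

Lemma amplify_adj (I : finType) m n (T : I -> 'M[CC]_(m, n)) A :
  adjm (amplify T A) = amplify T (adjm A).
Proof.
by rewrite /amplify adjm_sum; apply: eq_bigr => i _; rewrite !adjmM adjmK mulmxA.
Qed.

Lemma amplify1 (I : finType) m n (T : I -> 'M[CC]_(m, n)) : isofam T ->
  amplify T 1%:M = 1%:M.
Proof.
by move=> [_ <-]; apply: eq_bigr => i _; rewrite mulmx1.
Qed.

Lemma amplifyD (I : finType) m n (T : I -> 'M[CC]_(m, n)) A B :
  amplify T (A + B) = amplify T A + amplify T B.
Proof.
by rewrite /amplify -big_split /=; apply: eq_bigr => i _; rewrite mulmxDr mulmxDl.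
Qed.

Lemma amplifyZ (I : finType) m n (T : I -> 'M[CC]_(m, n)) a A :
  amplify T (a *: A) = a *: amplify T A.
Proof.
rewrite /amplify scaler_sumr; apply: eq_bigr => i _.
by rewrite -scalemxAr -scalemxAl.
Qed.

Lemma amplify0 (I : finType) m n (T : I -> 'M[CC]_(m, n)) : amplify T 0 = 0.
Proof. by rewrite /amplify big1 // => i _; rewrite mulmx0 mul0mx. Qed.

Lemma amplify_sum (I : finType) m n (T : I -> 'M[CC]_(m, n)) (J : Type) (r : seq J)
   (P : pred J) (F : J -> 'M[CC]_n) :
  amplify T (\sum_(i <- r | P i) F i) = \sum_(i <- r | P i) amplify T (F i).
Proof. exact: (big_morph _ (@amplifyD I m n T) (amplify0 T)). Qed.

Lemma rtr_amplify (I : finType) m n (T : I -> 'M[CC]_(m, n)) A B :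
  rtr (A *m amplify T B) = rtr (compress T A *m B).
Proof.
rewrite /amplify /compress mulmx_sumr mulmx_suml !rtr_sum; apply: eq_bigr => i _.
by rewrite !mulmxA rtrC !mulmxA.
Qed.

(** Amplified eigenprojections form a resolution with the same eigenvalues. For embeddings this is
    [tr (r log (A (x) id)) = tr (r_X log A)], with [r_X] the marginal. *)
Lemma tlog_amplify (I : finType) m n (T : I -> 'M[CC]_(m, n)) r (A : 'M[CC]_n) :
  isofam T -> adjm A = A -> tlog r (amplify T A) = tlog (compress T r) A.
Proof.
move=> iT hA; have [d [E [rE -> _]]] := herm_resol hA.
have rE' : resol (fun i => amplify T (E i)).
  have [hE hEE sE] := rE; split=> [i|i j|].
  - by rewrite amplify_adj hE.
  - by rewrite amplifyM // hEE; case: eqP => // _; rewrite amplify0.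
  - by rewrite -amplify_sum sE amplify1.
have -> : amplify T (rsum d E) = rsum d (fun i => amplify T (E i)).
  by rewrite /rsum amplify_sum; apply: eq_bigr => i _; rewrite amplifyZ.
by rewrite !tlog_rsum //; apply: eq_bigr => i _; rewrite rtr_amplify.
Qed.

(* The pinching inequality for the projections [T i *m adjm (T i)]. *)
Lemma lem_amplify (I : finType) m n (T : I -> 'M[CC]_(m, n)) (r : 'M[CC]_m) :
  isofam T -> psdmx r ->
  psdmx ((#|I|%:R)%:C *: amplify T (compress T r) - r).
Proof.
move=> [hT sT] pr.
have rP : resol (fun i => T i *m adjm (T i)).
  split=> // [i|i j]; first by rewrite adjmM adjmK.
  rewrite !mulmxA -[_ *m _ *m T j]mulmxA hT.
  by case: eqP => [->|]; rewrite ?mulmx1 // mulmx0 mul0mx.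
apply: lem_trans (pinch_lem rP pr) _.
rewrite -scalerBr; apply: psdmxZ; first by rewrite ler0n.
have -> : pinch (fun i => T i *m adjm (T i)) r =
  \sum_i T i *m (adjm (T i) *m r *m T i) *m adjm (T i).
  by apply: eq_bigr => i _; rewrite !mulmxA.
(* Each diagonal block is one of the positive summands of [compress T r], hence below it. *)
apply: lem_sum => i _; apply: lem_conj.
rewrite [X in psdmx (X - _)](bigD1 i) //= addrAC subrr add0r; apply: psdmx_sum => j _.
by have := psdmx_conj (adjm (T j)) pr; rewrite adjmK.
Qed.

Definition inj1 X K (k : K) : rop (X * K)%type X :=
  rmk (fun p x => (p == (x, k))%:R).

Lemma isofam_inj X K : isofam (fun k : K => inj1 X k).
Proof.
split=> [k l|].
  apply: ropP => x x'; rewrite rent_mul.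
  under eq_bigr => p _ do rewrite rent_adj !rentE /= rmorph_nat.
  rewrite sum_deltarl xpair_eqE -mulnb natrM.
  by case: (k == l); rewrite ?mulr1 ?mulr0 ?rent1 ?rent0.
apply: ropP => -[x k] [x' k']; rewrite rent_sum rent1.
under eq_bigr => j _.
  rewrite rent_mul.
  under eq_bigr => y _ do rewrite rent_adj !rentE /= rmorph_nat xpair_eqE -!mulnb !natrM -mulrA.
  rewrite sum_deltal.
  over.
by rewrite /= sum_deltal xpair_eqE -mulnb natrM [x' == x]eq_sym [k' == k]eq_sym.
Qed.

Lemma amplify_inj X K (A : rop X X) : amplify (fun k : K => inj1 X k) A = tensid K A.
Proof.
apply: ropP => -[x k] [x' k']; rewrite rent_sum rentE /=.
have L1 (j : K) y : rent (inj1 X j) (x, k) y = (k == j)%:R * (x == y)%:R.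
  by rewrite rentE xpair_eqE -mulnb natrM mulrC.
have L2 (j : K) y : rent (adjm (inj1 X j)) y (x', k') = (x' == y)%:R * (k' == j)%:R.
  by rewrite rent_adj rentE rmorph_nat xpair_eqE -mulnb natrM.
under eq_bigr => j _.
  rewrite rent_mul.
  under eq_bigr => y _ do rewrite L2 mulrCA.
  rewrite sum_deltal rent_mul.
  under eq_bigr => y _ do rewrite L1 -mulrA.
  rewrite -mulr_sumr sum_deltal -mulrA.
  over.
by rewrite sum_deltal eq_sym.
Qed.

Definition ptr X K (A : rop (X * K)%type (X * K)%type) : rop X X :=
  rmk (fun x x' => \sum_k rent A (x, k) (x', k)).

Lemma compress_inj X K (A : rop (X * K)%type (X * K)%type) :
  compress (fun k : K => inj1 X k) A = ptr A.
Proof.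
apply: ropP => x x'; rewrite rent_sum rentE; apply: eq_bigr => k _.
rewrite rent_mul; under eq_bigr => p _ do rewrite [rent (inj1 _ _) _ _]rentE.
rewrite sum_deltar rent_mul.
under eq_bigr => p _ do rewrite rent_adj rentE rmorph_nat.
by rewrite sum_deltarl.
Qed.

Lemma isofam_tensid K X Y (I : finType) (T : I -> rop X Y) : isofam T ->
  isofam (fun i => tensid K (T i)).
Proof.
move=> [hT sT]; split=> [i j|].
  by rewrite tensid_adj -tensidM hT; case: eqP; rewrite ?tensid0 ?tensid1.
by under eq_bigr => i _ do rewrite tensid_adj -tensidM; rewrite -tensid_sum sT tensid1.
Qed.

Lemma tensid_psd K X (A : rop X X) : psdmx A -> psdmx (tensid K A).
Proof. by move=> pA; rewrite -amplify_inj; apply: amplify_psd. Qed.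

Lemma ptr_psd X K (A : rop (X * K)%type (X * K)%type) : psdmx A -> psdmx (ptr A).
Proof. by move=> pA; rewrite -compress_inj; apply: compress_psd. Qed.

Lemma tlog_tensid X K (r : rop (X * K)%type (X * K)%type) (A : rop X X) :
  adjm A = A -> tlog r (tensid K A) = tlog (ptr r) A.
Proof.
by move=> hA; rewrite -amplify_inj tlog_amplify ?compress_inj //; exact: isofam_inj.
Qed.

Lemma rtr_tensid X K (r : rop (X * K)%type (X * K)%type) (A : rop X X) :
  rtr (r *m tensid K A) = rtr (ptr r *m A).
Proof. by rewrite -amplify_inj rtr_amplify compress_inj. Qed.

End IndexedOperators.
Arguments tensid {RR CC} K {X Y} M.

(** * One-shot bounds by pinching *)

Section OneShot.
Variables (RR : realType) (CC : complexLike RR).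

(** The number [1 / (1 + sum of 1 / d i)] stands in for a minimum and also serves the empty
    family. *)
Lemma pos_family_lb (I : finType) (d : I -> RR) : (forall i, 0 < d i) ->
  exists2 c : RR, 0 < c & forall i, c <= d i.
Proof.
move=> d0; have s0 : 0 <= \sum_i (d i)^-1.
  by apply: sumr_ge0 => i _; rewrite invr_ge0 ltW.
exists (1 + \sum_i (d i)^-1)^-1 => [|i]; first by rewrite invr_gt0 ltr_pwDl.
rewrite -[leRHS]invrK lef_pV2 ?posrE ?invr_gt0 ?ltr_pwDl //.
rewrite (bigD1 i) //= addrCA lerDl addr_ge0 //.
by apply: sumr_ge0 => j _; rewrite invr_ge0 ltW.
Qed.

Lemma rsum_pd (I : finType) n (d : I -> RR) (E : I -> 'M[CC]_n) : resol E ->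
  (forall i, 0 < d i) -> pdmx (rsum d E).
Proof.
move=> rE d0; split; first by apply: rsum_psd => // i; apply: ltW.
have [c c0 cd] := pos_family_lb d0; exists c => //.
have -> : rsum d E - c%:C%:M = rsum (fun i => d i - c) E.
  rewrite scalarC -(rsum1 rE) /rsum scaler_sumr -sumrB; apply: eq_bigr => i _.
  by rewrite rmorph1 scale1r -scalerBl rmorphB.
by apply: rsum_psd => // i; rewrite subr_ge0.
Qed.

Lemma pdmx_ker m n (S : 'M[CC]_n) (M : 'M[CC]_(m, n)) : pdmx S -> M *m S = 0 -> M = 0.
Proof.
move=> pS MS; rewrite -[M]mulmx1; apply: dominated_mx MS.
exact: pdmx_dominated.
Qed.

Lemma dominated_sandwich n (S Q : 'M[CC]_n) : pdmx S -> S *m Q = Q *m S ->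
  dominated Q (S *m Q *m S).
Proof.
move=> pS SQ v; rewrite !mulmxA => /(pdmx_ker pS).
by rewrite -mulmxA SQ mulmxA => /(pdmx_ker pS).
Qed.

Lemma dominated_amplify (I : finType) m n (T : I -> 'M[CC]_(m, n)) (A B : 'M[CC]_n) :
  isofam T -> dominated A B -> dominated (amplify T A) (amplify T B).
Proof.
move=> [hT _] AB v vB; rewrite /amplify mulmx_sumr big1 // => i _.
suff h : v *m T i *m B = 0.
  by rewrite !mulmxA (dominated_mx AB h) mul0mx.
have := congr1 (fun M => M *m T i) vB.
rewrite /amplify mul0mx -mulmxA mulmx_suml mulmx_sumr (bigD1 i) //= big1 => [|j ji].
  by rewrite addr0 -!mulmxA hT eqxx mulmx1.
by rewrite -!mulmxA hT (negbTE ji) !mulmx0.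
Qed.

Lemma sandwich_psd n (S Q : 'M[CC]_n) : adjm S = S -> psdmx Q -> psdmx (S *m Q *m S).
Proof. by move=> hS pQ; have := psdmx_conj S pQ; rewrite hS. Qed.

(** Monotonicity of the logarithm applied to the pinching inequality; the factor [#|I|] leaves the
    logarithm as [ln #|I|]. *)
Lemma tlog_pinch (I : finType) n (E : I -> 'M[CC]_n) r X : resol E -> (0 < #|I|)%N ->
  psdmx r -> psdmx X -> dominated r X ->
  dominated r (pinch E X) /\ tlog r X <= ln #|I|%:R * rtr r + tlog r (pinch E X).
Proof.
move=> rE I0 pr pX rX.
have hl := pinch_lem rE pX; have pP := pinch_psd rE pX.
have XP := lem_dominated pX hl.
have rP := dominated_trans rX XP; split=> //.
have I0' : 0 < #|I|%:R :> RR by rewrite ltr0n.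
rewrite -tlogZ //; apply: tlog_le => //.
by apply: psdmxZ => //; rewrite ltW.
Qed.

(* Gibbs' inequality for [r] against [w^(1/2) P w^(1/2)], where [P] is [s] pinched by
   the eigenspaces of [w]; the pinching costs [ln #|I|]. *)
Lemma oneshot_lower (I : finType) n (r s : 'M[CC]_n) (w : I -> RR) (E : I -> 'M[CC]_n) :
  resol E -> (0 < #|I|)%N -> (forall i, 0 < w i) ->
  psdmx r -> rtr r = 1 -> psdmx s -> dominated r s ->
  tlog r (rsum w E) - ln (rtr (s *m rsum w E)) - ln #|I|%:R
    <= tlog r r - tlog r s.
Proof.
move=> rE I0 w0 pr r1 ps rs.
have [rP hP] := tlog_pinch rE I0 pr ps rs.
have pP := pinch_psd rE ps.
pose S := rsum (fun i => Num.sqrt (w i)) E.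
have SS : S *m S = rsum w E by apply: rsum_sqrt => // i; apply: ltW.
have pS : pdmx S by apply: rsum_pd => // i; rewrite sqrtr_gt0.
have hS : adjm S = S by exact: rsum_adj.
have SP : S *m pinch E s = pinch E s *m S by exact: pinch_comm.
have pt : psdmx (S *m pinch E s *m S) by exact: sandwich_psd.
have dt := dominated_trans rP (dominated_sandwich pS SP).
have [T0 hg] := gibbs pr r1 pt dt.
(* Pinching by the eigenprojections of [w] does not change the trace against [w]. *)
have et : rtr (S *m pinch E s *m S) = rtr (s *m rsum w E).
  rewrite rtrC mulmxA SS /pinch mulmx_sumr rtr_sum.
  rewrite -[in RHS](mulmx1 (rsum w E)); case: (rE) => _ hEE <-.
  rewrite !mulmx_sumr rtr_sum; apply: eq_bigr => i _.
  rewrite rtrC -!mulmxA rtrC; rewrite -!mulmxA.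
  by rewrite (rsumE w i rE) -scalemxAr hEE eqxx.
move: hg; rewrite et (tlog_mul pr pS pP SP rP) -(tlog_sqr pr pS) SS.
move: hP; rewrite r1 mulr1; lra.
Qed.

Section Upper.
Variables (B C R : finType).
Local Notation BCR := ((B * C) * R)%type.
Local Notation BR := (B * R)%type.

Definition injC (c : C) : rop CC BCR BR := tensid R (inj1 CC B c).

Lemma isofam_injC : isofam injC.
Proof. exact/isofam_tensid/isofam_inj. Qed.

(** Tracing out the middle factor is written as a compression so that the lemmas on [amplify]
    apply. *)
Definition mBR (r : rop CC BCR BCR) : rop CC BR BR := compress injC r.

Lemma sum3 (V : nmodType) (I J K : finType) (F : I -> J -> K -> V) :
  \sum_(p : I * J * K) F p.1.1 p.1.2 p.2 = \sum_i \sum_j \sum_k F i j k.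
Proof.
rewrite -(pair_bigA _ (fun p k => F p.1 p.2 k)) /=.
by rewrite -(pair_bigA _ (fun i j => \sum_k F i j k)).
Qed.

Lemma gram_mulr (I : finType) m n p (M : I -> 'M[CC]_(m, n)) (N : 'M[CC]_(n, p)) :
  \sum_i adjm (M i *m N) *m (M i *m N) = adjm N *m (\sum_i adjm (M i) *m M i) *m N.
Proof.
rewrite mulmx_sumr mulmx_suml; apply: eq_bigr => i _.
by rewrite adjmM !mulmxA.
Qed.

Lemma mulmx_sumlr (I : Type) (s : seq I) (P : pred I) m n p q (M : 'M[CC]_(m, n))
    (F : I -> 'M[CC]_(n, p)) (N : 'M[CC]_(p, q)) :
  M *m (\sum_(i <- s | P i) F i) *m N = \sum_(i <- s | P i) M *m F i *m N.
Proof. by rewrite mulmx_sumr mulmx_suml. Qed.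

Lemma rtr_compress (I : finType) m n (T : I -> 'M[CC]_(m, n)) (A : 'M[CC]_m) :
  isofam T -> rtr (compress T A) = rtr A.
Proof.
by move=> iT; rewrite -[compress T A]mulmx1 -rtr_amplify amplify1 // mulmx1.
Qed.

(* The pinched Petz map: pinch by the eigenspaces of [b], conjugate by
   [b^(-1/2)], embed, pinch by the eigenspaces of [A], conjugate by [A^(1/2)];
   after each pinching all factors commute. *)
Lemma oneshot_upper (r : rop CC BCR BCR) (I J : finType)
    (a : I -> RR) (E : I -> rop CC (B * C)%type (B * C)%type)
    (b : J -> RR) (F : J -> rop CC B B) :
  resol E -> resol F -> (0 < #|I|)%N -> (0 < #|J|)%N ->
  (forall i, 0 < a i) -> (forall j, 0 < b j) -> ptr (rsum a E) = rsum b F ->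
  psdmx r -> rtr r = 1 ->
  exists L : rop CC B B -> rop CC (B * C)%type (B * C)%type,
  [/\ is_chan L, psdmx (appid L (mBR r)), dominated r (appid L (mBR r)) &
    tlog r r - tlog r (appid L (mBR r)) <=
    tlog r r - tlog (ptr r) (rsum a E) - tlog (mBR r) (mBR r)
    + tlog (ptr (mBR r)) (rsum b F) + ln #|I|%:R + ln #|J|%:R].
Proof.
move=> rE rF I0 J0 a0 b0 eb pr r1.
pose S := rsum (fun i => Num.sqrt (a i)) E.
pose G := rsum (fun j => (Num.sqrt (b j))^-1) F.
have sb0 j : 0 < Num.sqrt (b j) by rewrite sqrtr_gt0.
have SS : S *m S = rsum a E by apply: rsum_sqrt => // i; apply: ltW.
have GG : G *m rsum b F *m G = 1%:M.
  rewrite !rsum_mul // -(rsum1 rF); apply: eq_bigr => j _; congr (_%:C *: _).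
  have := sqr_sqrtr (ltW (b0 j)); have := sb0 j.
  by move: (Num.sqrt (b j)) => s s0 <-; field; rewrite gt_eqF.
pose K (p : I * J * C) := E p.1.1 *m S *m inj1 CC B p.2 *m G *m F p.1.2.
have hS : adjm S = S by exact: rsum_adj.
have hG : adjm G = G by exact: rsum_adj.
have [hE hEE sE] := rE; have [hF hFF sF] := rF.
(* Trace preservation: summing over [i] removes [E i], summing over [c] turns [S *m S] into its
   partial trace [rsum b F], the two factors [G] cancel it, and the [F j] sum to the identity. *)
have sK : \sum_p adjm (K p) *m K p = 1%:M.
  rewrite (sum3 (fun i j c => adjm (E i *m S *m inj1 CC B c *m G *m F j)
     *m (E i *m S *m inj1 CC B c *m G *m F j))).
  rewrite exchange_big /= -[RHS]sF; apply: eq_bigr => j _.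
  rewrite exchange_big /=.
  have key c : \sum_i adjm (E i *m S *m inj1 CC B c *m G *m F j)
      *m (E i *m S *m inj1 CC B c *m G *m F j)
      = adjm (G *m F j) *m (adjm (inj1 CC B c) *m rsum a E *m inj1 CC B c) *m (G *m F j).
    have eM i : E i *m S *m inj1 CC B c *m G *m F j
        = (E i *m S) *m (inj1 CC B c *m (G *m F j)) by rewrite !mulmxA.
    under eq_bigr => i _ do rewrite eM.
    rewrite gram_mulr gram_mulr hS; under eq_bigr => i _ do rewrite hE hEE eqxx.
    by rewrite sE mulmx1 SS [adjm (inj1 CC B c *m _)]adjmM !mulmxA.
  under eq_bigr => c _ do rewrite key.
  rewrite -mulmx_sumlr -/(compress (fun c => inj1 CC B c) (rsum a E)) compress_inj eb.
  rewrite adjmM hF hG !mulmxA -[_ *m G *m _ *m G]mulmxA -[F j *m G *m _]mulmxA.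
  by rewrite [G *m (_ *m _)]mulmxA GG mulmx1 hFF eqxx.
have cL : is_chan (kraus K) by exact: kraus_chan.
have rE' := tensid_resol R rE.
have rF' := tensid_resol R rF.
pose T := mBR r; pose E' i := tensid R (E i); pose F' j := tensid R (F j).
pose S' := rsum (fun i => Num.sqrt (a i)) E'.
pose G' := rsum (fun j => (Num.sqrt (b j))^-1) F'.
have tS : tensid R S = S' by exact: tensid_rsum.
have tG : tensid R G = G' by exact: tensid_rsum.
have hS' : adjm S' = S' by exact: rsum_adj.
have hG' : adjm G' = G' by exact: rsum_adj.
pose Y := G' *m pinch F' T *m G'.
pose Q := pinch E' (amplify injC Y).
have eL : appid (kraus K) T = S' *m Q *m S'.
  rewrite appid_kraus (sum3 (fun i j c => tensid R (E i *m S *m inj1 CC B c *m G *m F j)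
   *m T *m adjm (tensid R (E i *m S *m inj1 CC B c *m G *m F j)))).
  rewrite /Q /pinch [in RHS]mulmx_sumlr; apply: eq_bigr => i _.
  rewrite exchange_big /= /amplify 2![in RHS]mulmx_sumlr; apply: eq_bigr => c _.
  rewrite /Y /pinch 4![in RHS]mulmx_sumlr.
  apply: eq_bigr => j _.
  rewrite !tensidM -/(injC c) !adjmM tS tG hS' hG' !tensid_adj hE hF -/(E' i) -/(F' j).
  have SE : S' *m E' i = E' i *m S' by rewrite rsumE // rsumEl.
  by rewrite !mulmxA -SE -!mulmxA -[E' i *m S']SE !mulmxA.
have pT : psdmx T by apply: compress_psd.
have T1 : rtr T = 1 by rewrite rtr_compress //; exact: isofam_injC.
have pS' : pdmx S' by apply: rsum_pd => // i; rewrite sqrtr_gt0.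
have pG' : pdmx G' by apply: rsum_pd => // j; rewrite invr_gt0 sqrtr_gt0.
have [TX hX] := tlog_pinch rF' J0 pT pT (fun v h => h).
have pX : psdmx (pinch F' T) by exact: pinch_psd.
have GX : G' *m pinch F' T = pinch F' T *m G' by exact: pinch_comm.
have XY : dominated (pinch F' T) Y by exact: dominated_sandwich.
have pY : psdmx Y by exact: sandwich_psd.
(* Supports are followed through the whole map: from [r] to its marginal amplified by [C], then to
   each pinched and sandwiched operator. *)
have rT : dominated r (amplify injC T).
  by apply: lem_dominated => //; apply: lem_amplify => //; exact: isofam_injC.
have TY : dominated (amplify injC T) (amplify injC Y).
  apply: dominated_amplify; first exact: isofam_injC.
  exact: dominated_trans TX XY.
have pY1 : psdmx (amplify injC Y) by exact: amplify_psd.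
have rY := dominated_trans rT TY.
have [rQ hQ] := tlog_pinch rE' I0 pr pY1 rY.
have pQ : psdmx Q by exact: pinch_psd.
have SQ : S' *m Q = Q *m S' by exact: pinch_comm.
have e1 := tlog_mul pr pS' pQ SQ rQ.
have e2 : 2 * tlog r S' = tlog (ptr r) (rsum a E).
  rewrite -tlog_sqr // -tS -tensidM SS tlog_tensid //; exact: rsum_adj.
have e3 : tlog r (amplify injC Y) = tlog T Y.
  by rewrite tlog_amplify //; [exact: isofam_injC | exact: psdmx_herm].
have e4 : tlog T Y = tlog T (pinch F' T) + 2 * tlog T G' by exact: tlog_mul.
have e5 : 2 * tlog T G' = - tlog (ptr T) (rsum b F).
  rewrite -tlog_tensid; last exact: rsum_adj.
  rewrite tensid_rsum !tlog_rsum // -sumrN mulr_sumr; apply: eq_bigr => j _.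
  rewrite mulrA -mulNr lnV ?posrE //; congr (_ * _).
  rewrite -{2}[b j](sqr_sqrtr (ltW (b0 j))) lnXn // -mulr_natl; ring.
exists (kraus K); rewrite -/T eL; split=> //.
- exact: sandwich_psd.
- exact: dominated_trans rQ (dominated_sandwich pS' SQ).
- rewrite e1 e2; move: hX hQ; rewrite T1 r1 !mulr1 e3 e4 e5 -/Q; lra.
Qed.

End Upper.
End OneShot.

(** * Tensor powers *)

Section TensorPowers.
Variables (RR : realType) (CC : complexLike RR).

Section Encoding.
Variables (n : nat) (T X : finType) (enc : T -> 'I_n -> X).

(** Tuples of pairs and pairs of tuples are different types. Working up to a bijective code lets
    [B^n C^n R^n], grouped by system, serve directly as [n] copies of one system. *)
Definition encoding := bijective (fun t => [ffun i => enc t i] : {ffun 'I_n -> X}).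

Definition tpe (A : 'I_n -> rop CC X X) : rop CC T T :=
  rmk (fun p q => \prod_i rent (A i) (enc p i) (enc q i)).

Hypothesis encP : encoding.

Lemma enc_distr (F : 'I_n -> X -> CC) :
  \sum_t \prod_i F i (enc t i) = \prod_i \sum_x F i x.
Proof.
rewrite bigA_distr_bigA /= (reindex (fun t => [ffun i => enc t i])) /=.
  by apply: eq_bigr => t _; apply: eq_bigr => i _; rewrite ffunE.
by case: encP => g gK Kg; exists g => ? _; [exact: gK | exact: Kg].
Qed.

Lemma enc_eq t u : (t == u)%:R = \prod_i (enc t i == enc u i)%:R :> CC.
Proof.
have [<-|tu] := eqVneq t u; first by rewrite big1 // => i _; rewrite eqxx.
have : [exists i, enc t i != enc u i].
  apply: contraR tu; rewrite negb_exists => /forallP h.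
  apply/eqP; apply: (bij_inj encP); apply/ffunP => i; rewrite !ffunE.
  by have := h i; rewrite negbK => /eqP.
by move=> /existsP[i ei]; rewrite (bigD1 i) //= (negbTE ei) mul0r.
Qed.

Lemma eq_tpe (A B : 'I_n -> rop CC X X) : (forall i, A i = B i) -> tpe A = tpe B.
Proof. by move=> h; congr tpe; apply: funext. Qed.

Lemma tpeM (A B : 'I_n -> rop CC X X) :
  tpe A *m tpe B = tpe (fun i => A i *m B i).
Proof.
apply: ropP => p q; rewrite rent_mul rentE.
under [RHS]eq_bigr => i _ do rewrite rent_mul.
rewrite -(enc_distr (fun i x => rent (A i) (enc p i) x * rent (B i) x (enc q i))).
by apply: eq_bigr => t _; rewrite !rentE big_split.
Qed.

Lemma tpe_adj (A : 'I_n -> rop CC X X) : adjm (tpe A) = tpe (fun i => adjm (A i)).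
Proof.
apply: ropP => p q; rewrite rent_adj !rentE rmorph_prod.
by apply: eq_bigr => i _; rewrite rent_adj.
Qed.

Lemma tpe1 : tpe (fun=> 1%:M) = 1%:M.
Proof.
by apply: ropP => p q; rewrite rentE rent1 enc_eq; apply: eq_bigr => i _; rewrite rent1.
Qed.

Lemma tr_tpe (A : 'I_n -> rop CC X X) : \tr (tpe A) = \prod_i \tr (A i).
Proof.
rewrite tr_rent; under [RHS]eq_bigr => i _ do rewrite tr_rent.
rewrite -(enc_distr (fun i x => rent (A i) x x)).
by apply: eq_bigr => t _; rewrite rentE.
Qed.

Lemma tpe_sum (K : finType) (A : 'I_n -> K -> rop CC X X) :
  tpe (fun i => \sum_k A i k) = \sum_(f : {ffun 'I_n -> K}) tpe (fun i => A i (f i)).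
Proof.
apply: ropP => p q; rewrite rentE rent_sum.
under eq_bigr => i _ do rewrite rent_sum.
by rewrite bigA_distr_bigA; apply: eq_bigr => f _; rewrite rentE.
Qed.

Lemma tpeZ (a : 'I_n -> CC) (A : 'I_n -> rop CC X X) :
  tpe (fun i => a i *: A i) = (\prod_i a i) *: tpe A.
Proof.
apply: ropP => p q; rewrite rentZ !rentE -big_split; apply: eq_bigr => i _.
by rewrite rentZ.
Qed.

Lemma tpe_eq0 (A : 'I_n -> rop CC X X) i : A i = 0 -> tpe A = 0.
Proof.
move=> A0; apply: ropP => p q; rewrite rentE rent0 (bigD1 i) //= A0 rent0.
by rewrite mul0r.
Qed.

Lemma tpe_resol (K : finType) (E : K -> rop CC X X) : resol E ->
  resol (fun f : {ffun 'I_n -> K} => tpe (fun i => E (f i))).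
Proof.
move=> [hE hEE sE]; split=> [f|f g|].
- by rewrite tpe_adj; apply: eq_tpe.
- rewrite tpeM; have [<-|fg] := eqVneq f g.
    by apply: eq_tpe => i; rewrite hEE eqxx.
  have : [exists i, f i != g i].
    apply: contraR fg; rewrite negb_exists => /forallP h.
    by apply/eqP/ffunP => i; have := h i; rewrite negbK => /eqP.
  by move=> /existsP[i ei]; apply: (@tpe_eq0 _ i); rewrite hEE (negbTE ei).
- by rewrite -(tpe_sum (fun _ => E)) -tpe1; apply: eq_tpe => i.
Qed.

Lemma tpe_rsum (K : finType) (d : K -> RR) (E : K -> rop CC X X) :
  tpe (fun=> rsum d E) =
  rsum (fun f : {ffun 'I_n -> K} => \prod_i d (f i)) (fun f => tpe (fun i => E (f i))).
Proof.
rewrite /rsum (tpe_sum (fun _ k => (d k)%:C *: E k)); apply: eq_bigr => f _.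
by rewrite tpeZ rmorph_prod.
Qed.

Lemma tpe_psd (A : rop CC X X) : psdmx A -> psdmx (tpe (fun=> A)).
Proof.
move=> pA; rewrite (@eq_tpe _ (fun=> gsqrt A *m gsqrt A)); last first.
  by move=> _; rewrite gsqrt_sqr.
rewrite -tpeM -{2}(psdmx_herm (gsqrt_psd pA)) -(tpe_adj (fun=> gsqrt A)).
exact: psdmx_gram.
Qed.

Lemma psd_trM_ge0 m (A B : 'M[CC]_m) : psdmx A -> psdmx B -> 0 <= \tr (A *m B).
Proof.
move=> pA pB; rewrite -[A]gsqrt_sqr // -mulmxA mxtrace_mulC.
rewrite -{2}(psdmx_herm (gsqrt_psd pA)).
exact/psd_tr_ge0/psdmx_conj.
Qed.

Lemma rtr_tpe (A : 'I_n -> rop CC X X) : (forall i, 0 <= \tr (A i)) ->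
  rtr (tpe A) = \prod_i rtr (A i).
Proof.
move=> h; rewrite -(reK CC (\prod_i _)) rmorph_prod rtrE tr_tpe.
by congr re; apply: eq_bigr => i _; rewrite rtrE re_ge0K.
Qed.

Lemma ln_prod (I : finType) (x : I -> RR) : (forall i, 0 < x i) ->
  ln (\prod_i x i) = \sum_i ln (x i).
Proof.
move=> x0; suff [] : 0 < \prod_i x i /\ ln (\prod_i x i) = \sum_i ln (x i) by [].
apply: (big_ind2 (fun a b => 0 < a /\ ln a = b)) => [|a b c e [a0 <-] [c0 <-]|i _] //.
  by rewrite ln1.
by rewrite mulr_gt0 // lnM.
Qed.

(** The logarithm of a product of eigenvalues is a sum of [n] logarithms. Putting the [j]-th one on
    coordinate [j] makes the sum over [f] factorize, and the other coordinates each contribute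
    [rtr r = 1]. *)
Lemma tlog_tpe (r A : rop CC X X) : psdmx r -> rtr r = 1 -> psdmx A ->
  dominated r A ->
  tlog (tpe (fun=> r)) (tpe (fun=> A)) = n%:R * tlog r A.
Proof.
move=> pr r1 /psd_resol[d [E [rE -> d0]]] rA.
have pE k := resol_psd k rE.
rewrite tpe_rsum tlog_rsum; last exact: tpe_resol.
pose p k := rtr (r *m E k).
have p0 k : 0 <= p k by apply: psd_rtrM_ge0.
have sp : \sum_k p k = 1.
  by rewrite -rtr_sum -mulmx_sumr; case: rE => _ _ ->; rewrite mulmx1.
have e1 (f : {ffun 'I_n -> 'I_#|X|}) :
    rtr (tpe (fun=> r) *m tpe (fun i => E (f i))) = \prod_i p (f i).
  by rewrite tpeM rtr_tpe // => i; apply: psd_trM_ge0.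
have e2 (f : {ffun 'I_n -> 'I_#|X|}) :
  ln (\prod_i d (f i)) * rtr (tpe (fun=> r) *m tpe (fun i => E (f i)))
  = \sum_j \prod_i ((if i == j then ln (d (f i)) else 1) * p (f i)).
  have e3 j : \prod_i ((if i == j then ln (d (f i)) else 1) * p (f i))
      = ln (d (f j)) * \prod_i p (f i).
    by rewrite big_split /= -big_mkcond /= big_pred1_eq.
  rewrite [RHS](eq_bigr _ (fun j _ => e3 j)).
  rewrite e1 -mulr_suml; have [[i pi0]|hp] := pselect (exists i, p (f i) = 0).
    by rewrite [\prod_i p _](bigD1 i) //= pi0 mul0r !mulr0.
  rewrite ln_prod // => i.
  rewrite lt_neqAle d0 andbT eq_sym; apply/eqP => di; apply: hp; exists i.
  exact: (dominated_rtr rE rA).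
under eq_bigr => f _ do rewrite e2.
rewrite exchange_big /=.
under eq_bigr => j _.
  rewrite -(bigA_distr_bigA (fun i k => (if i == j then ln (d k) else 1) * p k)) /=.
  rewrite (bigD1 j) //= [X in _ * X]big1 => [|i ij]; last first.
    by rewrite (negbTE ij); under eq_bigr => k _ do rewrite mul1r.
  rewrite eqxx mulr1 -tlog_rsum //.
  over.
by rewrite sumr_const card_ord mulr_natl.
Qed.

End Encoding.

Lemma coarse_resol (I J : finType) m (E : I -> 'M[CC]_m) (c : I -> J) : resol E ->
  resol (fun j => \sum_(i | c i == j) E i).
Proof.
move=> [hE hEE sE]; split=> [j|j k|].
- by rewrite adjm_sum; apply: eq_bigr => i _.
- rewrite mulmx_suml; have [<-|jk] := eqVneq j k.
    apply: eq_bigr => i ij; rewrite mulmx_sumr (bigD1 i) //= big1 => [|i' /andP[_ ii']].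
      by rewrite addr0 hEE eqxx.
    by rewrite hEE eq_sym (negbTE ii').
  rewrite big1 // => i /eqP ij; rewrite mulmx_sumr big1 // => i' /eqP ik.
  by rewrite hEE; case: eqP => // ii; move: jk; rewrite -ij -ik ii eqxx.
- by rewrite -sE [RHS](partition_big c xpredT) /=.
Qed.

Lemma coarse_rsum (I J : finType) m (E : I -> 'M[CC]_m) (c : I -> J)
  (d : I -> RR) (e : J -> RR) : (forall i, d i = e (c i)) ->
  rsum d E = rsum e (fun j => \sum_(i | c i == j) E i).
Proof.
move=> de; rewrite /rsum (partition_big c xpredT) //=; apply: eq_bigr => j _.
by rewrite scaler_sumr; apply: eq_bigr => i /eqP ij; rewrite de ij.
Qed.

(* The eigenvalue of a tensor power at [f] only depends on how often each
   eigenvalue of the factor is used, hence the polynomial number of colours. *)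
Definition occ (K : finType) n (f : {ffun 'I_n -> K}) : {ffun K -> 'I_n.+1} :=
  [ffun k => inord #|[set i | f i == k]|].

Lemma prod_occ (K : finType) n (f : {ffun 'I_n -> K}) (d : K -> RR) :
  \prod_i d (f i) = \prod_k d k ^+ (occ f k).
Proof.
rewrite (partition_big f xpredT) //=; apply: eq_bigr => k _.
rewrite ffunE inordK; last by rewrite ltnS -[leqRHS]card_ord max_card.
rewrite (eq_bigr (fun=> d k)) => [|i /eqP -> //].
by rewrite prodr_const; congr (_ ^+ _); apply: eq_card => i; rewrite !inE.
Qed.

Lemma tpe_colour n (T X K : finType) (enc : T -> 'I_n -> X) (d : K -> RR)
    (E : K -> rop CC X X) : encoding enc -> resol E -> (forall k, 0 < d k) ->
  exists (a : {ffun K -> 'I_n.+1} -> RR) (F : {ffun K -> 'I_n.+1} -> rop CC T T),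
  [/\ resol F, tpe enc (fun=> rsum d E) = rsum a F & forall c, 0 < a c].
Proof.
move=> he rE d0; exists (fun c : {ffun K -> 'I_n.+1} => \prod_k d k ^+ c k),
  (fun c => \sum_(f | occ f == c) tpe enc (fun i => E (f i))); split.
- exact/coarse_resol/tpe_resol.
- by rewrite tpe_rsum; apply: coarse_rsum => f; rewrite prod_occ.
- by move=> c; apply: prodr_gt0 => k _; rewrite exprn_gt0.
Qed.

(** Eigenvalues on zero projections are arbitrary; resetting them to [0] makes the bounds hold at
    every index, as products over coordinates require. *)
Lemma clamp_resol (I : finType) m (d : I -> RR) (E : I -> 'M[CC]_m) : resol E ->
  psdmx (rsum d E) -> psdmx (1%:M - rsum d E) ->
  exists2 e : I -> RR, rsum d E = rsum e E & forall i, 0 <= e i <= 1.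
Proof.
move=> rE pd pd1; exists (fun i => if E i == 0 then 0 else d i).
  by apply: eq_bigr => i _; case: eqP => [->|]; rewrite ?scaler0.
move=> i; case: eqP => [_|Ei]; first by rewrite lexx ler01.
have [//|->] := psdmx_resol i rE pd; move: pd1.
have -> : 1%:M - rsum d E = rsum (fun i => 1 - d i) E.
  rewrite -(rsum1 rE) /rsum -sumrB; apply: eq_bigr => j _.
  by rewrite -scalerBl rmorphB.
by move=> /(psdmx_resol i rE)[//|]; rewrite subr_ge0.
Qed.

(* After conjugation by [B^(-1/2)] the claim is that a tensor power of a contraction
   is a contraction. *)
Lemma tpe_mono n (T X : finType) (enc : T -> 'I_n -> X) (A B : rop CC X X) :
  encoding enc -> psdmx A -> pdmx B -> psdmx (B - A) ->
  psdmx (tpe enc (fun=> B) - tpe enc (fun=> A)).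
Proof.
move=> he pA pB AB; have [pB' [c c0 Bc]] := pB.
have [d [E [rE eB d0]]] := herm_resol (psdmx_herm pB').
have {c0 Bc} d1 i : 0 < d i by apply: lt_le_trans c0 _; apply: d0.
pose S := rsum (fun i => Num.sqrt (d i)) E.
pose G := rsum (fun i => (Num.sqrt (d i))^-1) E.
have s0 i : Num.sqrt (d i) != 0 by rewrite gt_eqF // sqrtr_gt0.
have SS : S *m S = B by rewrite eB; apply: rsum_sqrt => // i; apply: ltW.
have SG : S *m G = 1%:M.
  by rewrite rsum_mul // -(rsum1 rE); apply: eq_bigr => i _; rewrite mulfV.
have GS : G *m S = 1%:M.
  by rewrite rsum_mul // -(rsum1 rE); apply: eq_bigr => i _; rewrite mulVf.
have hG : adjm G = G by exact: rsum_adj.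
have hS : adjm S = S by exact: rsum_adj.
pose D := G *m A *m G.
have pD : psdmx D by exact: sandwich_psd.
have pD1 : psdmx (1%:M - D).
  have := sandwich_psd hG AB; rewrite mulmxBr mulmxBl -SS !mulmxA GS mul1mx.
  by rewrite SG.
have eA : A = S *m D *m S by rewrite /D !mulmxA SG mul1mx -mulmxA GS mulmx1.
have [u [F [rF eD _]]] := herm_resol (psdmx_herm pD).
rewrite eD in pD pD1; have [e ee e01] := clamp_resol rF pD pD1.
have -> : tpe enc (fun=> A) = tpe enc (fun=> S) *m tpe enc (fun=> D) *m tpe enc (fun=> S).
  by rewrite !tpeM //; apply: eq_tpe.
have -> : tpe enc (fun=> B) = tpe enc (fun=> S) *m 1%:M *m tpe enc (fun=> S).
  by rewrite mulmx1 tpeM //; apply: eq_tpe.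
rewrite -mulmxBl -mulmxBr; apply: sandwich_psd.
  by rewrite tpe_adj; apply: eq_tpe.
rewrite eD ee tpe_rsum -(rsum1 (tpe_resol he rF)).
have -> a b : rsum a (fun f : {ffun 'I_n -> 'I_#|X|} => tpe enc (fun i => F (f i)))
   - rsum b (fun f : {ffun 'I_n -> 'I_#|X|} => tpe enc (fun i => F (f i)))
   = rsum (fun f => a f - b f) (fun f : {ffun 'I_n -> 'I_#|X|} => tpe enc (fun i => F (f i))).
  by rewrite /rsum -sumrB; apply: eq_bigr => j _; rewrite -scalerBl rmorphB.
apply: rsum_psd; first exact: tpe_resol.
move=> f; rewrite subr_ge0.
by apply: prodr_ile1 => i _.
Qed.

Section PairEncodings.
Variables (n : nat).

Definition encI (X : finType) (f : {ffun 'I_n -> X}) (i : 'I_n) : X := f i.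

Lemma encIP X : encoding (@encI X).
Proof.
exists id => f; last by apply/ffunP => i; rewrite ffunE.
by apply/ffunP => i; rewrite ffunE.
Qed.

Variables (T1 X1 T2 X2 : finType) (e1 : T1 -> 'I_n -> X1) (e2 : T2 -> 'I_n -> X2).

Definition encpair (p : T1 * T2) (i : 'I_n) : X1 * X2 := (e1 p.1 i, e2 p.2 i).

Lemma encpairP : encoding e1 -> encoding e2 -> encoding encpair.
Proof.
move=> [g1 gK1 Kg1] [g2 gK2 Kg2].
exists (fun f : {ffun 'I_n -> X1 * X2} => (g1 [ffun i => (f i).1], g2 [ffun i => (f i).2])) => [[t u]|f] /=.
  congr (_, _); [rewrite -[RHS]gK1|rewrite -[RHS]gK2]; congr (_ _);
    by apply/ffunP => i; rewrite !ffunE.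
apply/ffunP => i; rewrite ffunE /encpair /=.
have := congr1 (fun h : {ffun _} => h i) (Kg1 [ffun i => (f i).1]).
have := congr1 (fun h : {ffun _} => h i) (Kg2 [ffun i => (f i).2]).
by rewrite !ffunE => -> ->; case: (f i).
Qed.

Lemma ptr_tpe (A : 'I_n -> rop CC (X1 * X2)%type (X1 * X2)%type) : encoding e2 ->
  ptr (tpe encpair A) = tpe e1 (fun i => ptr (A i)).
Proof.
move=> h2; apply: ropP => p q; rewrite !rentE.
under [RHS]eq_bigr => i _ do rewrite rentE.
rewrite -(enc_distr h2 (fun i k => rent (A i) (e1 p i, k) (e1 q i, k))).
by apply: eq_bigr => k _; rewrite rentE.
Qed.

Lemma tensid_tpe (A : 'I_n -> rop CC X1 X1) : encoding e2 ->
  tensid T2 (tpe e1 A) = tpe encpair (fun i => tensid X2 (A i)).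
Proof.
move=> h2; apply: ropP => p q; rewrite !rentE (enc_eq h2) -big_split /=.
by apply: eq_bigr => i _; rewrite rentE.
Qed.

End PairEncodings.

Lemma mBRE (B C R : finType) (r : rop CC ((B * C) * R)%type ((B * C) * R)%type) x y :
  rent (mBR r) x y = \sum_c rent r ((x.1, c), x.2) ((y.1, c), y.2).
Proof.
rewrite rent_sum; apply: eq_bigr => c _.
case: x y => b k [b' k']; rewrite rent_mul_tensid.
under eq_bigr => p _ do rewrite [rent (inj1 _ _ _) _ _]rentE.
rewrite sum_deltar tensid_adj rent_tensid_mul.
under eq_bigr => p _ do rewrite rent_adj rentE rmorph_nat.
by rewrite sum_deltarl.
Qed.

Lemma mBR_tpe n (B C R : finType) (r : rop CC ((B * C) * R)%type ((B * C) * R)%type) :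
  mBR (tpe (encpair (encpair (@encI n B) (@encI n C)) (@encI n R)) (fun=> r))
  = tpe (encpair (@encI n B) (@encI n R)) (fun=> mBR r).
Proof.
apply: ropP => x y; rewrite mBRE rentE.
under [RHS]eq_bigr => i _ do rewrite mBRE.
rewrite -(enc_distr (@encIP n C) (fun i c => rent r ((encI x.1 i, c), encI x.2 i)
   ((encI y.1 i, c), encI y.2 i))).
by apply: eq_bigr => c _; rewrite rentE.
Qed.

End TensorPowers.

(** * Near-maximizers of bounded sets of reals *)

Section NearOptimal.
Variable RR : realType.

Lemma near_sup (A : set RR) (c e a0 : RR) :
  A a0 -> (forall a, A a -> a <= c) -> 0 < e ->
  exists2 a, A a & forall b, A b -> b <= a + e.
Proof.
move=> Aa0 Ac e0.
have hA : has_sup A by split; [exists a0 | exists c].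
have [a Aa ha] := sup_adherent e0 hA.
exists a => // b Ab; have : b <= sup A by apply: sup_ubound => //; exact: hA.2.
by move: ha; lra.
Qed.

End NearOptimal.

(** * Dual certificates for the optimization over channels *)

Section Duality.
Variables (RR : realType) (CC : complexLike RR).

(** The eigenvalues are nonnegative and, the projections having rank one, sum to the trace. *)
Lemma psd_le_tr n (A : 'M[CC]_n) : psdmx A -> psdmx ((rtr A)%:C%:M - A).
Proof.
move=> pA; have [d [E [rE eA E1 dE]]] := herm_resol_rank1 (psdmx_herm pA).
have d0 i : 0 <= d i by apply: dE; rewrite rmorph0 raddf0 subr0.
have tA : rtr A = \sum_i d i.
  by rewrite eA -[rsum d E]mul1mx rtr_rsum; apply: eq_bigr => i _; rewrite mul1mx E1 mulr1.
have -> : (rtr A)%:C%:M - A = rsum (fun i => rtr A - d i) E.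
  rewrite scalarC -(rsum1 rE) {2}eA /rsum scaler_sumr -sumrB; apply: eq_bigr => i _.
  by rewrite rmorph1 scale1r -scalerBl rmorphB.
apply: rsum_psd => // i; rewrite subr_ge0 tA (bigD1 i) //= lerDl.
by apply: sumr_ge0.
Qed.

Section KrausFunctionals.
Variables (X Y K : finType).
Variables (T : rop CC (X * K)%type (X * K)%type) (W : rop CC (Y * K)%type (Y * K)%type).

(** The objective [tr ((Lambda (x) id)(T) W)] is the sum of these quadratic forms over the Kraus
    operators of [Lambda]. *)
Definition kform (V : rop CC Y X) : RR :=
  rtr (tensid K V *m T *m adjm (tensid K V) *m W).

Lemma rtr_appid (I : finType) (M : I -> rop CC Y X) :
  rtr (appid (kraus M) T *m W) = \sum_i kform (M i).
Proof. by rewrite appid_kraus mulmx_suml rtr_sum. Qed.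

Lemma kformZ (a : RR) (V : rop CC Y X) : kform (a%:C *: V) = a ^+ 2 * kform V.
Proof.
rewrite /kform tensidZ adjmZr -!scalemxAl -scalemxAr -!scalemxAl !rtrZ mulrA.
by rewrite expr2.
Qed.

Lemma kform_ge0 (V : rop CC Y X) : psdmx T -> psdmx W -> 0 <= kform V.
Proof. by move=> pT pW; apply: psd_rtrM_ge0 => //; apply: psdmx_conj. Qed.

Definition ketbra (y : Y) (x : X) : rop CC Y X :=
  rmk (fun y' x' => ((y' == y) && (x' == x))%:R).

Lemma ketbra_gram y x :
  adjm (ketbra y x) *m ketbra y x = unitop CC x x.
Proof.
apply: ropP => a b; rewrite rent_mul rentE.
under eq_bigr => z _ do
  rewrite rent_adj !rentE rmorph_nat -!mulnb !natrM mulrACA -natrM mulnb andbb.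
by rewrite sum_deltarl.
Qed.

Lemma sum_unitop : \sum_x unitop CC x x = 1%:M :> rop CC X X.
Proof.
rewrite [RHS]rop_unit; apply: eq_bigr => x _.
rewrite (bigD1 x) //= big1 => [|x' x'x]; rewrite rent1 ?eqxx ?scale1r ?addr0 //.
by rewrite eq_sym (negbTE x'x) scale0r.
Qed.

Lemma sum_kform_mulr (I : finType) (M : I -> rop CC Y X) (A : rop CC X X) :
  \sum_i kform (M i *m A) = rtr (tensid K A *m T *m adjm (tensid K A) *m
     \sum_i adjm (tensid K (M i)) *m W *m tensid K (M i)).
Proof.
rewrite mulmx_sumr rtr_sum; apply: eq_bigr => i _.
rewrite /kform tensidM adjmM -!mulmxA [LHS]rtrC -!mulmxA.
by [].
Qed.

(* First-order optimality: [Z] is the partial trace of [T] against the image of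
   [W] under the adjoint of a nearly optimal channel.  Mixing that channel with
   the extra Kraus operator [sqrt e * V] (and a remainder of order [e^2]) cannot
   increase the value by more than [e^2]. *)
Lemma near_dual_unit (e : RR) (I : finType) (M : I -> rop CC Y X) (V : rop CC Y X) :
  psdmx T -> psdmx W -> (0 < #|Y|)%N -> 0 < e ->
  \sum_i adjm (M i) *m M i = 1%:M ->
  (forall (J : finType) (N : J -> rop CC Y X), \sum_j adjm (N j) *m N j = 1%:M ->
     \sum_j kform (N j) <= \sum_i kform (M i) + e ^+ 2) ->
  let N := \sum_i adjm (tensid K (M i)) *m W *m tensid K (M i) in
  let Z := 2^-1%:C *: (ptr (T *m N) + adjm (ptr (T *m N))) in
  rtr (adjm V *m V) = 1 ->
  kform V <= rtr (adjm V *m V *m Z) + e * (1 + \sum_i kform (M i) + e ^+ 2).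
Proof.
move=> pT pW Y0 e0 sM opt N Z V1.
set v := \sum_i kform (M i) in opt *.
pose G := adjm V *m V.
have pG : psdmx G by have := psdmx_gram (adjm V); rewrite adjmK.
have hG := psdmx_herm pG.
(* Chosen with [R0] so that [M0^2 + e G + e^2 R0 = (1 + e^2) 1]: the first order cancels exactly,
   and [R0 = 1 - G^2 / 4] is positive because [G] has trace one. *)
pose M0 := 1%:M - (e / 2)%:C *: G.
have hM0 : adjm M0 = M0 by rewrite adjmB adjm1 adjmZr hG.
pose R0 := 1%:M - (4^-1)%:C *: (G *m G).
have pR0 : psdmx R0.
  have G1 : psdmx (1%:M - G) by have := psd_le_tr pG; rewrite V1 rmorph1.
  have GG1 : rtr (G *m G) <= 1 by have := lem_rtr pG G1; rewrite mulmx1 V1.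
  have pGG : psdmx (G *m G) by have := psdmx_gram G; rewrite hG.
  have -> : R0 = (4^-1)%:C *: ((rtr (G *m G))%:C%:M - G *m G)
      + (1 - 4^-1 * rtr (G *m G))%:C *: 1%:M.
    rewrite scalerBr scalarC scalerA -rmorphM addrAC -scalerDl -rmorphD.
    by rewrite addrCA subrr addr0 rmorph1 scale1r.
  apply: psdmxD; apply: psdmxZ; try lra; [exact: psd_le_tr | exact: psdmx1].
pose S0 := gsqrt R0.
have hS0 : adjm S0 = S0 by apply/psdmx_herm/gsqrt_psd.
have S00 : S0 *m S0 = R0 by exact: gsqrt_sqr.
pose al := (Num.sqrt (1 + e ^+ 2))^-1.
have q0 : 0 < 1 + e ^+ 2 by rewrite ltr_pwDl // sqr_ge0.
have al2 : al ^+ 2 = (1 + e ^+ 2)^-1 by rewrite exprVn sqr_sqrtr // ltW.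
have Yp : 0 < #|Y|%:R :> RR by rewrite ltr0n.
(* The Gram matrices of all [ketbra y x] sum to [#|Y|] times the identity, whence the division. *)
pose be := e / Num.sqrt #|Y|%:R.
have be2 : be ^+ 2 = e ^+ 2 / #|Y|%:R by rewrite expr_div_n sqr_sqrtr // ltW.
pose P (j : I + (unit + (Y * X))) : rop CC Y X := al%:C *:
  match j with
  | inl i => M i *m M0
  | inr (inl _) => (Num.sqrt e)%:C *: V
  | inr (inr p) => be%:C *: (ketbra p.1 p.2 *m S0)
  end.
have sP : \sum_j adjm (P j) *m P j = 1%:M.
  have sq (a : RR) (A : rop CC Y X) :
      adjm (a%:C *: A) *m (a%:C *: A) = (a ^+ 2)%:C *: (adjm A *m A).
    by rewrite adjmZr -scalemxAl -scalemxAr scalerA expr2 rmorphM.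
  under eq_bigr => j _ do rewrite /P sq.
  rewrite -scaler_sumr !big_sumType /= (big_pred1 tt); last by case.
  rewrite gram_mulr sM mulmx1 hM0 sq sqr_sqrtr ?ltW //.
  under [X in _ + (_ + X)]eq_bigr => p _ do rewrite sq.
  rewrite -scaler_sumr gram_mulr.
  have -> : \sum_(p : Y * X) adjm (ketbra p.1 p.2) *m ketbra p.1 p.2
      = (#|Y|%:R)%:C *: 1%:M.
    rewrite -(pair_bigA _ (fun y x => adjm (ketbra y x) *m ketbra y x)) /=.
    under eq_bigr => y _ do under eq_bigr => x _ do rewrite ketbra_gram.
    by under eq_bigr => y _ do rewrite sum_unitop; rewrite sumr_const rmorph_nat scaler_nat.
  rewrite -scalemxAr mulmx1 -scalemxAl hS0 S00 scalerA -rmorphM be2 divfK ?gt_eqF //.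
  have -> : M0 *m M0 + (e%:C *: (adjm V *m V) + (e ^+ 2)%:C *: R0)
      = (1 + e ^+ 2)%:C *: 1%:M.
    rewrite -/G /R0 /M0 !(mulmxBl, mulmxBr, mul1mx, mulmx1) -!(scalemxAl, scalemxAr).
    suff gen (H H2 : 'M[CC]_#|X|) : 1%:M - (e / 2)%:C *: H -
        ((e / 2)%:C *: H - (e / 2)%:C *: ((e / 2)%:C *: H2)) +
        (e%:C *: H + (e ^+ 2)%:C *: (1%:M - (4^-1)%:C *: H2)) = (1 + e ^+ 2)%:C *: 1%:M.
      exact: gen.
    apply/matrixP => p q; rewrite !mxE.
    rewrite !(rmorphD, rmorphM, rmorph1, fmorphV, rmorphXn, rmorph_nat) /=.
    by field.
  by rewrite scalerA -rmorphM al2 mulVf ?rmorph1 ?scale1r // gt_eqF.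
have vP : \sum_j kform (P j) >= (1 + e ^+ 2)^-1 * (v - e * rtr (G *m Z) + e * kform V).
  rewrite /P; under eq_bigr => j _ do rewrite kformZ.
  rewrite -mulr_sumr al2.
  rewrite ler_pM2l ?invr_gt0 //.
  rewrite !big_sumType /= (big_pred1 tt); last by case.
  rewrite kformZ (sqr_sqrtr (ltW e0)) sum_kform_mulr -/N.
  have h3 : 0 <= \sum_(p : Y * X) kform (be%:C *: (ketbra p.1 p.2 *m S0)).
    by apply: sumr_ge0 => p _; apply: kform_ge0.
  suff h4 : v - e * rtr (G *m Z) <= rtr (tensid K M0 *m T *m adjm (tensid K M0) *m N).
    apply: (@le_trans _ _ (rtr (tensid K M0 *m T *m adjm (tensid K M0) *m N) + e * kform V)).
      by rewrite lerD2r.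
    by rewrite addrA lerDl.
  have ev : v = rtr (T *m N).
    rewrite /v; under eq_bigr => i _ do rewrite -[M i]mulmx1.
    by rewrite sum_kform_mulr tensid1 adjm1 mul1mx mulmx1.
  have pN : psdmx N.
    apply: psdmx_sum => i _; have := psdmx_conj (adjm (tensid K (M i))) pW.
    by rewrite adjmK.
  have hT := psdmx_herm pT; have hN := psdmx_herm pN.
  pose G' := tensid K G.
  have hG' : adjm G' = G' by rewrite tensid_adj hG.
  have e1 : rtr (G' *m T *m N) = rtr (G *m Z).
    rewrite -mulmxA rtrC rtr_tensid rtrC -scalemxAr rtrZ mulmxDr rtrD.
    have -> : rtr (G *m adjm (ptr (T *m N))) = rtr (G *m ptr (T *m N)).
      by rewrite -rtr_adj adjmM adjmK hG rtrC.
    lra.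
  have e2 : rtr (T *m G' *m N) = rtr (G *m Z).
    by rewrite -rtr_adj !adjmM hT hG' hN rtrC.
  have e3 : 0 <= rtr (G' *m T *m G' *m N).
    by apply: psd_rtrM_ge0 => //; have := psdmx_conj G' pT; rewrite hG'.
  move: (rtr (G *m Z)) e1 e2 => z e1 e2.
  rewrite tensid_adj hM0 ev.
  have -> : tensid K M0 = 1%:M - (e / 2)%:C *: G'.
    by rewrite /M0 -scaleN1r tensidD tensid1 !tensidZ scaleN1r.
  rewrite !(mulmxBl, mulmxBr, mul1mx, mulmx1) -!(scalemxAl, scalemxAr) !(rtrB, rtrZ).
  rewrite e1 e2; nra.
(* The error term comes from [(v + e^2) (1 + e^2) = v + e^2 (1 + v + e^2)] after division by [e]. *)
have := le_trans vP (opt _ _ sP).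
rewrite mulrC ler_pdivrMr // => h.
have : e * (kform V - rtr (G *m Z)) <= e * (e * (1 + v + e ^+ 2)).
  by move: h; rewrite -/v; nra.
by rewrite ler_pM2l //; rewrite -/G; lra.
Qed.

(** A multiple [dl] of the identity absorbs the first-order error of [near_dual_unit], and
    homogeneity in [V] removes the normalization. *)
Lemma dual_certificate (c eps : RR) :
  psdmx T -> psdmx W -> (0 < #|Y|)%N -> 0 < eps -> 0 <= c ->
  (forall (J : finType) (N : J -> rop CC Y X), \sum_j adjm (N j) *m N j = 1%:M ->
     \sum_j kform (N j) <= c) ->
  exists Z : rop CC X X, [/\ adjm Z = Z, rtr Z <= c + eps
    & forall V, kform V <= rtr (adjm V *m V *m Z)].
Proof.
move=> pT pW Y0 eps0 c0 hc.
(* The shift [dl] is at most [e * (2 + c)] and the identity has trace [#|X|], so the trace grows by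
   at most [eps]; the [+ 1] keeps the divisor positive. *)
pose e := Num.min 1 (eps / ((2 + c) * (#|X|%:R + 1))).
have X1 : 0 < #|X|%:R + 1 :> RR by rewrite ltr_wpDl.
have k0 : 0 < (2 + c) * (#|X|%:R + 1) by rewrite mulr_gt0 // ltr_pwDl.
have e0 : 0 < e by rewrite lt_min ltr01 divr_gt0.
have e1 : e <= 1 by rewrite ge_min lexx.
have e2 : e * (2 + c) * #|X|%:R <= eps.
  have : e <= eps / ((2 + c) * (#|X|%:R + 1)) by rewrite ge_min lexx orbT.
  rewrite ler_pdivlMr // => h.
  have : e * (2 + c) * #|X|%:R <= e * ((2 + c) * (#|X|%:R + 1)).
    rewrite -mulrA ler_pM2l // ler_wpM2l ?lerDl //; lra.
  by move=> h'; apply: le_trans h' h.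
pose A : set RR := [set a | exists (J : finType) (N : J -> rop CC Y X),
  \sum_j adjm (N j) *m N j = 1%:M /\ a = \sum_j kform (N j)]%classic.
have [y _] : exists y : Y, true.
  by move: Y0 => /card_gt0P[y _]; exists y.
have g0 : A (\sum_x kform (ketbra y x)).
  exists X, (fun x => ketbra y x); split=> //.
  by under eq_bigr => x _ do rewrite ketbra_gram; exact: sum_unitop.
have [|_ [I [M [sM ->]]] opt] := @near_sup RR A c (e ^+ 2) _ g0 _ (exprn_gt0 2 e0).
  by move=> _ [J [N [sN ->]]]; exact: hc.
set N := \sum_i adjm (tensid K (M i)) *m W *m tensid K (M i).
pose Z0 := 2^-1%:C *: (ptr (T *m N) + adjm (ptr (T *m N))).
pose dl := e * (1 + \sum_i kform (M i) + e ^+ 2).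
have hZ0 : adjm Z0 = Z0 by rewrite adjmZr adjmD adjmK addrC.
have v0 : 0 <= \sum_i kform (M i) by apply: sumr_ge0 => i _; apply: kform_ge0.
have vc : \sum_i kform (M i) <= c by exact: hc.
have tZ0 : rtr Z0 = \sum_i kform (M i).
  rewrite rtrZ rtrD rtr_adj -[ptr _]mulmx1 -rtr_tensid tensid1 mulmx1.
  under [RHS]eq_bigr => i _ do rewrite -[M i]mulmx1.
  rewrite sum_kform_mulr tensid1 adjm1 mul1mx mulmx1 -/N; lra.
have dl0 : 0 <= dl by apply: mulr_ge0; [exact: ltW | apply: addr_ge0; [lra | exact: sqr_ge0]].
have dle : dl <= e * (2 + c).
  rewrite ler_pM2l //; have : e ^+ 2 <= 1 by rewrite expr_le1 // ltW.
  lra.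
exists (Z0 + dl%:C *: 1%:M); split.
- by rewrite adjmD hZ0 adjmZr adjm1.
- rewrite rtrD rtrZ rtr1 tZ0.
  have : dl * #|X|%:R <= e * (2 + c) * #|X|%:R by rewrite ler_wpM2r.
  lra.
- move=> V; have -> : rtr (adjm V *m V *m (Z0 + dl%:C *: 1%:M))
      = rtr (adjm V *m V *m Z0) + dl * rtr (adjm V *m V).
    by rewrite mulmxDr rtrD -[adjm V *m V *m (dl%:C *: _)]scalemxAr rtrZ mulmx1.
  have pG : psdmx (adjm V *m V) by have := psdmx_gram (adjm V); rewrite adjmK.
  have [t0|t0] := leP (rtr (adjm V *m V)) 0.
    have V0 : V = 0.
      have : adjm V = 0 by apply: gram_tr0; rewrite adjmK.
      by move=> /(congr1 (@adjm _ _ _ _)); rewrite adjmK adjm0.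
    rewrite V0 /kform tensid0 !(mul0mx, mulmx0) !rtr0 mulr0 addr0 lexx //.
  set t := rtr _ in t0 *.
  pose V1 := ((Num.sqrt t)^-1)%:C *: V.
  have gV1 : adjm V1 *m V1 = (t^-1)%:C *: (adjm V *m V).
    rewrite adjmZr -scalemxAl -scalemxAr scalerA -rmorphM -invfM -expr2.
    by rewrite sqr_sqrtr // ltW.
  have := @near_dual_unit e I M V1 pT pW Y0 e0 sM.
  move=> /(_ (fun J N0 sN => opt _ (ex_intro _ J (ex_intro _ N0 (conj sN erefl))))).
  rewrite gV1 rtrZ mulVf ?gt_eqF // => /(_ erefl).
  rewrite kformZ exprVn sqr_sqrtr; last exact: ltW.
  rewrite -scalemxAl rtrZ -/N -/Z0 -/dl.
  move=> /(ler_wpM2l (ltW t0)); rewrite mulrDr !mulrA mulfV ?gt_eqF // !mul1r.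
  by move=> h; apply: le_trans h _; rewrite lerD2l /dl [leRHS]mulrC !mulrA.
Qed.

Local Notation XY := ((X * Y)%type : finType).

(** The matrix of the quadratic form [kform] in the vectorized Kraus operator. A dual certificate
    thereby becomes the operator inequality [wform <= Z (x) id], which passes to tensor powers. *)
Definition wform : rop CC XY XY :=
  rmk (fun p q : X * Y => \sum_k \sum_l
    rent T (p.1, k) (q.1, l) * rent W (q.2, l) (p.2, k)).

Definition rvec (V : rop CC Y X) : 'rV[CC]_#|XY| :=
  \row_j rent V (enum_val j).2 (enum_val j).1.

Lemma rvecK (v : 'rV[CC]_#|XY|) :
  v = rvec (rmk (fun y x => v 0 (enum_rank (x, y)))).
Proof.
apply/rowP => j; rewrite mxE rentE; congr (v 0 _).
by rewrite -[LHS]enum_valK; case: (enum_val j).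
Qed.

Lemma rvec_form (V : rop CC Y X) (A : rop CC XY XY) :
  \tr (rvec V *m A *m adjm (rvec V)) = \sum_x \sum_y \sum_x' \sum_y'
    rent V y x * rent A (x, y) (x', y') * Num.conj (rent V y' x').
Proof.
rewrite -mx11E mxE sum_enum_rank.
under eq_bigr => q _ do rewrite mxE sum_enum_rank mulr_suml.
rewrite exchange_big /= sum_pair; apply: eq_bigr => x _; apply: eq_bigr => y _.
rewrite sum_pair; apply: eq_bigr => x' _; apply: eq_bigr => y' _.
by rewrite adjm_ij !mxE !enum_rankK.
Qed.

Lemma sum6 (f : X -> Y -> X -> Y -> K -> K -> CC) :
  \sum_x \sum_y \sum_x' \sum_y' \sum_k \sum_l f x y x' y' k l =
  \sum_y \sum_k \sum_y' \sum_l \sum_x' \sum_x f x y x' y' k l.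
Proof.
rewrite exchange_big /=; apply: eq_bigr => y _; rewrite [RHS]exchange_big /=.
rewrite pair_bigA /= exchange_big /=; apply: eq_bigr => y' _.
rewrite exchange_big /=; apply: eq_bigr => k _.
rewrite exchange_big /=; apply: eq_bigr => l _.
by rewrite [RHS]exchange_big /= pair_bigA.
Qed.

Lemma rvec_wform V : rtr (rvec V *m wform *m adjm (rvec V)) = kform V.
Proof.
rewrite rtrE rvec_form /kform rtrE tr_rent; congr re.
under eq_bigr => x _ do under eq_bigr => y _ do under eq_bigr => x' _ do
  under eq_bigr => y' _ do (rewrite rentE /= mulr_sumr mulr_suml;
    under eq_bigr => k _ do rewrite mulr_sumr mulr_suml).
rewrite sum6 sum_pair; apply: eq_bigr => y _; apply: eq_bigr => k _.
rewrite rent_mul sum_pair; apply: eq_bigr => y' _; apply: eq_bigr => l _.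
rewrite tensid_adj rent_mul_tensid mulr_suml; apply: eq_bigr => x' _.
rewrite rent_tensid_mul !mulr_suml; apply: eq_bigr => x _.
by rewrite rent_adj; ring.
Qed.

Lemma rvec_tensid V (Z : rop CC X X) :
  rtr (rvec V *m tensid Y Z *m adjm (rvec V)) = rtr (adjm V *m V *m Z).
Proof.
rewrite !rtrE rvec_form tr_rent; congr re.
under [RHS]eq_bigr => x' _ do (rewrite rent_mul;
  under eq_bigr => x _ do rewrite rent_mul mulr_suml).
rewrite [RHS]exchange_big /=; apply: eq_bigr => x _.
rewrite [RHS]exchange_big /=; apply: eq_bigr => y _; apply: eq_bigr => x' _.
under eq_bigr => y' _ do rewrite rentE /= mulrA mulrAC.
by rewrite sum_delta rent_adj; ring.
Qed.

Lemma psd_re n (A : 'M[CC]_n) : adjm A = A ->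
  (forall v : 'rV[CC]_n, 0 <= rtr (v *m A *m adjm v)) -> psdmx A.
Proof.
move=> hA h; apply/psdmxP; split=> // v; rewrite mx11E.
have := h v; rewrite rtrE -(ofR_ge0 CC) ofR_re //; apply/CrealP.
by rewrite -mx11E -adjm_ij !adjmM adjmK hA mulmxA.
Qed.

Lemma wform_psd : psdmx T -> psdmx W -> psdmx wform.
Proof.
move=> pT pW; apply: psd_re => [|v]; last by rewrite (rvecK v) rvec_wform kform_ge0.
apply: ropP => p q; rewrite rent_adj !rentE rmorph_sum exchange_big /=.
apply: eq_bigr => k _; rewrite rmorph_sum; apply: eq_bigr => l _.
rewrite rmorphM /= -!rent_adj (psdmx_herm pT) (psdmx_herm pW).
by [].
Qed.

Lemma wform_le (Z : rop CC X X) : psdmx T -> psdmx W -> adjm Z = Z ->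
  (forall V, kform V <= rtr (adjm V *m V *m Z)) -> psdmx (tensid Y Z - wform).
Proof.
move=> pT pW hZ h; apply: psd_re => [|v].
  by rewrite adjmB tensid_adj hZ (psdmx_herm (wform_psd pT pW)).
rewrite mulmxBr mulmxBl rtrB subr_ge0 (rvecK v) rvec_wform rvec_tensid.
exact: h.
Qed.

Lemma tensid_psd_inv (Z : rop CC X X) : (0 < #|Y|)%N -> psdmx (tensid Y Z) -> psdmx Z.
Proof.
move=> /card_gt0P[y _]; rewrite -amplify_inj => pZ.
have := psdmx_conj (adjm (inj1 CC X y)) pZ; rewrite adjmK.
have [hT _] := isofam_inj CC X Y.
rewrite /amplify mulmx_sumlr (bigD1 y) //= big1 => [|z zy].
  by rewrite addr0 !mulmxA hT eqxx mul1mx -mulmxA hT eqxx mulmx1.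
by rewrite !mulmxA hT eq_sym (negbTE zy) !mul0mx.
Qed.

Lemma psd_add_pd n (A : 'M[CC]_n) (d : RR) : psdmx A -> 0 < d -> pdmx (A + d%:C%:M).
Proof.
move=> pA d0; split; last by exists d => //; rewrite addrK.
by apply: psdmxD => //; rewrite scalarC; apply: psdmxZ; [exact: ltW | exact: psdmx1].
Qed.

(** Half of [eps] pays for the certificate, half for a multiple of the identity that makes [Z]
    invertible, as [tpe_mono] assumes. *)
Lemma dual_certificate_pd (c eps : RR) :
  psdmx T -> psdmx W -> (0 < #|Y|)%N -> 0 < eps -> 0 <= c ->
  (forall (J : finType) (N : J -> rop CC Y X), \sum_j adjm (N j) *m N j = 1%:M ->
     \sum_j kform (N j) <= c) ->
  exists Z : rop CC X X, [/\ pdmx Z, rtr Z <= c + eps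
    & forall V, kform V <= rtr (adjm V *m V *m Z)].
Proof.
move=> pT pW Y0 eps0 c0 hc; have e2 : 0 < eps / 2 by rewrite divr_gt0.
have [Z [hZ tZ hk]] := dual_certificate pT pW Y0 e2 c0 hc.
have pZ : psdmx Z.
  apply: tensid_psd_inv => //; rewrite -[tensid Y Z](subrK wform).
  by apply: psdmxD; [exact: wform_le | exact: wform_psd].
have X1 : 0 < #|X|%:R + 1 :> RR by rewrite ltr_wpDl.
pose d := eps / 2 / (#|X|%:R + 1).
have d0 : 0 < d by rewrite divr_gt0.
exists (Z + d%:C%:M); split=> [||V].
- exact: psd_add_pd.
- rewrite scalarC rtrD rtrZ rtr1.
  have : d * #|X|%:R <= eps / 2.
    by rewrite mulrAC ler_pdivrMr // ler_pM2l // lerDl.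
  lra.
- apply: le_trans (hk V) _; rewrite mulmxDr rtrD lerDl scalarC.
  have -> : rtr (adjm V *m V *m (d%:C *: 1%:M)) = d * rtr (adjm V *m V).
    by rewrite -scalemxAr mulmx1 rtrZ.
  apply: mulr_ge0; first exact: ltW.
  by apply: psd_rtr_ge0; have := psdmx_gram (adjm V); rewrite adjmK.
Qed.

End KrausFunctionals.

Section TensorDuality.
Variables (n : nat) (X Y K X' Y' K' : finType).
Variables (eX : X' -> 'I_n -> X) (eY : Y' -> 'I_n -> Y) (eK : K' -> 'I_n -> K).
Hypotheses (hX : encoding eX) (hY : encoding eY) (hK : encoding eK).
Variables (T : rop CC (X * K)%type (X * K)%type) (W : rop CC (Y * K)%type (Y * K)%type).
Let Tn := tpe (encpair eX eK) (fun=> T).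
Let Wn := tpe (encpair eY eK) (fun=> W).

Lemma wform_tpe : wform Tn Wn = tpe (encpair eX eY) (fun=> wform T W).
Proof.
apply: ropP => p q; rewrite !rentE.
under [RHS]eq_bigr => i _ do rewrite rentE /=.
rewrite -(enc_distr hK (fun i k => \sum_l rent T (eX p.1 i, k) (eX q.1 i, l) *
   rent W (eY q.2 i, l) (eY p.2 i, k))).
apply: eq_bigr => k _.
rewrite -(enc_distr hK (fun i l => rent T (eX p.1 i, eK k i) (eX q.1 i, l) *
   rent W (eY q.2 i, l) (eY p.2 i, eK k i))).
by apply: eq_bigr => l _; rewrite !rentE big_split.
Qed.

(** The inequality [wform <= Z (x) id] is raised to the tensor power by [tpe_mono] and evaluated at
    the vectorized Kraus operators of an arbitrary joint channel; their Gram matrices sum to the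
    identity, leaving the trace of the power of [Z]. *)
Lemma kform_tpe (Z : rop CC X X) (J : finType) (M : J -> rop CC Y' X') :
  psdmx T -> psdmx W -> (0 < #|Y|)%N -> pdmx Z ->
  (forall V, kform T W V <= rtr (adjm V *m V *m Z)) ->
  \sum_j adjm (M j) *m M j = 1%:M ->
  \sum_j kform Tn Wn (M j) <= rtr Z ^+ n.
Proof.
move=> pT pW Y0 pZ hZ sM; have [pZ' [c c0 Zc]] := pZ.
have hle := wform_le pT pW (psdmx_herm pZ') hZ.
have pdZ : pdmx (tensid Y Z).
  split; first exact: tensid_psd.
  exists c => //; have := tensid_psd Y Zc.
  by rewrite -scaleN1r tensidD tensidZ scaleN1r !scalarC tensidZ tensid1.
have := tpe_mono (encpairP hX hY) (wform_psd pT pW) pdZ hle.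
rewrite -wform_tpe -(tensid_tpe eX (fun=> Z) hY) => mono.
apply: (@le_trans _ _ (\sum_j rtr (adjm (M j) *m M j *m tpe eX (fun=> Z)))).
  apply: ler_sum => j _; rewrite -rvec_wform -rvec_tensid -subr_ge0 -rtrB.
  by rewrite -mulmxBl -mulmxBr; apply/psd_rtr_ge0/psdmx_conj.
rewrite -rtr_sum -mulmx_suml sM mul1mx rtr_tpe // => [|i]; last exact: psd_tr_ge0.
by rewrite prodr_const card_ord.
Qed.

End TensorDuality.
End Duality.

(** * Minimax *)

Section Minimax.
Variables (RR : realType) (CC : complexLike RR).

Lemma near_inf (A : set RR) (c e a0 : RR) :
  A a0 -> (forall a, A a -> c <= a) -> 0 < e ->
  exists2 a, A a & forall b, A b -> a <= b + e.
Proof.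
move=> Aa0 Ac e0; pose B : set RR := [set - a | a in A]%classic.
have [||_ [a Aa <-] h] := @near_sup RR B (- c) e (- a0) _ _ e0.
- by exists a0.
- by move=> _ [a Aa <-]; rewrite lerN2 Ac.
by exists a => // b Ab; have := h (- b) (ex_intro2 _ _ b Ab erefl); lra.
Qed.

Lemma tlog_scalar n (r : 'M[CC]_n) (c : RR) : tlog r (c%:C%:M) = ln c * rtr r.
Proof.
have rE : resol (fun _ : unit => 1%:M : 'M[CC]_n).
  split=> [_|[] []|]; rewrite ?adjm1 ?mulmx1 //.
  by rewrite (big_pred1 tt) //; case.
have -> : (c%:C%:M : 'M[CC]_n) = rsum (fun=> c) (fun _ : unit => 1%:M).
  by rewrite /rsum (big_pred1 tt) ?scalarC //; case.
by rewrite tlog_rsum // (big_pred1 tt) ?mulmx1 //; case.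
Qed.

Lemma tlogZl n (r A : 'M[CC]_n) (c : RR) : tlog (c%:C *: r) A = c * tlog r A.
Proof. by rewrite /tlog -scalemxAl rtrZ. Qed.

Lemma psd_scalar n (c : RR) : 0 <= c -> psdmx (c%:C%:M : 'M[CC]_n).
Proof. by move=> c0; rewrite scalarC; apply: psdmxZ => //; apply: psdmx1. Qed.

Lemma pd_scalar n (c : RR) : 0 < c -> pdmx (c%:C%:M : 'M[CC]_n).
Proof.
move=> c0; split; first exact/psd_scalar/ltW.
by exists c => //; rewrite subrr; apply: psdmx0.
Qed.

(** Operator Jensen with two Kraus operators equal to [2^(-1/2)] times the identity; midpoint
    concavity is the form used in the minimax argument. *)
Lemma tlog_mid n (r A B : 'M[CC]_n) : psdmx r -> pdmx A -> pdmx B ->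
  (tlog r A + tlog r B) / 2 <= tlog r (2^-1%:C *: (A + B)).
Proof.
move=> pr pA pB; have [pA' _] := pA; have [pB' _] := pB.
have s0 : 0 <= 2^-1 :> RR by rewrite invr_ge0.
pose a : RR := Num.sqrt 2^-1; have a2 : a * a = 2^-1 by rewrite -expr2 sqr_sqrtr.
pose K (b : bool) : 'M[CC]_n := a%:C *: 1%:M.
pose X (b : bool) := if b then A else B.
have KK b (M : 'M[CC]_n) : K b *m M *m adjm (K b) = 2^-1%:C *: M.
  rewrite adjmZr adjm1 -scalemxAl mul1mx -scalemxAr mulmx1 scalerA.
  by rewrite -rmorphM a2.
have KK' b (M : 'M[CC]_n) : adjm (K b) *m M *m K b = 2^-1%:C *: M.
  rewrite adjmZr adjm1 -scalemxAl mul1mx -scalemxAr mulmx1 scalerA.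
  by rewrite -rmorphM a2.
have eX : \sum_b adjm (K b) *m X b *m K b = 2^-1%:C *: (A + B).
  by rewrite big_bool /= !KK' scalerDr.
have pX : pdmx (2^-1%:C *: (A + B)).
  have [_ [c c0 Ac]] := pA; split.
    by apply: psdmxZ => //; apply: psdmxD.
  exists (2^-1 * c); first by rewrite mulr_gt0.
  have -> : 2^-1%:C *: (A + B) - (2^-1 * c)%:C%:M
     = 2^-1%:C *: (A - c%:C%:M) + 2^-1%:C *: B.
    by rewrite !scalarC scalerBr scalerA -rmorphM scalerDr addrAC.
  by apply: psdmxD; apply: psdmxZ.
have h1 : \sum_b adjm (K b) *m K b = 1%:M.
  under eq_bigr => b _ do rewrite -[adjm _]mulmx1 KK'.
  by rewrite big_bool /= -scalerDl -rmorphD -[2^-1]mul1r -splitr rmorph1 scale1r.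
have h2 b : psdmx (X b) by case: b.
have h3 b : dominated (K b *m r *m adjm (K b)) (X b).
  by apply: pdmx_dominated; case: b.
have := tlog_jensen pr h1 h2 h3; rewrite eX => /(_ (pdmx_dominated _ pX)).
by rewrite big_bool /= !KK !tlogZl; lra.
Qed.

Definition gpovm n (k : nat) (M : 'I_k -> 'M[CC]_n) : Prop :=
  (forall j, psdmx (M j)) /\ \sum_(j < k) M j = 1%:M.

(** With [ln 0 = 0] this is the relative entropy of the outcomes as long as none has probability
    zero under [s] and positive probability under [r]. *)
Definition cdiv n k (M : 'I_k -> 'M[CC]_n) (r s : 'M[CC]_n) : RR :=
  \sum_j rtr (M j *m r) * (ln (rtr (M j *m r)) - ln (rtr (M j *m s))).

(* The likelihood ratios of the outcomes, averaged with the POVM elements,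
   give an operator whose logarithm dominates by the operator Jensen inequality. *)
Lemma povm_omega n k (M : 'I_k -> 'M[CC]_n) (r s : 'M[CC]_n) (G e : RR) :
  gpovm M -> psdmx r -> rtr r = 1 -> psdmx s -> rtr s = 1 -> 0 < G ->
  psdmx (G%:C *: s - r) -> 0 < e ->
  exists w : 'M[CC]_n, [/\ pdmx w, psdmx ((G + e)%:C%:M - w),
     cdiv M r s <= tlog r w & rtr (s *m w) <= 1 + e].
Proof.
move=> [pM sM] pr r1 ps s1 G0 Gs e0.
pose p j := rtr (M j *m r); pose q j := rtr (M j *m s).
have p0 j : 0 <= p j by apply: psd_rtrM_ge0.
have q0 j : 0 <= q j by apply: psd_rtrM_ge0.
have pq j : p j <= G * q j.
  by rewrite /p /q -rtrZ scalemxAr; apply: lem_rtr.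
(* At the default value [0] nothing is lost, since [q j = 0] forces [p j = 0]. The later shift by
   [e] makes the average invertible and costs [e] in [tr (s w)]. *)
pose w j := if q j == 0 then 0 else p j / q j.
have w0 j : 0 <= w j by rewrite /w; case: eqP => // _; rewrite divr_ge0.
have wG j : w j <= G.
  rewrite /w; case: eqP => [_|/eqP qj]; first exact: ltW.
  by rewrite ler_pdivrMr // lt_neqAle eq_sym qj q0.
have we j : 0 < w j + e by rewrite ltr_wpDl.
pose K j := gsqrt (M j).
have hK j : adjm (K j) = K j by apply/psdmx_herm/gsqrt_psd.
have KK j : K j *m K j = M j by exact: gsqrt_sqr.
pose X j : 'M[CC]_n := (w j + e)%:C%:M.
have pX j : pdmx (X j) by exact: pd_scalar.
have eW : \sum_j adjm (K j) *m X j *m K j = \sum_j (w j + e)%:C *: M j.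
  by apply: eq_bigr => j _; rewrite hK mul_mx_scalar -scalemxAl KK.
set W := \sum_j _ in eW.
have lbW : psdmx (W - e%:C%:M).
  rewrite eW scalarC -sM scaler_sumr -sumrB; apply: psdmx_sum => j _.
  by rewrite -scalerBl -rmorphB addrK; apply: psdmxZ.
have pW : pdmx W.
  split; last by exists e.
  by rewrite eW; apply: psdmx_sum => j _; apply: psdmxZ; rewrite ?ltW.
exists W; split=> //.
- rewrite eW scalarC -sM scaler_sumr -sumrB; apply: psdmx_sum => j _.
  by rewrite -scalerBl -rmorphB; apply: psdmxZ => //; rewrite subr_ge0 lerD2r.
- have h1 : \sum_j adjm (K j) *m K j = 1%:M.
    by under eq_bigr => j _ do rewrite hK KK.
  have h2 j : psdmx (X j) by case: (pX j).
  have h3 j : dominated (K j *m r *m adjm (K j)) (X j) by exact: pdmx_dominated.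
  apply: le_trans (tlog_jensen pr h1 h2 h3 (pdmx_dominated _ pW)).
  apply: ler_sum => j _.
    have e1 : rtr (K j *m r *m K j) = p j by rewrite rtrC mulmxA KK.
    rewrite tlog_scalar hK e1 -/(p j) -/(q j) [leRHS]mulrC.
    have [pj|pj] := eqVneq (p j) 0; first by rewrite pj !mul0r.
    have pj0 : 0 < p j by rewrite lt_neqAle eq_sym pj p0.
    have qj0 : 0 < q j by have := pq j; rewrite -(pmulr_rgt0 _ G0); apply: lt_le_trans.
    rewrite ler_pM2l // -ln_div // ler_ln ?posrE ?divr_gt0 //.
    by rewrite /w gt_eqF // lerDl ltW.
- rewrite eW mulmx_sumr rtr_sum.
  have -> : 1 + e = \sum_j (p j + e * q j).
    rewrite big_split /= -mulr_sumr -!rtr_sum -!mulmx_suml sM !mul1mx r1 s1.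
    by rewrite mulr1.
  apply: ler_sum => j _; rewrite -scalemxAr rtrZ rtrC -/(q j) mulrDl lerD2r.
  rewrite /w; case: eqP => [->|/eqP qj]; first by rewrite mulr0.
  by rewrite divfK.
Qed.

(** Expansion of the squared Hilbert-Schmidt norm of [s A - B]. *)
Lemma rtr_young n (A B : 'M[CC]_n) (s : RR) : adjm A = A -> adjm B = B -> 0 < s ->
  rtr (A *m B) <= s / 2 * rtr (A *m A) + (2 * s)^-1 * rtr (B *m B).
Proof.
move=> hA hB s0.
have h : 0 <= rtr ((s%:C *: A - B) *m adjm (s%:C *: A - B)).
  exact/psd_rtr_ge0/psdmx_gram.
move: h; rewrite adjmB adjmZr hA hB mulmxBl !mulmxBr -!scalemxAl -!scalemxAr.
rewrite !rtrB !rtrZ [rtr (B *m A)]rtrC.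
set a := rtr (A *m A); set b := rtr (B *m B); set c := rtr (A *m B) => h.
have : 0 <= (2 * s)^-1 * (s * (s * a) - s * c - (s * c - b)).
  by rewrite mulr_ge0 // invr_ge0 mulr_ge0 // ltW.
suff -> : (2 * s)^-1 * (s * (s * a) - s * c - (s * c - b)) =
  s / 2 * a + (2 * s)^-1 * b - c by rewrite subr_ge0.
by field; rewrite gt_eqF.
Qed.

Lemma rtr_sqr_le1 n (s : 'M[CC]_n) : psdmx s -> rtr s = 1 -> rtr (s *m s) <= 1.
Proof.
move=> ps s1; have := lem_rtr ps (psd_le_tr ps).
by rewrite s1 rmorph1 mulmx1 s1.
Qed.

(** Parallelogram identity, both states having purity at most one. *)
Lemma rtr_sqr_diff n (s t : 'M[CC]_n) : psdmx s -> psdmx t -> rtr s = 1 -> rtr t = 1 ->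
  rtr ((t - s) *m (t - s)) <= 4.
Proof.
move=> ps pt s1 t1.
have := psd_rtr_ge0 (psdmx_gram (t + s)).
rewrite adjmD (psdmx_herm ps) (psdmx_herm pt) !(mulmxDl, mulmxDr, mulNmx, mulmxN) !(rtrD, rtrN).
have := rtr_sqr_le1 ps s1; have := rtr_sqr_le1 pt t1; lra.
Qed.

Section ConvexSet.
Variables (n : nat) (r : 'M[CC]_n) (S : 'M[CC]_n -> Prop) (G m : RR).
Hypotheses (pr : psdmx r) (r1 : rtr r = 1) (G0 : 0 < G).
Hypothesis S_ne : exists s, S s.
Hypothesis pS : forall s, S s -> [/\ psdmx s, rtr s = 1 & psdmx (G%:C *: s - r)].
Hypothesis cvxS : forall s t (a : RR), S s -> S t -> 0 <= a <= 1 ->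
  S ((1 - a)%:C *: s + a%:C *: t).
Hypothesis Sm : forall s e, S s -> 0 < e ->
  exists k (M : 'I_k -> 'M[CC]_n), gpovm M /\ m - e <= cdiv M r s.

(** Bounds the operators from [povm_omega], whose parameter will be at most [1]; boundedness of [Om]
    keeps the suprema finite. *)
Let G1 := G + 1.
Let Om (w : 'M[CC]_n) := pdmx w /\ psdmx (G1%:C%:M - w).
Let g (eta : RR) (s w : 'M[CC]_n) : RR :=
  tlog r w + 1 - rtr (s *m w) - eta * rtr (w *m w).

Lemma G1_gt0 : 0 < G1. Proof. by rewrite addr_gt0. Qed.

Lemma Om_rtr s w : psdmx s -> rtr s = 1 -> Om w -> 0 <= rtr (s *m w) <= G1.
Proof.
move=> ps s1 [[pw _] wG]; rewrite psd_rtrM_ge0 //=.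
by have := lem_rtr ps wG; rewrite mul_mx_scalar rtrZ s1 mulr1.
Qed.

Lemma Om_sqr w : Om w -> 0 <= rtr (w *m w) <= G1 ^+ 2 * n%:R.
Proof.
move=> [[pw _] wG]; rewrite psd_rtrM_ge0 //=.
have := lem_rtr pw wG; rewrite mul_mx_scalar rtrZ => h.
have := psd_rtr_ge0 wG; rewrite rtrB scalarC rtrZ rtr1 subr_ge0 => h'.
by apply: le_trans h _; rewrite expr2 -mulrA ler_pM2l // G1_gt0.
Qed.

Lemma g_le eta s w : 0 <= eta -> S s -> Om w -> g eta s w <= ln G1 + 1.
Proof.
move=> eta0 /pS[ps s1 _] Ow; have [[pw _] wG] := Ow.
have /andP[h1 _] := Om_rtr ps s1 Ow; have /andP[h2 _] := Om_sqr Ow.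
have h3 : tlog r w <= ln G1.
  rewrite -[leRHS]mulr1 -r1 -tlog_scalar; apply: tlog_le => //.
    exact/psd_scalar/ltW/G1_gt0.
  by apply: pdmx_dominated; case: Ow.
rewrite /g; have := mulr_ge0 eta0 h2; lra.
Qed.

(** The trace against [s] is affine and [tlog] midpoint concave; the gain [eta / 4] is the
    parallelogram identity for the penalty. *)
Lemma g_mid eta s w v : S s -> Om w -> Om v ->
  Om (2^-1%:C *: (w + v)) /\
  (g eta s w + g eta s v) / 2 + eta / 4 * rtr ((v - w) *m (v - w))
   <= g eta s (2^-1%:C *: (w + v)).
Proof.
move=> Ss [pw wG] [pv vG]; have [pw' [c c0 wc]] := pw; have [pv' _] := pv.
have i0 : 0 <= 2^-1 :> RR by rewrite invr_ge0.
split.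
  split; first split.
  - by apply: psdmxZ => //; apply: psdmxD.
  - exists (2^-1 * c); first by rewrite mulr_gt0.
    have -> : 2^-1%:C *: (w + v) - (2^-1 * c)%:C%:M
       = 2^-1%:C *: (w - c%:C%:M) + 2^-1%:C *: v.
      by rewrite !scalarC scalerBr scalerA -rmorphM scalerDr addrAC.
    by apply: psdmxD; apply: psdmxZ.
  - have -> : G1%:C%:M - 2^-1%:C *: (w + v)
       = 2^-1%:C *: (G1%:C%:M - w) + 2^-1%:C *: (G1%:C%:M - v).
      rewrite -scalerDr addrACA -opprD scalerBr; congr (_ - _).
      by rewrite scalarC -scalerDl scalerA -!rmorphD -rmorphM; congr (_%:C *: _); field.
    by apply: psdmxD; apply: psdmxZ.
have := tlog_mid pr pw pv.
rewrite /g -!scalemxAr -!scalemxAl !mulmxDr !mulmxDl !(rtrZ, rtrD, rtrB).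
rewrite !mulmxN !mulNmx !rtrN [rtr (v *m w)]rtrC.
by move: (tlog r (_ *: _)) => x h; nra.
Qed.

(* The term [eta * rtr (w *m w)] makes [g] strongly concave in [w], so a near-maximizer
   moves little when a near-minimal [s] is perturbed towards [t]; this replaces the
   compactness behind the usual minimax theorem. *)
Lemma minimax (e : RR) : 0 < e ->
  exists w : 'M[CC]_n, pdmx w /\
    forall t, S t -> m - e <= tlog r w + 1 - rtr (t *m w).
Proof.
move=> e0.
have C0 : 0 <= G1 ^+ 2 * n%:R by rewrite mulr_ge0 // sqr_ge0.
(* Makes the penalty at most [e / 4] on [Om]. *)
pose eta := e / (4 * (G1 ^+ 2 * n%:R + 1)).
have eta0 : 0 < eta by rewrite divr_gt0 // mulr_gt0 // ltr_wpDl.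
have etaC : eta * (G1 ^+ 2 * n%:R) <= e / 4.
  rewrite /eta mulrAC ler_pdivrMr ?mulr_gt0 ?ltr_wpDl //.
  have -> : e / 4 * (4 * (G1 ^+ 2 * n%:R + 1)) = e * (G1 ^+ 2 * n%:R + 1) by field.
  by rewrite ler_pM2l // lerDl.
(* [t * kap] will bound the squared distance [d] of the near-maximizers at [u] and at [ut]: strong
   concavity gives [eta / 4 * d <= (3 * t ^+ 2 + t * G1) / 2], and [t <= 1]. *)
pose kap := (6 + 2 * G1) / eta.
have k0 : 0 < kap by rewrite divr_gt0 // addr_gt0 // mulr_gt0 // G1_gt0.
pose s := e / 16; have s0 : 0 < s by rewrite divr_gt0.
(* The three bounds give [t ^+ 2 <= t], [3 * t <= e / 8], and at most [e / 8] for the distance term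
   in Young's inequality. *)
pose t := Num.min 1 (Num.min (e / 24) (s * e / (4 * kap))).
have t0 : 0 < t by rewrite !lt_min ltr01 !divr_gt0 // mulr_gt0.
have t1 : t <= 1 by rewrite ge_min lexx.
have t2 : t <= e / 24 by rewrite !ge_min lexx orbT.
have t3 : t * kap / (2 * s) <= e / 8.
  have k4 : 0 < 4 * kap by rewrite pmulr_rgt0.
  have s2 : 0 < 2 * s by rewrite pmulr_rgt0.
  have : t <= s * e / (4 * kap) by rewrite !ge_min lexx !orbT.
  rewrite ler_pdivlMr // ler_pdivrMr //.
  suff gen (k : RR) : t * (4 * k) <= s * e -> t * k <= e / 8 * (2 * s) by exact: gen.
  lra.
pose A u : set RR := [set x | exists w, Om w /\ x = g eta u w]%classic.
have Om1 : Om 1%:M.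
  split; first by rewrite -(rmorph1 (@ofR _ CC)); apply: pd_scalar.
  rewrite /G1 rmorphD rmorph1 raddfD /= addrK.
  exact/psd_scalar/ltW.
have hA u : S u -> has_sup (A u).
  move=> Su; split; first by exists (g eta u 1%:M), 1%:M.
  by exists (ln G1 + 1) => _ [w [Ow ->]]; apply: g_le => //; apply: ltW.
pose h u := sup (A u).
have hub u w : S u -> Om w -> g eta u w <= h u.
  by move=> Su Ow; apply: sup_ubound; [exact: (hA _ Su).2 | exists w].
have hadh u d : S u -> 0 < d -> exists2 w, Om w & h u - d <= g eta u w.
  move=> Su d0; have [_ [w [Ow ->]] hw] := sup_adherent d0 (hA _ Su).
  by exists w => //; apply: ltW.
(* Every state has a near-optimal measurement, which [povm_omega] turns into an element of [Om]; the
   loss [e / 4] is the penalty. *)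
have hm u : S u -> m - e / 4 <= h u.
  move=> Su; have [pu u1 uG] := pS Su; apply/ler_addgt0Pr => d d0.
  pose d' := Num.min 1 (d / 2).
  have d'0 : 0 < d' by rewrite lt_min ltr01 divr_gt0.
  have d'1 : d' <= 1 by rewrite ge_min lexx.
  have d'2 : d' <= d / 2 by rewrite ge_min lexx orbT.
  have [k [M [pM hM]]] := Sm Su d'0.
  have [w [pw wG hw sw]] := povm_omega pM pr r1 pu u1 G0 uG d'0.
  have Ow : Om w.
    split=> //; have -> : G1%:C%:M - w = (1 - d')%:C%:M + ((G + d')%:C%:M - w).
      rewrite addrA -raddfD -rmorphD; congr (_%:C%:M - _); rewrite /G1; ring.
    by apply: psdmxD => //; apply: psd_scalar; rewrite subr_ge0.
  have := hub _ _ Su Ow; have /andP[_ h2] := Om_sqr Ow.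
  have h3 : eta * rtr (w *m w) <= eta * (G1 ^+ 2 * n%:R) by rewrite ler_pM2l.
  rewrite /g; lra.
have [s0' Ss0'] := S_ne.
pose B : set RR := [set h u | u in S]%classic.
have [||_ [u Su <-] hu] := @near_inf B (m - e / 4) (t ^+ 2) (h s0') _ _ (exprn_gt0 2 t0).
- by exists s0'.
- by move=> _ [u Su <-]; exact: hm.
have [pu u1 _] := pS Su.
have [w0 Ow0 hw0] := hadh u (t ^+ 2) Su (exprn_gt0 2 t0).
exists w0; split; first by case: Ow0.
move=> v Sv; have [pv v1 _] := pS Sv.
pose ut := (1 - t)%:C *: u + t%:C *: v.
have Sut : S ut by apply: cvxS => //; rewrite (ltW t0).
have hut : h u <= h ut + t ^+ 2 by apply: hu; exists ut.
have [wt Owt hwt] := hadh ut (t ^+ 2) Sut (exprn_gt0 2 t0).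
have e1 : g eta u wt = g eta ut wt + t * (rtr (v *m wt) - rtr (u *m wt)).
  rewrite /g /ut mulmxDl -!scalemxAl rtrD !rtrZ; ring.
have e2 := hub u wt Su Owt.
have /andP[e3 _] := Om_rtr pv v1 Owt; have /andP[_ e4] := Om_rtr pu u1 Owt.
have [Om' mid] := g_mid eta Su Ow0 Owt.
have e5 := hub u _ Su Om'.
set d := rtr ((wt - w0) *m (wt - w0)) in mid.
(* Since [u] nearly minimizes [h], the slope towards [v], taken at the near-maximizer of the moved
   point, is small. *)
have x1 : rtr (v *m wt) - rtr (u *m wt) <= 2 * t.
  rewrite -(ler_pM2l t0); move: hut hwt e1 e2; rewrite expr2; lra.
have tt : t ^+ 2 <= t by rewrite expr2 -[leRHS]mulr1 ler_pM2l.
have x2 : - (t * G1) <= t * (rtr (v *m wt) - rtr (u *m wt)).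
  by rewrite -mulrN ler_pM2l //; lra.
have x3 : d <= t * kap.
  rewrite /kap mulrA ler_pdivlMr //; lra.
have hw (w : 'M[CC]_n) : Om w -> adjm w = w by move=> [[/psdmx_herm]].
(* Transfers the slope estimate from [wt] to [w0], which was chosen before [v]. *)
have x4 := @rtr_young n (v - u) (w0 - wt) s.
rewrite adjmB (psdmx_herm pv) (psdmx_herm pu) adjmB (hw _ Ow0) (hw _ Owt) in x4.
have {}x4 := x4 erefl erefl s0.
have x5 := rtr_sqr_diff pu pv u1 v1.
have ed : rtr ((w0 - wt) *m (w0 - wt)) = d.
  by rewrite -opprB mulNmx mulmxN opprK.
have ex : rtr ((v - u) *m (w0 - wt)) =
    rtr (v *m w0) - rtr (v *m wt) - (rtr (u *m w0) - rtr (u *m wt)).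
  by rewrite mulmxBl !mulmxBr !rtrB.
rewrite ed ex in x4.
have x6 : s / 2 * rtr ((v - u) *m (v - u)) <= 2 * s.
  have : s / 2 * rtr ((v - u) *m (v - u)) <= s / 2 * 4 by rewrite ler_pM2l // divr_gt0.
  by move=> hh; apply: le_trans hh _; lra.
have x7 : (2 * s)^-1 * d <= e / 8.
  apply: le_trans t3; rewrite mulrC ler_pM2r // invr_gt0 mulr_gt0 //.
have x8 := hm u Su.
have /andP[x9 _] := Om_sqr Ow0; have x10 := mulr_ge0 (ltW eta0) x9.
have es : s = e / 16 by [].
move: hw0 x4 x6; rewrite /g; move: (rtr ((v - u) *m (v - u))) => z hw0 x4 x6.
lra.
Qed.

End ConvexSet.
End Minimax.

(** * Bounds on many copies *)

Section RegularizedBounds.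
Variables (RR : realType) (CC : complexLike RR).

Lemma pdmx_lb_tr n (s w : 'M[CC]_n) : psdmx s -> rtr s = 1 -> pdmx w -> 0 < rtr (s *m w).
Proof.
move=> ps s1 [_ [c c0 wc]]; apply: lt_le_trans c0 _.
by have := psd_rtrM_ge0 ps wc; rewrite mulmxBr rtrB mul_mx_scalar rtrZ s1 mulr1 subr_ge0.
Qed.

(** Each eigenvalue satisfies [d * (ln (d + c) - ln d) <= c], and the projections have total trace
    [n]. *)
Lemma tlog_perturb n (A : 'M[CC]_n) (c : RR) : psdmx A -> 0 < c ->
  tlog A (A + c%:C%:M) <= tlog A A + c * n%:R.
Proof.
move=> /psd_resol[d [E [rE -> d0]]] c0.
have -> : rsum d E + c%:C%:M = rsum (fun i => d i + c) E.
  rewrite scalarC -(rsum1 rE) /rsum scaler_sumr -big_split /=; apply: eq_bigr => i _.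
  by rewrite rmorph1 scale1r -scalerDl rmorphD.
rewrite !tlog_rsum // -(rtr1 CC) -(rsum1 rE) -[rsum (fun=> 1) E]mul1mx rtr_rsum.
rewrite mulr_sumr -big_split /=; apply: ler_sum => i _.
rewrite rsumE // rtrZ mul1mx mul1r.
have t0 : 0 <= rtr (E i) by apply/psd_rtr_ge0/resol_psd.
rewrite !mulrA -mulrDl ler_wpM2r //.
have [->|di] := eqVneq (d i) 0; first by rewrite !mulr0 add0r ltW.
have d1 : 0 < d i by rewrite lt_neqAle eq_sym di d0.
have := @ln_le_subr1 RR ((d i + c) / d i).
rewrite divr_gt0 ?addr_gt0 // => /(_ isT); rewrite ln_div ?posrE ?addr_gt0 // => h.
have e1 : (d i + c) / d i - 1 = c / d i by field.
rewrite e1 in h.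
have : d i * (ln (d i + c) - ln (d i)) <= c by rewrite mulrC -ler_pdivlMr.
lra.
Qed.

Definition eB (B : finType) (n : nat) := @encI n B.
Definition eBC (B C : finType) (n : nat) := encpair (@encI n B) (@encI n C).
Definition eBCR (B C R : finType) (n : nat) := encpair (@eBC B C n) (@encI n R).
Arguments eB : clear implicits.
Arguments eBC : clear implicits.
Arguments eBCR : clear implicits.

Lemma eBP (B : finType) n : encoding (eB B n). Proof. exact: encIP. Qed.
Lemma eBCP (B C : finType) n : encoding (eBC B C n). Proof. exact/encpairP/encIP/encIP. Qed.
Lemma eBCRP (B C R : finType) n : encoding (eBCR B C R n).
Proof. exact/encpairP/encIP/eBCP. Qed.

Implicit Types X K : finType.
Variables (B C R : finType).
Local Notation BCR := (((B * C) * R)%type : finType).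
Local Notation BC := ((B * C)%type : finType).
Local Notation BR := ((B * R)%type : finType).

Variable r : rop CC BCR BCR.
Hypotheses (pr : psdmx r) (r1 : rtr r = 1).

Definition tpB n := tpe (eBC B R n) (fun=> mBR r).
Definition tpr n := tpe (eBCR B C R n) (fun=> r).

Lemma tpr_psd n : psdmx (tpr n). Proof. exact: (tpe_psd (eBCRP B C R n) pr). Qed.

Lemma tpr_tr n : rtr (tpr n) = 1.
Proof.
rewrite rtr_tpe; [|exact: eBCRP|by move=> i; exact: psd_tr_ge0].
by rewrite r1 big1.
Qed.

Lemma mBR_tpr n : mBR (tpr n) = tpB n. Proof. exact: mBR_tpe. Qed.

Lemma mBR_psd : psdmx (mBR r). Proof. exact: compress_psd. Qed.

Lemma mBR_tr : rtr (mBR r) = 1. Proof. by rewrite rtr_compress //; exact: isofam_injC. Qed.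

Lemma ptr_tr X K (A : rop CC (X * K)%type (X * K)%type) : rtr (ptr A) = rtr A.
Proof. by rewrite -compress_inj rtr_compress //; exact: isofam_inj. Qed.

Lemma tpB_psd n : psdmx (tpB n). Proof. exact: (tpe_psd (eBCP B R n) mBR_psd). Qed.

Lemma ln_card_colour (K : finType) n :
  ln (#|{ffun K -> 'I_n.+1}|%:R : RR) = #|K|%:R * ln n.+1%:R.
Proof. by rewrite card_ffun card_ord natrX lnXn ?ltr0n // mulr_natl. Qed.

Lemma card_colour_gt0 (K : finType) n : (0 < #|{ffun K -> 'I_n.+1}|)%N.
Proof. by rewrite card_ffun card_ord expn_gt0. Qed.

(* [I(C:R|B)], since [tlog x x = - S(x)]. *)
Definition gcmi : RR :=
  tlog r r - tlog (ptr r) (ptr r) - tlog (mBR r) (mBR r) + tlog (ptr (mBR r)) (ptr (mBR r)).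

Lemma ptr_ptr : ptr (mBR r) = ptr (ptr r).
Proof.
apply: ropP => b b'; rewrite !rentE.
under eq_bigr => k _ do rewrite mBRE /=.
by rewrite exchange_big /=; apply: eq_bigr => c _; rewrite rentE.
Qed.

Lemma ptr_scalar X K (c : RR) :
  ptr (c%:C%:M : rop CC (X * K)%type (X * K)%type) = (#|K|%:R * c)%:C%:M.
Proof.
apply: ropP => x x'; rewrite rentE !scalarC rentZ rent1.
under eq_bigr => k _ do rewrite rentZ rent1 xpair_eqE eqxx andbT.
by rewrite sumr_const -[LHS]mulr_natl rmorphM rmorph_nat mulrA.
Qed.

Lemma ptrD X K (M N : rop CC (X * K)%type (X * K)%type) : ptr (M + N) = ptr M + ptr N.
Proof.
apply: ropP => x x'; rewrite rentD !rentE -big_split /=; apply: eq_bigr => k _.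
by rewrite rentD.
Qed.

Lemma pd_herm_resol n (A : 'M[CC]_n) : pdmx A ->
  exists (d : 'I_n -> RR) (E : 'I_n -> 'M[CC]_n),
    [/\ resol E, A = rsum d E & forall i, 0 < d i].
Proof.
move=> [pA [c c0 Ac]]; have [d [E [rE eA dE]]] := herm_resol (psdmx_herm pA).
by exists d, E; split=> // i; apply: lt_le_trans c0 _; apply: dE.
Qed.

(** Trace one rules out an empty system, where the trace is an empty sum. *)
Lemma card_nz : [/\ (0 < #|B|)%N, (0 < #|C|)%N & (0 < #|R|)%N].
Proof.
case: (pickP (fun _ : BCR => true)) => [p _|h]; last first.
  have e : \tr r = 0 by rewrite tr_rent big1 // => p _; have := h p.
  by move: r1; rewrite rtrE e re0 => /esym/eqP; rewrite oner_eq0.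
by split; apply/card_gt0P; [exists p.1.1 | exists p.1.2 | exists p.2].
Qed.

(* [ptr r] is perturbed by a multiple of the identity to become invertible, at the
   price of [e] per copy. *)
Lemma reg_upper (e : RR) : 0 < e -> forall n,
  exists L, [/\ is_chan L, psdmx (appid L (tpB n)), dominated (tpr n) (appid L (tpB n)) &
    tlog (tpr n) (tpr n) - tlog (tpr n) (appid L (tpB n)) <=
    n%:R * (gcmi + e) + (#|BC| + #|B|)%:R * ln n.+1%:R].
Proof.
move=> e0 n; have [B0 C0 R0] := card_nz.
have C0' : 0 < #|C|%:R :> RR by rewrite ltr0n.
have B0' : 0 < #|B|%:R :> RR by rewrite ltr0n.
(* The perturbation induced on [B] is [#|C| * c] times the identity, and [tlog_perturb] charges
   exactly [e] for it. *)
pose c := e / (#|C|%:R * #|B|%:R); have c0 : 0 < c by rewrite divr_gt0 ?mulr_gt0.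
pose t := ptr r + c%:C%:M.
have ppr : psdmx (ptr r) by exact: ptr_psd.
have pdt : pdmx t by exact: psd_add_pd.
have et : ptr t = ptr (mBR r) + (#|C|%:R * c)%:C%:M.
  by rewrite ptrD ptr_scalar ptr_ptr.
have pB : psdmx (ptr (mBR r)) by apply/ptr_psd/mBR_psd.
have pdt' : pdmx (ptr t) by rewrite et; apply: psd_add_pd => //; rewrite mulr_gt0.
have [d [E [rE eqt d0]]] := pd_herm_resol pdt.
have [d' [E' [rE' eqt' d0']]] := pd_herm_resol pdt'.
have [a [F [rF eF a0]]] := tpe_colour (eBCP B C n) rE d0.
have [b [F' [rF' eF' b0]]] := tpe_colour (eBP B n) rE' d0'.
have eab : ptr (rsum a F) = rsum b F'.
  by rewrite -eF -eF' -eqt -eqt'; apply: ptr_tpe; apply: encIP.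
have [L [cL pL dL hL]] := oneshot_upper rF rF' (card_colour_gt0 _ n) (card_colour_gt0 _ n)
  a0 b0 eab (tpr_psd n) (tpr_tr n).
rewrite mBR_tpr in pL dL hL.
exists L; split=> //; apply: le_trans hL _.
have -> : ptr (tpr n) = tpe (eBC B C n) (fun=> ptr r) by apply: ptr_tpe; apply: encIP.
have -> : ptr (tpB n) = tpe (eB B n) (fun=> ptr (mBR r)) by apply: ptr_tpe; apply: encIP.
rewrite -eF -eF' -eqt -eqt' !ln_card_colour !card_ord.
rewrite /tpr (tlog_tpe (eBCRP B C R n) pr r1 pr (fun v h => h)).
rewrite (tlog_tpe (eBCP B C n)) ?ptr_tr //; [|by case: pdt|exact: pdmx_dominated].
rewrite /tpB (tlog_tpe (eBCP B R n)) ?mBR_tr //; try exact: mBR_psd.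
rewrite (tlog_tpe (eBP B n)) ?ptr_tr ?mBR_tr //; [|by case: pdt'|exact: pdmx_dominated].
(* On [BC] the perturbation helps, by monotonicity; only the marginal on [B] pays. *)
have h1 : tlog (ptr r) (ptr r) <= tlog (ptr r) t.
  apply: tlog_le => //; first by case: pdt.
  by rewrite /t addrAC subrr add0r; apply/psd_scalar/ltW.
have h2 : tlog (ptr (mBR r)) (ptr t) <= tlog (ptr (mBR r)) (ptr (mBR r)) + e.
  rewrite et; apply: le_trans (tlog_perturb pB _) _; first by rewrite mulr_gt0.
  rewrite lerD2l [leLHS](_ : _ = e) //.
  by rewrite /c; field; rewrite !gt_eqF.
have n0 : 0 <= n%:R :> RR by rewrite ler0n.
have k1 := ler_wpM2l n0 h1; have k2 := ler_wpM2l n0 h2.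
rewrite natrD /gcmi; move: k1 k2; lra.
Qed.

(** Kraus operators of the completely depolarizing channel. *)
Definition constM (p : BC * B) : rop CC BC B :=
  (Num.sqrt (#|BC|%:R^-1))%:C *: ketbra CC p.1 p.2.

Lemma BC_gt0 : 0 < #|BC|%:R :> RR.
Proof. by have [B0 C0 _] := card_nz; rewrite ltr0n card_prod muln_gt0 B0. Qed.

Lemma constM_tp : \sum_p adjm (constM p) *m constM p = 1%:M.
Proof.
have s2 : Num.sqrt (#|BC|%:R^-1) * Num.sqrt (#|BC|%:R^-1) = #|BC|%:R^-1 :> RR.
  by rewrite -expr2 sqr_sqrtr // invr_ge0.
under eq_bigr => p _ do rewrite /constM adjmZr -scalemxAl -scalemxAr scalerA -rmorphM s2.
rewrite -scaler_sumr.
rewrite -(pair_bigA _ (fun y x => adjm (ketbra CC y x) *m ketbra CC y x)) /=.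
under eq_bigr => y _ do under eq_bigr => x _ do rewrite ketbra_gram.
under eq_bigr => y _ do rewrite sum_unitop.
rewrite sumr_const -[1%:M *+ _]scaler_nat scalerA -(rmorph_nat (@ofR _ CC)) -rmorphM.
by rewrite mulVf ?rmorph1 ?scale1r // gt_eqF // BC_gt0.
Qed.

Definition inj2 X K (x : X) : rop CC (X * K)%type K :=
  rmk (fun p k => (p == (x, k))%:R).

Lemma isofam_inj2 X K : isofam (fun x : X => @inj2 X K x).
Proof.
split=> [x y|].
  apply: ropP => k l; rewrite rent_mul.
  under eq_bigr => p _ do rewrite rent_adj !rentE /= rmorph_nat.
  rewrite sum_deltarl xpair_eqE -mulnb natrM.
  by case: (x == y); rewrite ?mul1r ?mul0r ?rent1 ?rent0.
apply: ropP => -[x k] [x' k']; rewrite rent_sum rent1.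
under eq_bigr => y _.
  rewrite rent_mul.
  under eq_bigr => j _ do rewrite rent_adj !rentE /= rmorph_nat !xpair_eqE -!mulnb !natrM mulrACA.
  rewrite -mulr_sumr sum_deltal.
  over.
rewrite -mulr_suml sum_deltal xpair_eqE -mulnb natrM.
by rewrite [x' == x]eq_sym [k' == k]eq_sym.
Qed.

Lemma kraus_const A : kraus constM A = (#|BC|%:R^-1)%:C *: (\tr A *: 1%:M).
Proof.
have s2 : Num.sqrt (#|BC|%:R^-1) * Num.sqrt (#|BC|%:R^-1) = #|BC|%:R^-1 :> RR.
  by rewrite -expr2 sqr_sqrtr // invr_ge0.
rewrite /kraus; under eq_bigr => p _ do
  rewrite /constM adjmZr -!scalemxAl -scalemxAr scalerA -rmorphM s2.
rewrite -scaler_sumr; congr (_ *: _).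
apply: ropP => y y'; rewrite rent_sum rentZ rent1 tr_rent mulr_suml sum_pair exchange_big /=.
apply: eq_bigr => x _.
have L1 z w : rent (ketbra CC z x *m A) y w = (y == z)%:R * rent A x w.
  rewrite rent_mul; under eq_bigr => v _ do rewrite rentE -mulnb natrM -mulrA.
  by rewrite -mulr_sumr sum_deltarl.
under eq_bigr => z _ do (rewrite rent_mul;
  under eq_bigr => w _ do rewrite L1 rent_adj rentE rmorph_nat -mulnb natrM mulrA;
  rewrite sum_deltar -mulrA).
by rewrite sum_deltal eq_sym.
Qed.

Lemma amplify_inj2 X K (A : rop CC K K) x k x' k' :
  rent (amplify (@inj2 X K) A) (x, k) (x', k') = (x == x')%:R * rent A k k'.
Proof.
have L1 y (j : K) : rent (@inj2 X K y) (x, k) j = (x == y)%:R * (k == j)%:R.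
  by rewrite rentE xpair_eqE -mulnb natrM.
have L2 y j : rent (adjm (@inj2 X K y)) j (x', k') = (k' == j)%:R * (x' == y)%:R.
  by rewrite rent_adj rentE rmorph_nat xpair_eqE -mulnb natrM mulrC.
have L3 y j : rent (@inj2 X K y *m A) (x, k) j = (x == y)%:R * rent A k j.
  rewrite rent_mul; under eq_bigr => i _ do rewrite L1 -mulrA.
  by rewrite -mulr_sumr sum_deltal.
rewrite rent_sum.
have L4 y : rent (@inj2 X K y *m A *m adjm (@inj2 X K y)) (x, k) (x', k')
    = (x == y)%:R * (rent A k k' * (x' == y)%:R).
  rewrite rent_mul; under eq_bigr => j _ do rewrite L3 L2 mulrCA.
  by rewrite sum_deltal mulrA.
under eq_bigr => y _ do rewrite L4.
by rewrite sum_deltal eq_sym mulrC.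
Qed.

Lemma compress_inj2 X K (A : rop CC (X * K)%type (X * K)%type) k k' :
  rent (compress (@inj2 X K) A) k k' = \sum_x rent A (x, k) (x, k').
Proof.
rewrite rent_sum; apply: eq_bigr => x _.
rewrite rent_mul; under eq_bigr => p _ do rewrite [rent (inj2 _ _) _ _]rentE.
rewrite sum_deltar rent_mul.
under eq_bigr => p _ do rewrite rent_adj rentE rmorph_nat.
by rewrite sum_deltarl.
Qed.

Lemma appid_const : appid (kraus constM) (mBR r) =
  (#|BC|%:R^-1)%:C *: amplify (@inj2 BC R) (compress (@inj2 BC R) r).
Proof.
apply: ropP => -[y k] [y' k']; rewrite rentE kraus_const !rentZ rent1 tr_rent.
congr (_ * _); rewrite amplify_inj2 compress_inj2 mulrC; congr (_ * _).
rewrite sum_pair; apply: eq_bigr => b _.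
by rewrite rentE mBRE.
Qed.

(** The depolarized state is [id (x) r_R] divided by [#|BC|], and the pinching inequality gives
    [r <= #|BC| id (x) r_R]; hence the square. *)
Lemma const_dominates : psdmx ((#|BC|%:R ^+ 2)%:C *: appid (kraus constM) (mBR r) - r).
Proof.
rewrite appid_const scalerA -rmorphM.
have -> : #|BC|%:R ^+ 2 * #|BC|%:R^-1 = #|BC|%:R :> RR.
  by rewrite expr2 mulfK // gt_eqF // BC_gt0.
by apply: lem_amplify => //; exact: isofam_inj2.
Qed.

Lemma chan_mix X Y (L1 L2 : rop CC X X -> rop CC Y Y) (a : RR) :
  is_chan L1 -> is_chan L2 -> 0 <= a <= 1 ->
  exists L, is_chan L /\ forall K (T : rop CC (X * K)%type (X * K)%type),
    appid L T = (1 - a)%:C *: appid L1 T + a%:C *: appid L2 T.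
Proof.
move=> /chan_kraus[I1 [M1 [-> s1]]] /chan_kraus[I2 [M2 [-> s2]]] /andP[a0 a1].
have b0 : 0 <= 1 - a by rewrite subr_ge0.
pose M (i : I1 + I2) : rop CC Y X := match i with
  | inl i => (Num.sqrt (1 - a))%:C *: M1 i
  | inr i => (Num.sqrt a)%:C *: M2 i end.
have sq (c : RR) : 0 <= c -> (Num.sqrt c)%:C * (Num.sqrt c)%:C = c%:C :> CC.
  by move=> c0; rewrite -rmorphM -expr2 sqr_sqrtr.
exists (kraus M); split.
  apply: kraus_chan; rewrite big_sumType /=.
  under eq_bigr => i _ do rewrite adjmZr -scalemxAl -scalemxAr scalerA sq //.
  under [X in _ + X]eq_bigr => i _ do rewrite adjmZr -scalemxAl -scalemxAr scalerA sq //.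
  by rewrite -!scaler_sumr s1 s2 -scalerDl -rmorphD subrK rmorph1 scale1r.
move=> K T; rewrite !appid_kraus big_sumType /= !scaler_sumr; congr (_ + _).
  apply: eq_bigr => i _.
  by rewrite tensidZ adjmZr -!scalemxAl -scalemxAr scalerA sq.
apply: eq_bigr => i _.
by rewrite tensidZ adjmZr -!scalemxAl -scalemxAr scalerA sq.
Qed.

(** [is_chan] speaks of ancillas ['I_k] only; the Kraus form extends positivity to any reference
    system. *)
Lemma chan_appid_psd X Y K (L : rop CC X X -> rop CC Y Y)
    (T : rop CC (X * K)%type (X * K)%type) :
  is_chan L -> psdmx T -> psdmx (appid L T).
Proof. by move=> /chan_kraus[I [M [-> _]]]; apply: appid_kraus_psd. Qed.

Lemma chan_appid_rtr X Y K (L : rop CC X X -> rop CC Y Y)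
    (T : rop CC (X * K)%type (X * K)%type) :
  is_chan L -> rtr (appid L T) = rtr T.
Proof. by move=> cL; rewrite !rtrE chan_appid_tr. Qed.

Lemma const_chan : is_chan (kraus constM).
Proof. by apply: kraus_chan; exact: constM_tp. Qed.

Section Lower.
Variables (m e : RR).
Hypothesis e0 : 0 < e.
(** Asked only where the channel output dominates [r] up to a constant, so that every measured value
    is a finite sum [cdiv]. *)
Hypothesis Hm : forall L (G e' : RR), is_chan L -> 0 < G ->
  psdmx (G%:C *: appid L (mBR r) - r) -> 0 < e' ->
  exists k (M : 'I_k -> 'M[CC]_#|BCR|), gpovm M /\ m - e' <= cdiv M r (appid L (mBR r)).

(** Weight of the depolarizing channel, chosen so that [1 / (1 - dl) = 1 + e]. *)
Let dl := e / (1 + e).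

Lemma dl01 : 0 < dl < 1.
Proof.
have q : 0 < 1 + e by rewrite addr_gt0.
by rewrite divr_gt0 //= ltr_pdivrMr // mul1r ltrDr.
Qed.

(* Mixing every channel with the completely depolarizing one makes all candidates
   dominate [r] up to a common factor, as the minimax argument requires. *)
Lemma recovery_witness : exists w : 'M[CC]_#|BCR|, pdmx w /\ forall L, is_chan L ->
  (1 - dl) * rtr (appid L (mBR r) *m w) <= tlog r w + 1 - m + e.
Proof.
have /andP[d0 d1] := dl01.
pose s0 := appid (kraus constM) (mBR r).
pose mix t := (1 - dl)%:C *: t + dl%:C *: s0.
pose S t := exists L, is_chan L /\ t = mix (appid L (mBR r)).
have d01 : 0 <= dl <= 1 by rewrite !ltW.
have ps0 : psdmx s0 by apply: chan_appid_psd; [exact: const_chan | exact: mBR_psd].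
have Sch t : S t -> exists2 L, is_chan L & t = appid L (mBR r).
  move=> [L [cL ->]]; have [L' [cL' eL']] := chan_mix cL const_chan d01.
  by exists L'; rewrite // eL'.
(* With this constant the depolarized share alone dominates [r]. *)
pose G := #|BC|%:R ^+ 2 / dl.
have G0 : 0 < G by rewrite divr_gt0 // exprn_gt0 // BC_gt0.
have SG t : S t -> psdmx (G%:C *: t - r).
  move=> [L [cL ->]]; rewrite /mix scalerDr -addrA; apply: psdmxD.
    rewrite scalerA -rmorphM; apply: psdmxZ.
      by rewrite mulr_ge0 ?subr_ge0 // ltW.
    by apply: chan_appid_psd => //; exact: mBR_psd.
  rewrite scalerA -rmorphM /G divfK ?gt_eqF //; exact: const_dominates.
have [||||w [pw hw]] := @minimax _ CC _ r S G m pr r1 G0 _ _ _ _ e e0.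
- by exists (mix s0), (kraus constM); split=> //; exact: const_chan.
- move=> t St; split; last exact: SG.
    by have [L cL ->] := Sch t St; apply: chan_appid_psd => //; exact: mBR_psd.
  by have [L cL ->] := Sch t St; rewrite chan_appid_rtr // mBR_tr.
- move=> t u a [L1 [c1 ->]] [L2 [c2 ->]] a01.
  have [L [cL eL]] := chan_mix c1 c2 a01; exists L; split=> //.
  have gen (A1 A2 A3 : 'M[CC]_#|BCR|) :
      (1 - a)%:C *: ((1 - dl)%:C *: A1 + dl%:C *: A3)
      + a%:C *: ((1 - dl)%:C *: A2 + dl%:C *: A3)
      = (1 - dl)%:C *: ((1 - a)%:C *: A1 + a%:C *: A2) + dl%:C *: A3.
    by apply/matrixP => i j; rewrite !mxE !(rmorphB, rmorph1) /=; ring.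
  by rewrite /mix eL; exact: gen.
- move=> t e' St e'0; have [L cL et] := Sch t St.
  by rewrite et; apply: (Hm cL G0) => //; rewrite -et; apply: SG.
exists w; split=> // L cL.
have := hw (mix (appid L (mBR r))); rewrite /mix mulmxDl -!scalemxAl rtrD !rtrZ.
move=> /(_ (ex_intro _ L (conj cL erefl))).
have [pw' _] := pw.
have h : 0 <= dl * rtr (s0 *m w) by rewrite mulr_ge0 ?psd_rtrM_ge0 // ltW.
lra.
Qed.

(* The dual certificate of a single copy is multiplicative under tensor powers, so it
   bounds the witness over all channels on [n] copies. *)
Lemma reg_lower n L : is_chan L -> dominated (tpr n) (appid L (tpB n)) ->
  n%:R * (m - 3 * e) - #|BCR|%:R * ln n.+1%:R <=
  tlog (tpr n) (tpr n) - tlog (tpr n) (appid L (tpB n)).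
Proof.
move=> cL dL; have [w [pw hw]] := recovery_witness.
have [pw' _] := pw; have /andP[d0 d1] := dl01.
have [B0 C0 R0] := card_nz.
have Y0 : (0 < #|BC|)%N by rewrite card_prod muln_gt0 B0.
have q0 : 0 < 1 - dl by rewrite subr_gt0.
pose x := tlog r w + 1 - m + e.
have x0 : 0 < x.
  apply: lt_le_trans (hw _ const_chan); rewrite mulr_gt0 // pdmx_lb_tr //.
    by apply: chan_appid_psd; [exact: const_chan | exact: mBR_psd].
  by rewrite chan_appid_rtr ?mBR_tr //; exact: const_chan.
have c0 : 0 <= x / (1 - dl) by rewrite divr_ge0 ?ltW.
have [|Z [pZ tZ hZ]] := dual_certificate_pd mBR_psd pw' Y0 e0 c0.
  move=> J N sN; rewrite -rtr_appid ler_pdivlMr // mulrC.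
  by apply: hw; apply: kraus_chan.
have [I [M [eL sM]]] := chan_kraus cL.
pose wn := tpe (eBCR B C R n) (fun=> w).
have hk : rtr (appid L (tpB n) *m wn) <= rtr Z ^+ n.
  rewrite eL rtr_appid.
  have hk' := kform_tpe (encIP n B) (eBCP B C n) (encIP n R) mBR_psd pw' Y0 pZ hZ sM.
  exact: hk'.
have [d [E [rE ew d0']]] := pd_herm_resol pw.
have [a [F [rF eF a0]]] := tpe_colour (eBCRP B C R n) rE d0'.
have ewn : wn = rsum a F by rewrite -eF -ew.
have ps : psdmx (appid L (tpB n)) by apply: chan_appid_psd => //; exact: tpB_psd.
have := oneshot_lower rF (card_colour_gt0 _ n) a0 (tpr_psd n) (tpr_tr n) ps dL.
rewrite -ewn ln_card_colour card_ord /wn.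
rewrite [tlog (tpr n) (tpe _ _)](tlog_tpe (eBCRP B C R n) pr r1 pw'); last exact: pdmx_dominated.
rewrite -/wn; apply: le_trans.
have w0 : 0 < rtr (appid L (tpB n) *m wn).
  apply: pdmx_lb_tr => //; last by rewrite ewn; apply: rsum_pd.
  rewrite chan_appid_rtr // rtr_tpe; [|exact: eBCP|by move=> i; apply/psd_tr_ge0/mBR_psd].
  by rewrite mBR_tr big1.
have tZ0 : 0 < rtr Z.
  have [_ [c cp Zc]] := pZ; have := psd_rtr_ge0 Zc.
  rewrite rtrB scalarC rtrZ rtr1 subr_ge0; apply: lt_le_trans.
  by rewrite mulr_gt0 // ltr0n.
have l1 : ln (rtr (appid L (tpB n) *m wn)) <= n%:R * ln (rtr Z).
  by rewrite mulr_natl -lnXn // ler_ln ?posrE // exprn_gt0.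
(* [ln y <= y - 1] cancels the [1] in [x], undoing the linearization. The mixing factor [1 + e], the
   slack of the witness and that of the dual certificate cost at most [e] each. *)
have l2 : ln (rtr Z) <= tlog r w - m + 3 * e.
  have e1 : 0 < 1 + e by rewrite addr_gt0.
  have eq1 : x / (1 - dl) + e = (1 + e) * (x + e / (1 + e)).
    by rewrite /dl; field; rewrite !gt_eqF // addrK.
  have y0 : 0 < x + e / (1 + e) by rewrite addr_gt0 // divr_gt0.
  apply: (@le_trans _ _ (ln ((1 + e) * (x + e / (1 + e))))).
    by rewrite ler_ln ?posrE ?mulr_gt0 // -eq1.
  rewrite lnM ?posrE //.
  have k1 := ln_le_subr1 e1; have k2 := ln_le_subr1 y0.
  have k3 : e / (1 + e) <= e by rewrite ler_pdivrMr // mulrDr mulr1 lerDl mulr_ge0 // ltW.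
  move: k1 k2; rewrite /x; lra.
have n0 : 0 <= n%:R :> RR by rewrite ler0n.
have l3 := ler_wpM2l n0 l2.
rewrite lerD2r; move: l1 l3; lra.
Qed.

End Lower.
End RegularizedBounds.

(** * Subadditivity and the regularized limit *)

Section BinaryTensor.
Variables (RR : realType) (CC : complexLike RR).

(** Splits an index of [n + m] copies into its two parts while [B], [C] and [R] stay grouped by
    system. *)
Definition pairing (T T1 T2 : finType) (u : T -> T1) (v : T -> T2) :=
  bijective (fun t => (u t, v t)).

Definition bt (T T1 T2 S S1 S2 : finType) (u : T -> T1) (v : T -> T2)
    (u' : S -> S1) (v' : S -> S2) (A : rop CC T1 S1) (A' : rop CC T2 S2) : rop CC T S :=
  rmk (fun p q => rent A (u p) (u' q) * rent A' (v p) (v' q)).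

Section Codes.
Variables (T T1 T2 : finType) (u : T -> T1) (v : T -> T2).
Hypothesis uv : pairing u v.

Lemma pairing_sum (F : T1 -> CC) (G : T2 -> CC) :
  \sum_t F (u t) * G (v t) = (\sum_x F x) * (\sum_y G y).
Proof.
have -> : (\sum_x F x) * (\sum_y G y) = \sum_p F p.1 * G p.2.
  by rewrite big_distrlr /= (sum_pair (fun p => F p.1 * G p.2)).
rewrite [RHS](reindex (fun t => (u t, v t))) //=.
by case: uv => g gK Kg; exists g => ? _; [exact: gK | exact: Kg].
Qed.

Lemma pairing_eq t t' : (t == t') = (u t == u t') && (v t == v t').
Proof.
apply/eqP/andP => [->//|[/eqP e1 /eqP e2]]; apply: (bij_inj uv).
by rewrite e1 e2.
Qed.

Lemma btM (S S1 S2 P P1 P2 : finType) (a : S -> S1) (a' : S -> S2)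
    (b : P -> P1) (b' : P -> P2)
    (A : rop CC S1 T1) (A' : rop CC S2 T2) (B : rop CC T1 P1) (B' : rop CC T2 P2) :
  bt a a' u v A A' *m bt u v b b' B B' = bt a a' b b' (A *m B) (A' *m B').
Proof.
apply: ropP => p q; rewrite rent_mul rentE !rent_mul.
rewrite -(pairing_sum (fun x => rent A (a p) x * rent B x (b q))
                      (fun x => rent A' (a' p) x * rent B' x (b' q))).
by apply: eq_bigr => t _; rewrite !rentE mulrACA.
Qed.

Lemma bt1 : bt u v u v 1%:M 1%:M = 1%:M.
Proof.
by apply: ropP => p q; rewrite rentE !rent1 pairing_eq -natrM mulnb.
Qed.

Lemma rtr_bt (A : rop CC T1 T1) (A' : rop CC T2 T2) : 0 <= \tr A -> 0 <= \tr A' ->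
  rtr (bt u v u v A A') = rtr A * rtr A'.
Proof.
move=> a0 a0'; rewrite -(reK CC (_ * _)) rmorphM !rtrE !re_ge0K // !tr_rent.
by rewrite -pairing_sum; congr re; apply: eq_bigr => t _; rewrite rentE.
Qed.
End Codes.

Lemma bt_adj (T T1 T2 S S1 S2 : finType) (u : T -> T1) (v : T -> T2)
    (u' : S -> S1) (v' : S -> S2) (A : rop CC T1 S1) (A' : rop CC T2 S2) :
  adjm (bt u v u' v' A A') = bt u' v' u v (adjm A) (adjm A').
Proof. by apply: ropP => p q; rewrite rent_adj !rentE !rent_adj rmorphM. Qed.

Lemma bt_sum (T T1 T2 S S1 S2 I J : finType) (u : T -> T1) (v : T -> T2)
    (u' : S -> S1) (v' : S -> S2) (A : I -> rop CC T1 S1) (A' : J -> rop CC T2 S2) :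
  bt u v u' v' (\sum_i A i) (\sum_j A' j) = \sum_p bt u v u' v' (A p.1) (A' p.2).
Proof.
apply: ropP => p q; rewrite rentE !rent_sum big_distrlr /=.
rewrite (sum_pair (fun k => rent (bt u v u' v' (A k.1) (A' k.2)) p q)) /=.
by apply: eq_bigr => i _; apply: eq_bigr => j _; rewrite rentE.
Qed.

Lemma btZ (T T1 T2 S S1 S2 : finType) (u : T -> T1) (v : T -> T2)
    (u' : S -> S1) (v' : S -> S2) (A : rop CC T1 S1) (A' : rop CC T2 S2) (a a' : CC) :
  bt u v u' v' (a *: A) (a' *: A') = (a * a') *: bt u v u' v' A A'.
Proof. by apply: ropP => p q; rewrite rentZ !rentE !rentZ mulrACA. Qed.

Lemma bt0l (T T1 T2 S S1 S2 : finType) (u : T -> T1) (v : T -> T2)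
    (u' : S -> S1) (v' : S -> S2) (A' : rop CC T2 S2) : bt u v u' v' 0 A' = 0.
Proof. by apply: ropP => p q; rewrite rentE !rent0 mul0r. Qed.

Lemma bt0r (T T1 T2 S S1 S2 : finType) (u : T -> T1) (v : T -> T2)
    (u' : S -> S1) (v' : S -> S2) (A : rop CC T1 S1) : bt u v u' v' A 0 = 0.
Proof. by apply: ropP => p q; rewrite rentE !rent0 mulr0. Qed.

Section Spectral.
Variables (T T1 T2 : finType) (u : T -> T1) (v : T -> T2).
Hypothesis uv : pairing u v.
Local Notation bt := (bt u v u v).

Lemma bt_resol (I J : finType) (E : I -> rop CC T1 T1) (F : J -> rop CC T2 T2) :
  resol E -> resol F -> resol (fun p => bt (E p.1) (F p.2)).
Proof.
move=> [hE hEE sE] [hF hFF sF]; split=> [[i j]|[i j] [k l]|].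
- by rewrite bt_adj hE hF.
- rewrite (btM uv) hEE hFF /= xpair_eqE; case: eqP => [->|_]; last exact: bt0l.
  by case: eqP => [->|_] //; exact: bt0r.
- by rewrite -bt_sum sE sF (bt1 uv).
Qed.

Lemma bt_rsum (I J : finType) (d : I -> RR) (E : I -> rop CC T1 T1)
    (e : J -> RR) (F : J -> rop CC T2 T2) :
  bt (rsum d E) (rsum e F) = rsum (fun p => d p.1 * e p.2) (fun p => bt (E p.1) (F p.2)).
Proof.
by rewrite /rsum bt_sum; apply: eq_bigr => p _; rewrite btZ rmorphM.
Qed.

Lemma bt_dominated (r s : rop CC T1 T1) (r' s' : rop CC T2 T2) :
  psdmx s -> psdmx s' -> dominated r s -> dominated r' s' ->
  dominated (bt r r') (bt s s').
Proof.
move=> /psd_resol[d [E [rE -> _]]] /psd_resol[e [F [rF -> _]]] dr dr' w.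
rewrite bt_rsum => w0.
have rG := bt_resol rE rF.
rewrite -[bt r r']mul1mx; case: (rG) => _ _ <-.
rewrite mulmx_suml mulmx_sumr big1 // => p _.
have := congr1 (fun x => x *m bt (E p.1) (F p.2)) w0.
rewrite /= mul0mx -mulmxA (rsumE _ _ rG) -scalemxAr => /eqP.
rewrite scaler_eq0 => /orP[|/eqP wp]; last by rewrite mulmxA wp mul0mx.
rewrite rmorphM mulf_eq0 !fmorph_eq0 => /orP[] /eqP h.
  by rewrite (btM uv) (dominated_resol rE dr h) bt0l mulmx0.
by rewrite (btM uv) (dominated_resol rF dr' h) bt0r mulmx0.
Qed.

Lemma tlog_bt (r s : rop CC T1 T1) (r' s' : rop CC T2 T2) :
  psdmx r -> psdmx r' -> rtr r = 1 -> rtr r' = 1 -> psdmx s -> psdmx s' ->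
  dominated r s -> dominated r' s' ->
  tlog (bt r r') (bt s s') = tlog r s + tlog r' s'.
Proof.
move=> pr pr' r1 r1' /psd_resol[d [E [rE -> d0]]] /psd_resol[e [F [rF -> e0]]] dr dr'.
rewrite bt_rsum !tlog_rsum //; last exact: bt_resol.
have tE : \sum_i rtr (r *m E i) = 1.
  by rewrite -rtr_sum -mulmx_sumr; case: rE => _ _ ->; rewrite mulmx1.
have tF : \sum_j rtr (r' *m F j) = 1.
  by rewrite -rtr_sum -mulmx_sumr; case: rF => _ _ ->; rewrite mulmx1.
rewrite -[X in _ = X + _]mulr1 -tF -[X in _ = _ + X]mul1r -tE !big_distrlr /=.
rewrite -big_split /= -(pair_bigA _ (fun i j => ln (d i * e j) *
   rtr (bt r r' *m bt (E i) (F j)))) /=; apply: eq_bigr => i _.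
rewrite -big_split /=; apply: eq_bigr => j _.
rewrite (btM uv) (rtr_bt uv); first last.
- exact/psd_trM_ge0/(resol_psd _ rF).
- exact/psd_trM_ge0/(resol_psd _ rE).
have [di|di] := eqVneq (d i) 0.
  by rewrite (dominated_rtr rE dr di); ring.
have [ej|ej] := eqVneq (e j) 0.
  by rewrite (dominated_rtr rF dr' ej); ring.
rewrite lnM ?posrE ?lt_neqAle ?d0 ?e0 ?(eq_sym 0) ?di ?ej //; ring.
Qed.
End Spectral.

Definition pairc (T1 T2 S1 S2 : finType) (u : T1 -> S1) (v : T2 -> S2) (p : T1 * T2) :=
  (u p.1, v p.2).

Lemma pairingX (T1 T2 S1 S2 P1 P2 : finType) (u : T1 -> S1) (v : T1 -> S2)
    (a : T2 -> P1) (b : T2 -> P2) :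
  pairing u v -> pairing a b -> pairing (pairc u a) (pairc v b).
Proof.
move=> [f fK Kf] [g gK Kg].
exists (fun q : (S1 * P1) * (S2 * P2) => (f (q.1.1, q.2.1), g (q.1.2, q.2.2))).
  by case=> x y; rewrite /pairc /= (fK x) (gK y).
case=> [[x1 y1] [x2 y2]]; rewrite /pairc /=.
have := Kf (x1, x2); have := Kg (y1, y2).
by move=> [-> ->] [-> ->].
Qed.

Section BinaryChannel.
Variables (X X1 X2 Y Y1 Y2 K K1 K2 : finType).
Variables (x1 : X -> X1) (x2 : X -> X2) (y1 : Y -> Y1) (y2 : Y -> Y2)
  (k1 : K -> K1) (k2 : K -> K2).
Hypotheses (hx : pairing x1 x2) (hy : pairing y1 y2) (hk : pairing k1 k2).

Lemma tensid_bt (M : rop CC Y1 X1) (N : rop CC Y2 X2) :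
  tensid K (bt y1 y2 x1 x2 M N) =
  bt (pairc y1 k1) (pairc y2 k2) (pairc x1 k1) (pairc x2 k2) (tensid K1 M) (tensid K2 N).
Proof.
apply: ropP => p q; rewrite !rentE /= (pairing_eq hk) mulrACA.
by rewrite -mulnb natrM.
Qed.

Lemma chan_bt L1 L2 : is_chan L1 -> is_chan L2 ->
  exists L : rop CC X X -> rop CC Y Y, is_chan L /\
   forall (A1 : rop CC (X1 * K1)%type (X1 * K1)%type) (A2 : rop CC (X2 * K2)%type (X2 * K2)%type),
   appid L (bt (pairc x1 k1) (pairc x2 k2) (pairc x1 k1) (pairc x2 k2) A1 A2) =
   bt (pairc y1 k1) (pairc y2 k2) (pairc y1 k1) (pairc y2 k2)
     (appid (L1 : rop CC X1 X1 -> rop CC Y1 Y1) A1)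
     (appid (L2 : rop CC X2 X2 -> rop CC Y2 Y2) A2).
Proof.
move=> /chan_kraus[I [M [-> sM]]] /chan_kraus[J [N [-> sN]]].
exists (kraus (fun p : I * J => bt y1 y2 x1 x2 (M p.1) (N p.2))); split.
  apply: kraus_chan; under eq_bigr => p _ do rewrite bt_adj (btM hy).
  rewrite -(bt_sum x1 x2 x1 x2 (fun i => adjm (M i) *m M i) (fun j => adjm (N j) *m N j)).
  by rewrite sM sN (bt1 hx).
move=> A1 A2; rewrite !appid_kraus bt_sum; apply: eq_bigr => p _.
have hxk := pairingX hx hk.
by rewrite tensid_bt bt_adj !(btM hxk).
Qed.
End BinaryChannel.

Section Splitting.
Variables (n m : nat).

Definition lft (X : finType) (f : {ffun 'I_(n + m) -> X}) : {ffun 'I_n -> X} :=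
  [ffun i => f (lshift m i)].
Definition rgt (X : finType) (f : {ffun 'I_(n + m) -> X}) : {ffun 'I_m -> X} :=
  [ffun i => f (rshift n i)].

Lemma lft_rgt (X : finType) : pairing (@lft X) (@rgt X).
Proof.
exists (fun p : {ffun 'I_n -> X} * {ffun 'I_m -> X} =>
  [ffun i : 'I_(n + m) => match fintype.split i with inl j => p.1 j | inr j => p.2 j end]).
  move=> f; apply/ffunP => i; rewrite ffunE /=.
  by case: splitP => j ij; rewrite ffunE; congr (f _); apply: val_inj.
case=> f g; congr pair; apply/ffunP => i; rewrite !ffunE.
  by rewrite (unsplitK (inl i)).
by rewrite (unsplitK (inr i)).
Qed.

Lemma tpe_split (T T1 T2 X : finType) (e : T -> 'I_(n + m) -> X) (e1 : T1 -> 'I_n -> X)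
    (e2 : T2 -> 'I_m -> X) (u : T -> T1) (v : T -> T2) (A : rop CC X X) :
  (forall t i, e1 (u t) i = e t (lshift m i)) ->
  (forall t i, e2 (v t) i = e t (rshift n i)) ->
  tpe e (fun=> A) = bt u v u v (tpe e1 (fun=> A)) (tpe e2 (fun=> A)).
Proof.
move=> h1 h2; apply: ropP => p q; rewrite !rentE big_split_ord /=.
by congr (_ * _); apply: eq_bigr => i _; rewrite ?h1 ?h2.
Qed.
End Splitting.

Section Subadditive.
Variables (B C R : finType).
Local Notation BCR := (((B * C) * R)%type : finType).
Variable r : rop CC BCR BCR.
Hypotheses (pr : psdmx r) (r1 : rtr r = 1).

(** Only the finite values are collected, so that infima are taken in the reals; all other channels
    contribute [+oo]. *)
Definition recover n (x : RR) := exists L, [/\ is_chan L,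
  dominated (tpr r n) (appid L (tpB r n)) &
  x = tlog (tpr r n) (tpr r n) - tlog (tpr r n) (appid L (tpB r n))].

(** The product of two recovery channels is one on the joint copies, and both logarithmic terms are
    additive. *)
Lemma recoverD n m x y : recover n x -> recover m y -> recover (n + m) (x + y).
Proof.
move=> [L1 [c1 d1 ->]] [L2 [c2 d2 ->]].
pose lB := @lft n m B; pose rB := @rgt n m B.
pose lC := @lft n m C; pose rC := @rgt n m C.
pose lR := @lft n m R; pose rR := @rgt n m R.
have hB : pairing lB rB := lft_rgt n m B.
have hC : pairing lC rC := lft_rgt n m C.
have hR : pairing lR rR := lft_rgt n m R.
have hBC := pairingX hB hC; have hBCR := pairingX hBC hR.
have [L [cL eL]] := chan_bt hB hBC hR c1 c2.
have er : tpr r (n + m) = bt (pairc (pairc lB lC) lR) (pairc (pairc rB rC) rR)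
    (pairc (pairc lB lC) lR) (pairc (pairc rB rC) rR) (tpr r n) (tpr r m).
  by apply: tpe_split => -[[f g] h] i; rewrite /eBCR /eBC /encpair /encI /= !ffunE.
have eb : tpB r (n + m) = bt (pairc lB lR) (pairc rB rR) (pairc lB lR) (pairc rB rR)
    (tpB r n) (tpB r m).
  by apply: tpe_split => -[f g] i; rewrite /eBC /encpair /encI /= !ffunE.
have p1 : psdmx (appid L1 (tpB r n)) by apply: chan_appid_psd => //; exact: tpB_psd.
have p2 : psdmx (appid L2 (tpB r m)) by apply: chan_appid_psd => //; exact: tpB_psd.
have q1 := tpr_psd pr n; have q2 := tpr_psd pr m.
have t1 := tpr_tr pr r1 n; have t2 := tpr_tr pr r1 m.
exists L; split => //.
  by rewrite er eb eL; apply: bt_dominated.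
have D1 : dominated (tpr r n) (tpr r n) by move=> v.
have D2 : dominated (tpr r m) (tpr r m) by move=> v.
rewrite er eb eL !(tlog_bt hBCR) //; ring.
Qed.

Lemma recover_ge0 n x : recover n x -> 0 <= x.
Proof.
move=> [L [cL dL ->]].
have pL : psdmx (appid L (tpB r n)) by apply: chan_appid_psd => //; exact: tpB_psd.
have tB : rtr (tpB r n) = 1.
  rewrite rtr_tpe; [|exact: eBCP|by move=> i; apply/psd_tr_ge0/mBR_psd].
  by rewrite mBR_tr // big1.
have [_] := gibbs (tpr_psd pr n) (tpr_tr pr r1 n) pL dL.
by rewrite chan_appid_rtr // tB ln1 oppr0.
Qed.

Lemma recover_ne n : exists x, recover n x.
Proof.
have [L [cL _ dL _]] := reg_upper pr r1 ltr01 n.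
by eexists; exists L; split; [exact: cL | exact: dL | reflexivity].
Qed.
End Subadditive.
End BinaryTensor.

Import numFieldNormedType.Exports.
Local Open Scope classical_set_scope.

(** * Subadditive sequences and their growth rates *)

Section Subadditivity.
Variable RR : realType.

(** Tangent line of [ln] at [1 / e]: logarithmic errors are absorbed into an arbitrarily small slope
    and a constant. *)
Lemma ln_affine (e : RR) : 0 < e -> forall n, ln n.+1%:R <= n%:R * e + (e - 1 - ln e).
Proof.
move=> e0 n; have n0 : 0 < n.+1%:R :> RR by rewrite ltr0n.
have := ln_le_subr1 (mulr_gt0 e0 n0); rewrite lnM ?posrE // -natr1.
set x := ln e; set y := ln _; lra.
Qed.

(** Division of [n] by a nearly optimal block length [N]; the remainder costs at most the constant
    [K]. *)
Lemma fekete (a : nat -> RR) : (forall n, 0 <= a n) ->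
  (forall n m, a (n + m)%N <= a n + a m) ->
  exists l : RR, (fun n => a n / n%:R) @ \oo --> l.
Proof.
move=> a0 aD.
pose A := [set x | exists n : nat, x = a n.+1 / n.+1%:R].
have lbA : lbound A 0 by move=> _ [n ->]; rewrite divr_ge0.
have infA : has_inf A by split; [exists (a 1%N / 1%:R), 0%N | exists 0].
exists (inf A); apply/cvgrPdist_le => e e0.
have e2 : 0 < e / 2 by rewrite divr_gt0.
have [_ [N0 ->]] := inf_adherent e2 infA; set N := N0.+1 => hN.
pose K := \sum_(i < N) a i.
(* The case [q = 0] leaves the term [a 0], which may be positive. *)
have aq q : a (q * N)%N <= q%:R * a N + a 0%N.
  elim: q => [|q IH]; first by rewrite mul0n mul0r add0r.
  rewrite mulSn; have := aD N (q * N)%N; rewrite -natr1; lra.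
have aK s : (s < N)%N -> a s <= K.
  by move=> sN; rewrite /K (bigD1 (Ordinal sN)) //= lerDl sumr_ge0.
near=> n.
have n0 : (0 < n)%N by near: n; exact: nbhs_infty_gt.
have n0' : 0 < n%:R :> RR by rewrite ltr0n.
have hK : (K + a 0%N) / (e / 2) <= n%:R by near: n; exact: nbhs_infty_ger.
have lb : inf A <= a n / n%:R.
  by apply: inf_lbound; [exact: infA.2 | exists n.-1; rewrite prednK].
rewrite ler_distlC lerBlDr; apply/andP; split.
  by apply: (le_trans lb); rewrite lerDl ltW.
rewrite ler_pdivrMr //.
have := aD (n %/ N * N)%N (n %% N)%N; rewrite -divn_eq => h.
have h2 := aq (n %/ N)%N; have h3 := aK _ (ltn_pmod n (isT : (0 < N)%N)).
have h4 : (n %/ N)%:R * a N <= (inf A + e / 2) * n%:R.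
  have e1 : a N = a N / N%:R * N%:R by rewrite divfK // pnatr_eq0.
  apply: (@le_trans _ _ (a N / N%:R * n%:R)).
    rewrite {1}e1 mulrCA; apply: ler_wpM2l; first exact: divr_ge0.
    by rewrite -natrM ler_nat leq_divM.
  by rewrite ler_wpM2r // ltW.
rewrite ler_pdivrMr // in hK; lra.
Unshelve. all: by end_near. Qed.

Lemma fekete_le (a : nat -> RR) (l x : RR) : (fun n => a n / n%:R) @ \oo --> l ->
  (forall e, 0 < e -> exists c, forall n, a n <= n%:R * (x + e) + c) -> l <= x.
Proof.
move=> /cvgrPdist_le al h; apply/ler_addgt0Pr => e e0.
have e3 : 0 < e / 3 by rewrite divr_gt0.
have [c hc] := h _ e3.
near \oo => n.
have n0 : (0 < n)%N by near: n; exact: nbhs_infty_gt.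
have n0' : 0 < n%:R :> RR by rewrite ltr0n.
have hn : c / (e / 3) <= n%:R by near: n; exact: nbhs_infty_ger.
have : `|l - a n / n%:R| <= e / 3 by near: n; exact: al.
rewrite ler_distlC => /andP[+ _].
have h1 : a n / n%:R <= x + e / 3 + e / 3.
  rewrite ler_pdivrMr //; rewrite ler_pdivrMr // in hn; have := hc n; lra.
lra.
Unshelve. all: by end_near. Qed.

Lemma fekete_ge (a : nat -> RR) (l x : RR) : (fun n => a n / n%:R) @ \oo --> l ->
  (forall e, 0 < e -> exists c, forall n, n%:R * (x - e) - c <= a n) -> x <= l.
Proof.
move=> al h; rewrite -lerN2.
apply: (@fekete_le (fun n => - a n)).
  have -> : (fun n => - a n / n%:R) = (fun n => - (a n / n%:R)).
    by apply: funext => n; rewrite mulNr.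
  exact: cvgN.
move=> e e0; have [c hc] := h _ e0; exists c => n; have := hc n; lra.
Qed.
End Subadditivity.

(** * Existence of the regularized limit and its two bounds, in real terms *)

Section RegularizedLimit.
Variables (RR : realType) (CC : complexLike RR) (B C R : finType).
Local Notation BCR := (((B * C) * R)%type : finType).
Variable r : rop CC BCR BCR.
Hypotheses (pr : psdmx r) (r1 : rtr r = 1).

Definition recover_inf n : RR := inf (recover r n).

Lemma recover_has_inf n : has_inf (recover r n).
Proof.
split; first exact: recover_ne.
by exists 0 => x; exact: recover_ge0.
Qed.

Lemma recover_inf_le n x : recover r n x -> recover_inf n <= x.
Proof. by move=> h; apply: inf_lbound => //; case: (recover_has_inf n). Qed.

Lemma recover_inf_ge n c : (forall x, recover r n x -> c <= x) -> c <= recover_inf n.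
Proof. by move=> h; apply: lb_le_inf; [case: (recover_has_inf n) | exact: h]. Qed.

Lemma recover_infD n m : recover_inf (n + m) <= recover_inf n + recover_inf m.
Proof.
apply/ler_addgt0Pr => e e0; have e2 : 0 < e / 2 by rewrite divr_gt0.
have [x hx lx] := inf_adherent e2 (recover_has_inf n).
have [y hy ly] := inf_adherent e2 (recover_has_inf m).
have := recover_inf_le (recoverD pr r1 hx hy).
move: lx ly; rewrite -/(recover_inf n) -/(recover_inf m); lra.
Qed.

(** The lower bound is stated for every real [m] below the measured values, because their infimum is
    not yet known to be finite. *)
Lemma recover_lim : exists l : RR,
  [/\ (fun n => recover_inf n / n%:R) @ \oo --> l, l <= gcmi r &
  forall m : RR, (forall L (G e' : RR), is_chan L -> 0 < G ->
    psdmx (G%:C *: appid L (mBR r) - r) -> 0 < e' ->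
    exists k (M : 'I_k -> 'M[CC]_#|BCR|), gpovm M /\ m - e' <= cdiv M r (appid L (mBR r))) ->
  m <= l].
Proof.
have [|l hl] := fekete _ recover_infD.
  by move=> n; apply: recover_inf_ge => x; exact: recover_ge0.
exists l; split=> //.
  apply: (fekete_le hl) => e e0.
  pose K : RR := (#|((B * C)%type : finType)| + #|B|)%:R.
  have K0 : 0 <= K by rewrite ler0n.
  (* The slope is so small that the [K] logarithms contribute at most [e / 2] per copy; the other
     half is the parameter of [reg_upper]. *)
  pose d := e / 2 / (K + 1).
  have K1 : 0 < K + 1 by rewrite ltr_wpDl.
  have d0 : 0 < d by rewrite !divr_gt0.
  have Kd : K * d <= e / 2.
    by rewrite /d mulrCA ler_piMr ?divr_ge0 ?(ltW e0) // ler_pdivrMr // mul1r lerDl.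
  exists (K * (d - 1 - ln d)) => n.
  have e2 : 0 < e / 2 by rewrite divr_gt0.
  have [L [cL pL dL hL]] := reg_upper pr r1 e2 n.
  apply: (le_trans (recover_inf_le _)); first by exists L; split; [| | reflexivity].
  apply: (le_trans hL); rewrite -/K.
  have k1 := ler_wpM2l K0 (ln_affine d0 n).
  have k2 := ler_wpM2l (ler0n RR n) Kd.
  rewrite !mulrDr in k1 k2 *; lra.
move=> m Hm; apply: (fekete_ge hl) => e e0.
pose K : RR := #|BCR|%:R.
have K0 : 0 <= K by rewrite ler0n.
pose d := e / 2 / (K + 1).
have K1 : 0 < K + 1 by rewrite ltr_wpDl.
have d0 : 0 < d by rewrite !divr_gt0.
have Kd : K * d <= e / 2.
  by rewrite /d mulrCA ler_piMr ?divr_ge0 ?(ltW e0) // ler_pdivrMr // mul1r lerDl.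
exists (K * (d - 1 - ln d)) => n.
(* [reg_lower] loses three times its parameter, that is [e / 2]. *)
have e6 : 0 < e / 6 by rewrite divr_gt0.
apply: recover_inf_ge => x [L [cL dL ->]].
have := reg_lower pr r1 e6 Hm cL dL; rewrite -/K; apply: le_trans.
have k1 := ler_wpM2l K0 (ln_affine d0 n).
have k2 := ler_wpM2l (ler0n RR n) Kd.
rewrite !mulrDr in k1 k2 *; lra.
Qed.
End RegularizedLimit.

(** * Measured relative entropy and fidelity *)

Section MeasuredFidelity.
Variables (RR : realType) (CC : complexLike RR).

(* If [w] satisfies [w s w = r], measuring its eigenprojections gives outcome
   probabilities with [p_j = w_j ^ 2 q_j], and the sum of the [sqrt (p_j q_j) = w_j q_j]
   is the fidelity. *)
Lemma fuchs_caves n (r s : 'M[CC]_n) : psdmx r -> psdmx s -> dominated r s ->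
  exists w : 'M[CC]_n, [/\ psdmx w, w *m s *m w = r &
    rtr (w *m s) = rtr (gsqrt (gsqrt s *m r *m gsqrt s))].
Proof.
move=> pr ps; have [d [E [rE es d0]]] := psd_resol ps => rs.
pose S := rsum (fun i => Num.sqrt (d i)) E.
have hS : adjm S = S by exact: rsum_adj.
have SS : S *m S = s by rewrite rsum_sqrt.
have -> : gsqrt s = S by rewrite es gsqrt_rsum.
(* The pseudo-inverse of [S], zero off the support; [P] is the support projection of [s]. *)
pose Si := rsum (fun i => if d i == 0 then 0 else (Num.sqrt (d i))^-1) E.
have hSi : adjm Si = Si by exact: rsum_adj.
pose P := rsum (fun i => (d i != 0)%:R : RR) E.
have sq0 i : d i != 0 -> Num.sqrt (d i) != 0.
  by move=> di; rewrite gt_eqF // sqrtr_gt0 lt_neqAle eq_sym di d0.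
have SSi : S *m Si = P.
  rewrite rsum_mul //; congr rsum; apply: funext => i.
  by case: eqP => [|/eqP di]; rewrite ?mulr0 // divff // sq0.
have SiS : Si *m S = P.
  rewrite rsum_mul //; congr rsum; apply: funext => i.
  by case: eqP => [|/eqP di]; rewrite ?mul0r // mulVf // sq0.
have hP : adjm P = P by exact: rsum_adj.
have PS : P *m S = S.
  rewrite rsum_mul //; congr rsum; apply: funext => i.
  by case: eqP => [->|]; rewrite ?mul1r // sqrtr0 mulr0.
have Pr : P *m r = r.
  rewrite -[r in RHS]mul1mx; case: (rE) => _ _ <-; rewrite /P /rsum !mulmx_suml.
  apply: eq_bigr => i _; case: eqP => [di|_]; last by rewrite rmorph1 scale1r.
  by rewrite -scalemxAl (dominated_resol rE _ di) ?scaler0 // -es.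
have rP : r *m P = r by rewrite -{1}(psdmx_herm pr) -hP -adjmM Pr psdmx_herm.
clearbody S Si P.
have [T [pT TT ->]] : exists T, [/\ psdmx T, T *m T = S *m r *m S & gsqrt (S *m r *m S) = T].
  have pSrS : psdmx (S *m r *m S) by rewrite -{2}hS; exact: psdmx_conj.
  by exists (gsqrt (S *m r *m S)); rewrite gsqrt_sqr //; split=> //; exact: gsqrt_psd.
have hT := psdmx_herm pT.
have PT : P *m T = T.
  have : (1%:M - P) *m T = 0.
    apply: gram_tr0; rewrite adjmM hT mulmxA -(mulmxA _ T T) TT !mulmxA.
    by rewrite mulmxBl mul1mx PS subrr !mul0mx rtr0.
  by rewrite mulmxBl mul1mx => /eqP; rewrite subr_eq0 => /eqP.
have TP : T *m P = T by rewrite -{1}hT -hP -adjmM PT.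
(* The matrix geometric mean of [r] and the pseudo-inverse of [s]. *)
exists (Si *m T *m Si); split.
- by rewrite -{2}hSi; exact: psdmx_conj.
- rewrite -SS !mulmxA -(mulmxA _ Si S) SiS -(mulmxA _ S Si) SSi.
  rewrite -(mulmxA Si T P) TP -(mulmxA Si T P) TP -(mulmxA Si T T) TT !mulmxA.
  by rewrite SiS Pr -mulmxA SSi rP.
- rewrite -SS !mulmxA -(mulmxA _ Si S) SiS -(mulmxA Si T P) TP.
  by rewrite rtrC mulmxA SSi PT.
Qed.

(** What remains after the choice of measurement is classical: the Renyi divergence of order one
    half is at most the relative entropy. The clause on zero probabilities keeps the measured
    divergence finite. *)
Lemma measured_ge_fidelity n (r s : 'M[CC]_n) : psdmx r -> rtr r = 1 -> psdmx s ->
  dominated r s ->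
  let F := rtr (gsqrt (gsqrt s *m r *m gsqrt s)) in
  0 < F /\ exists k (M : 'I_k -> 'M[CC]_n), [/\ gpovm M,
    forall j, rtr (M j *m s) = 0 -> rtr (M j *m r) = 0 & - 2 * ln F <= cdiv M r s].
Proof.
move=> pr r1 ps rs F; have [w [pw wsw eF]] := fuchs_caves pr ps rs.
rewrite -/F in eF; have [a [G [rG ew a0]]] := psd_resol pw.
pose p j := rtr (G j *m r); pose q j := rtr (G j *m s).
have pG j := resol_psd j rG.
have p0 j : 0 <= p j by apply: psd_rtrM_ge0.
have q0 j : 0 <= q j by apply: psd_rtrM_ge0.
have pq j : p j = a j ^+ 2 * q j.
  rewrite /p /q -wsw !mulmxA ew rsumEl // -!scalemxAl rtrZ -mulmxA rtrC.
  by rewrite -mulmxA rsumE // -scalemxAr rtrZ [rtr (s *m _)]rtrC mulrA expr2.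
have sF : \sum_j a j * q j = F.
  rewrite -eF rtrC ew rtr_rsum; apply: eq_bigr => j _.
  by rewrite /q rtrC.
have sp : \sum_j p j = 1.
  by rewrite -rtr_sum -mulmx_suml; case: rG => _ _ ->; rewrite mul1mx.
have F0 : 0 < F.
  have F0 : 0 <= F by rewrite -sF sumr_ge0 // => j _; exact: mulr_ge0.
  rewrite lt_neqAle F0 andbT eq_sym; apply/eqP => Fz.
  have : \sum_j p j = 0.
    rewrite big1 // => j _; rewrite pq expr2 -mulrA.
    have /allP h : all (fun j => (true ==> (a j * q j == 0))) (index_enum _).
      by rewrite -psumr_eq0 ?sF ?Fz // => k _; exact: mulr_ge0.
    by have /= /eqP -> := h j (mem_index_enum j); rewrite mulr0.
  by rewrite sp => /eqP; rewrite oner_eq0.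
split=> //; exists n, G; split.
- by split => //; case: rG.
- by move=> j; rewrite -/(q j) -/(p j) pq => ->; rewrite mulr0.
(* Jensen's inequality in tangent form: [p j] and [a j * q j / F] both sum to one, so their
   difference can be inserted term by term. *)
have -> : - 2 * ln F = \sum_j 2 * (p j - a j * q j / F - p j * ln F).
  rewrite -mulr_sumr !big_split /= !sumrN -!mulr_suml sp sF divff ?gt_eqF //.
  by ring.
apply: ler_sum => j _; rewrite -/(p j) -/(q j).
have [pj|pj] := eqVneq (p j) 0.
  rewrite pj !mul0r; have : 0 <= a j * q j / F.
    by rewrite divr_ge0 ?mulr_ge0 // ltW.
  lra.
have pj0 : 0 < p j by rewrite lt_neqAle eq_sym pj p0.
have qj0 : 0 < q j.
  by rewrite lt_neqAle q0 andbT eq_sym; apply: contraNneq pj => qj; rewrite pq qj mulr0.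
have aj0 : 0 < a j.
  by rewrite lt_neqAle a0 andbT eq_sym; apply: contraNneq pj => aj; rewrite pq aj expr2 !mul0r.
have lnp : ln (p j) = 2 * ln (a j) + ln (q j).
  by rewrite pq lnM ?posrE ?exprn_gt0 // lnXn // mulr_natl.
have h := ln_ge_1subV (mulr_gt0 aj0 F0).
have h2 : p j - a j * q j / F <= p j * (ln (a j) + ln F).
  rewrite -lnM ?posrE //; apply: le_trans (ler_wpM2l (ltW pj0) h).
  suff -> : p j * (1 - (a j * F)^-1) = p j - a j * q j / F by [].
  by rewrite pq; field; rewrite !gt_eqF.
rewrite lnp; move: h2; lra.
Qed.
End MeasuredFidelity.

(** * Relative, measured and Renyi divergences with values in the extended reals *)

Section Divergences.
Variables (RR : realType) (CC : complexLike RR).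
Implicit Types X : finType.
Local Open Scope ereal_scope.

Definition gqrel n (r s : 'M[CC]_n) : \bar RR :=
  if (r <= s)%MS then (rtr (r *m (glog r - glog s)))%:E else +oo.

Definition gqc X k (M : 'I_k -> rop CC X X) (r : rop CC X X) : rop CC 'I_k 'I_k :=
  rmk (fun i j => (i == j)%:R * \tr (M i *m r))%R.

Definition gmeasured X (r s : rop CC X X) : \bar RR :=
  ereal_sup [set x | exists (k : nat) (M : 'I_k -> rop CC X X),
    gpovm M /\ x = gqrel (gqc M r) (gqc M s)].

Definition gfidelity X (r s : rop CC X X) : RR := rtr (gsqrt (gsqrt s *m r *m gsqrt s)).

Definition grenyi X (r s : rop CC X X) : \bar RR :=
  if gfidelity r s == 0%R then +oo else (- 2 * ln (gfidelity r s))%:E.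

(** Taking adjoints turns row-space inclusion into kernel inclusion; the converse tests the cokernel
    of [s]. *)
Lemma submx_dominated n (r s : 'M[CC]_n) : adjm r = r -> adjm s = s ->
  (r <= s)%MS <-> dominated r s.
Proof.
move=> hr hs; split=> [/submxP[D e] v v0|h].
  by rewrite -hr e adjmM hs mulmxA v0 mul0mx.
rewrite submxE; apply/eqP; have c0 := mulmx_coker s.
have : (adjm (cokermx s) *m s = 0)%R by rewrite -{2}hs -adjmM c0 adjm0.
by move/(dominated_mx h)/(congr1 (@adjm _ _ _ _)); rewrite adjmM adjmK hr adjm0.
Qed.

Lemma gqrelE n (r s : 'M[CC]_n) : adjm r = r -> adjm s = s -> dominated r s ->
  gqrel r s = (tlog r r - tlog r s)%:E.
Proof.
move=> hr hs /(submx_dominated hr hs) h.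
by rewrite /gqrel h mulmxBr rtrB.
Qed.

Lemma gqrel_pinfty n (r s : 'M[CC]_n) : adjm r = r -> adjm s = s -> ~ dominated r s ->
  gqrel r s = +oo.
Proof.
by move=> hr hs h; rewrite /gqrel; case: ifPn => // /(submx_dominated hr hs).
Qed.

Lemma unitop_resol X : resol (fun x : X => unitop CC x x).
Proof.
split=> [x|x y|]; last exact: sum_unitop.
  apply: ropP => a b; rewrite rent_adj !rentE rmorphM !rmorph_nat.
  by rewrite mulrC.
apply: ropP => a b; rewrite rent_mul.
under eq_bigr => c _ do rewrite !rentE.
rewrite (bigD1 x) //= big1 ?addr0; last by move=> c /negbTE cx; rewrite cx !(mulr0, mul0r).
rewrite eqxx mulr1; case: (eqVneq x y) => [<-|xy].
  by rewrite mul1r !rentE.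
by rewrite mul0r mulr0 rent0.
Qed.

Lemma gqcE X k (M : 'I_k -> rop CC X X) (r : rop CC X X) : gpovm M -> psdmx r ->
  gqc M r = rsum (fun i => rtr (M i *m r)) (fun i => unitop CC i i).
Proof.
move=> [pM _] pr; apply: ropP => a b; rewrite rentE rent_sum.
under eq_bigr => c _ do rewrite rentZ rentE.
rewrite (bigD1 a) //= big1 ?addr0; last by move=> c /negbTE ca; rewrite (eq_sym a) ca mul0r mulr0.
rewrite eqxx mul1r (eq_sym b) mulrC rtrE re_ge0K //.
exact: psd_trM_ge0.
Qed.

Lemma gqc_dominated X k (M : 'I_k -> rop CC X X) (r s : rop CC X X) :
  gpovm M -> psdmx r -> psdmx s ->
  dominated (gqc M r) (gqc M s) <->
  (forall j, rtr (M j *m s) = 0 -> rtr (M j *m r) = 0)%R.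
Proof.
move=> pM pr ps; have rU := unitop_resol 'I_k; rewrite !gqcE //; split=> [h j qj|h v v0].
  have := dominated_resol rU h qj; rewrite (rsumEl _ _ rU) => /(congr1 (fun A => rent A j j)).
  rewrite rentZ rentE rent0 eqxx !mulr1 => /(congr1 re).
  by rewrite reK re0.
rewrite -[X in v *m X]mul1mx; case: (rU) => _ _ <-; rewrite mulmx_suml mulmx_sumr big1 // => j _.
rewrite (rsumEl _ _ rU) -scalemxAr.
have := congr1 (mulmx^~ (unitop CC j j)) v0; rewrite /= -mulmxA (rsumE _ _ rU) mul0mx -scalemxAr.
move/eqP; rewrite scaler_eq0 => /orP[|/eqP ->]; last by rewrite scaler0.
by rewrite fmorph_eq0 => /eqP /h ->; rewrite rmorph0 scale0r.
Qed.

Lemma gqrel_gqc X k (M : 'I_k -> rop CC X X) (r s : rop CC X X) :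
  gpovm M -> psdmx r -> psdmx s ->
  (forall j, rtr (M j *m s) = 0 -> rtr (M j *m r) = 0)%R ->
  gqrel (gqc M r) (gqc M s) = (cdiv M r s)%:E.
Proof.
move=> pM pr ps h; have rU := unitop_resol 'I_k.
have tU (j : 'I_k) : rtr (unitop CC j j) = 1%R.
  rewrite rtrE tr_rent (bigD1 j) //= big1 ?addr0; last first.
    by move=> c /negbTE cj; rewrite rentE cj mul0r.
  by rewrite rentE eqxx mulr1 -(rmorph1 ofR) reK.
rewrite gqrelE; last exact/gqc_dominated.
- congr EFin; rewrite !gqcE // !tlog_rsum // -sumrB; apply: eq_bigr => j _.
  by rewrite rsumE // rtrZ tU mulr1 -mulrBl mulrC.
- by rewrite gqcE // rsum_adj.
- by rewrite gqcE // rsum_adj.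
Qed.

(** When the support condition fails, the measured side is [+oo]: some eigenprojection of [s] has
    probability zero under [s] but not under [r]. *)
Lemma grenyi_le_measured X (r s : rop CC X X) : psdmx r -> rtr r = 1%R -> psdmx s ->
  grenyi r s <= gmeasured r s.
Proof.
move=> pr r1 ps; have [rs|nrs] := pselect (dominated r s).
  have [F0 [k [M [pM h hF]]]] := measured_ge_fidelity pr r1 ps rs.
  rewrite /grenyi /gfidelity gt_eqF //.
  apply: (@le_trans _ _ (cdiv M r s)%:E); first by rewrite lee_fin.
  by apply: ereal_sup_ubound; exists k, M; split=> //; rewrite gqrel_gqc.
suff -> : gmeasured r s = +oo by rewrite leey.
apply/eqP; rewrite -leye_eq.
have [d [E [rE es d0]]] := psd_resol ps.
have [i [di Er]] : exists i, d i = 0%R /\ E i *m r <> 0%R.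
  apply: contrapT => h; apply: nrs => v v0.
  rewrite -[r]mul1mx; case: (rE) => _ _ <-; rewrite mulmx_suml mulmx_sumr big1 // => i _.
  rewrite mulmxA; have [di|di] := eqVneq (d i) 0%R.
    by rewrite -mulmxA; have -> : E i *m r = 0%R; [apply: contrapT => h'; apply: h; exists i | rewrite mulmx0].
  have := congr1 (mulmx^~ (E i)) v0; rewrite /= es -mulmxA rsumE // mul0mx -scalemxAr.
  move/eqP; rewrite scaler_eq0 fmorph_eq0 (negbTE di) /= => /eqP ->; exact: mul0mx.
have pE : gpovm E by split; [move=> j; exact: resol_psd | case: rE].
apply: ereal_sup_ubound; exists _, E; split=> //.
rewrite gqrel_pinfty //.
- by rewrite gqcE // rsum_adj //; exact: unitop_resol.
- by rewrite gqcE // rsum_adj //; exact: unitop_resol.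
move=> /(gqc_dominated pE pr ps) /(_ i) h; apply: Er.
have hE : adjm (E i) = E i by case: rE.
have EE : E i *m E i = E i by case: rE => _ -> _; rewrite eqxx.
apply: psd_ker => //; rewrite hE rtrC mulmxA EE h //.
by rewrite es rsumEl // di rmorph0 scale0r rtr0.
Qed.
End Divergences.

(** * The complex numbers over [RR] as an instance of the interface *)

Section Instance.
Variable RR : realType.

Lemma Re_real_mul (a : RR) (z : RR[i]) :
  complex.Re (real_complex RR a * z) = a * complex.Re z.
Proof. by case: z => x y; rewrite /= mul0r subr0. Qed.

Lemma Re_conj (z : RR[i]) : complex.Re (Num.conj z) = complex.Re z.
Proof. by case: z. Qed.

Lemma conj_real (a : RR) : Num.conj (real_complex RR a) = real_complex RR a.
Proof. by apply/eqP; rewrite eq_complex /= oppr0 !eqxx. Qed.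

Lemma real_Re (z : RR[i]) : z \is Num.real -> real_complex RR (complex.Re z) = z.
Proof. by move=> /complex_realP[x ->]. Qed.

Lemma Re_add (x y : RR[i]) : complex.Re (x + y) = complex.Re x + complex.Re y.
Proof. by case: x y => [? ?] [? ?]. Qed.

Lemma real_ge0 (a : RR) : (0 <= real_complex RR a) = (0 <= a).
Proof. by rewrite lecE /= eqxx. Qed.

Definition complexC : complexLike RR :=
  @ComplexLike RR (RR[i]) (real_complex RR) (@complex.Re RR)
    Re_add (fun a => erefl) Re_real_mul Re_conj conj_real real_Re real_ge0.
End Instance.

Local Open Scope ereal_scope.

(** * The chain of inequalities in terms of channels, entropies and divergences *)

Section RecoverabilityBound.
Variables (RR : realType) (CC : complexLike RR) (B C R : finType).
Local Notation BCR := (((B * C) * R)%type : finType).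

Definition gmarg_BR (r : rop CC BCR BCR) : rop CC (B * R)%type (B * R)%type :=
  rmk (fun x y : B * R => \sum_(c : C) rent r ((x.1, c), x.2) ((y.1, c), y.2))%R.
Definition gmarg_BC (r : rop CC BCR BCR) : rop CC (B * C)%type (B * C)%type :=
  rmk (fun x y => \sum_(k : R) rent r (x, k) (y, k))%R.
Definition gmarg_B (r : rop CC BCR BCR) : rop CC B B :=
  rmk (fun b b' => \sum_(c : C) \sum_(k : R) rent r ((b, c), k) ((b', c), k))%R.

Lemma gmarg_BRE r : gmarg_BR r = mBR r.
Proof. by apply: ropP => x y; rewrite rentE mBRE. Qed.

Lemma gmarg_BE r : gmarg_B r = ptr (mBR r).
Proof.
apply: ropP => x y; rewrite !rentE exchange_big; apply: eq_bigr => k _.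
by rewrite mBRE.
Qed.

Definition gentropy n (r : 'M[CC]_n) : RR := (- rtr (r *m glog r))%R.

Lemma gcmi_entropy r : (gentropy (gmarg_BC r) + gentropy (gmarg_BR r)
  - gentropy r - gentropy (gmarg_B r))%R = gcmi r.
Proof. by rewrite gmarg_BRE gmarg_BE /gcmi /gentropy /tlog; ring. Qed.

Definition gregularized (r : rop CC BCR BCR) (n : nat) : \bar RR :=
  ((n%:R)^-1)%:E * ereal_inf [set x | exists L, is_chan L /\
     x = gqrel (tpe (@eBCR B C R n) (fun=> r))
       (appid L (tpe (@eBC B R n) (fun=> gmarg_BR r)))].

Definition gmin_measured (r : rop CC BCR BCR) : \bar RR :=
  ereal_inf [set x | exists L : rop CC B B -> rop CC (B * C)%type (B * C)%type,
     is_chan L /\ x = gmeasured r (appid L (gmarg_BR r))].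

Definition gmin_renyi (r : rop CC BCR BCR) : \bar RR :=
  ereal_inf [set x | exists L : rop CC B B -> rop CC (B * C)%type (B * C)%type,
     is_chan L /\ x = grenyi r (appid L (gmarg_BR r))].

Variable r : rop CC BCR BCR.
Hypotheses (pr : psdmx r) (r1 : rtr r = 1%R).

(** Channels violating the support condition contribute [+oo], and [recover] is nonempty and bounded
    below, so the extended infimum is real. *)
Lemma gregularizedE n : gregularized r n = (recover_inf r n / n%:R)%:E.
Proof.
rewrite [RHS]EFinM muleC /gregularized gmarg_BRE; congr (_ * _).
have [ne lb] := recover_has_inf pr r1 n.
rewrite -ereal_inf_EFin //.
have hr := psdmx_herm (tpr_psd pr n).
have hB L : is_chan L -> adjm (appid L (tpB r n)) = appid L (tpB r n).
  by move=> cL; apply/psdmx_herm/chan_appid_psd => //; exact: tpB_psd.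
apply/eqP; rewrite eq_le; apply/andP; split; apply: le_ereal_inf_tmp.
  move=> _ [x [L [cL dL ->]] <-]; apply: ereal_inf_lbound; exists L; split; first exact: cL.
  by rewrite gqrelE; [|exact: hr|exact: hB|exact: dL].
move=> _ [L [cL ->]]; have [dL|dL] := pselect (dominated (tpr r n) (appid L (tpB r n))).
  apply: ereal_inf_lbound; exists (tlog (tpr r n) (tpr r n) - tlog (tpr r n) (appid L (tpB r n)))%R.
    by exists L; split.
  by rewrite gqrelE; [|exact: hr|exact: hB|exact: dL].
by rewrite gqrel_pinfty; [exact: leey|exact: hr|exact: hB|exact: dL].
Qed.

(** Passes from the supremum in the extended reals to the real hypothesis of the minimax part;
    domination by [G] makes each measured value finite. *)
Lemma measured_approx (m : RR) : m%:E <= gmin_measured r ->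
  forall L (G e : RR), is_chan L -> (0 < G)%R ->
    psdmx (G%:C *: appid L (mBR r) - r)%R -> (0 < e)%R ->
    exists k (M : 'I_k -> 'M[CC]_#|BCR|), gpovm M /\ (m - e <= cdiv M r (appid L (mBR r)))%R.
Proof.
move=> hm L G e cL G0 hG e0.
have ps : psdmx (appid L (mBR r)) by apply: chan_appid_psd => //; exact: mBR_psd.
have : (m - e)%:E < gmeasured r (appid L (mBR r)).
  apply: (@lt_le_trans _ _ m%:E); first by rewrite lte_fin ltrBlDr ltrDl.
  apply: (le_trans hm); apply: ereal_inf_lbound; exists L; split; first exact: cL.
  by rewrite gmarg_BRE.
move=> /ereal_sup_gt[_ [k [M [pM ->]]]]; rewrite gqrel_gqc //.
  by rewrite lte_fin => /ltW h; exists k, M.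
move=> j qj; apply/eqP; rewrite eq_le; have [pMj _] := pM.
rewrite psd_rtrM_ge0 // andbT.
by have := psd_rtrM_ge0 (pMj j) hG; rewrite mulmxBr -scalemxAr rtrB rtrZ qj mulr0 sub0r oppr_ge0.
Qed.

Lemma recoverability_bound : exists l : \bar RR,
  [/\ gregularized r @ \oo --> l, l <= (gcmi r)%:E, gmin_measured r <= l
    & gmin_renyi r <= gmin_measured r].
Proof.
have [l [al lI lm]] := recover_lim pr r1.
exists l%:E; split.
- have -> : gregularized r = EFin \o (fun n => recover_inf r n / n%:R)%R.
    by apply: funext => n; rewrite gregularizedE.
  by apply: cvg_EFin => //; near=> n.
- by rewrite lee_fin.
- rewrite leNgt; apply/negP => lt_l.
  (* The minimum could a priori be [+oo], so a real number strictly above [l] is placed below it. *)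
  have [m hm lm'] : exists2 m : RR, m%:E <= gmin_measured r & (l < m)%R.
    case: (gmin_measured r) lt_l => [x||//].
      by rewrite lte_fin => lx; exists x.
    by exists (l + 1)%R; rewrite ?leey // ltrDl.
  by have := lm m (measured_approx hm); rewrite leNgt lm'.
- apply: le_ereal_inf_tmp => _ [L [cL ->]].
  apply: (@le_trans _ _ (grenyi r (appid L (gmarg_BR r)))).
    by apply: ereal_inf_lbound; exists L; split; first exact: cL.
  apply: grenyi_le_measured => //; rewrite gmarg_BRE.
  by apply: chan_appid_psd => //; exact: mBR_psd.
Unshelve. all: by end_near. Qed.

End RecoverabilityBound.

Transparent psdmx rtr fcalc adjm gsqrt rootmx.

Theorem theorem1 (RR : realType) (B C R : finType) (rho : op RR ((B * C) * R)%type) :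
  density rho ->
  exists lim_val : \bar RR,
    [/\ regularized_term rho @ \oo --> lim_val,
        lim_val <= (cmi rho)%:E,
        min_measured rho <= lim_val
      & min_renyi_half rho <= min_measured rho].
Proof.
move=> [prho trho].
have rtr1 : @rtr RR (complexC RR) _ rho = 1%R by apply: (congr1 (@complex.Re RR) trho).
have [l [lim_l l_cmi meas_l renyi_meas]] :=
  @recoverability_bound RR (complexC RR) B C R rho prho rtr1.
(* The generic notions repeat the stated ones, so these clauses hold by conversion; only the mutual
   information has to be regrouped into entropies. *)
exists l; split; [exact: lim_l | | exact: meas_l | exact: renyi_meas].
by rewrite -(gcmi_entropy (rho : rop (complexC RR) _ _)) in l_cmi.
Qed.
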